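(* Let $\mathbf{P}$ be the law of the limiting forest $\{T(v)\}_{v\in\partial\mathbb{H}}$, $T(v)=\bigcup_{t\ge 0}T(v,t)$, of the Stretched IDLA process on the oriented half-plane lattice $\mathbb{H}$. Then $$\mathbf{P}\big(\forall v\in\partial\mathbb{H},\ |T(v)|<\infty\big)=1 .$$
   Context: **Lattice.** $\mathbb{H}=\{(x,y)\in\mathbb{Z}^2: x+y\in 2\mathbb{Z},\ y\ge 0\}$, $\theta_l=(-1,1)$, $\theta_r=(1,1)$. It is a directed graph: each $v\in\mathbb{H}$ has exactly the outgoing edges $(v,v+\theta_l)$ and $(v,v+\theta_r)$; $\mathcal{E}$ is the set of directed edges. $\partial\mathbb{H}=\{(x,0):x\in 2\mathbb{Z}\}$. **Stretched IDLA (SIDLA).** To each $v\in\partial\mathbb{H}$ and $t\ge 0$ is associated a tree $T(v,t)\subset\mathcal{E}$ rooted at $v$, increasing in $t$. A vertex $u$ is said to belong to $T(v,t)$ if $u=v$ or $u$ is an endpoint of an edge of $T(v,t)$. At time $0$, $T(v,0)=\emptyset$ (no edges) for all $v$. The vertices $v\in\partial\mathbb{H}$ carry independent Poisson clocks of rate $1$. Whenever the clock at $u\in\partial\mathbb{H}$ rings, at time $t_0$ say, a particle starts at $u$ and instantaneously performs an oriented random walk (independent of everything else), using the trees as they are just before time $t_0$, by the following rule: 1. Being at a vertex $w$ of the tree of $u$, the particle chooses $a\in\{w+\theta_l,w+\theta_r\}$ with probability $\tfrac12$ each. 2. If $a$ belongs to no tree, the edge $(w,a)$ is added to the tree of $u$,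 and the particle stops. 3. If $a$ belongs to the tree of some root other than $u$, or if $a$ belongs to the tree of $u$ but the edge $(w,a)$ is not in the tree of $u$, the particle vanishes and nothing is added. 4. Otherwise (the edge $(w,a)$ is in the tree of $u$) the particle moves to $a$ and continues from step 1. This is well defined almost surely, because each edge can be reached by directed paths from only finitely many vertices of $\partial\mathbb{H}$, so its state up to time $t$ depends on only finitely many clock rings. $T(v,t)$ is the tree of $v$ at time $t$, $T(v)=\bigcup_{t\ge0}T(v,t)$, and $|T(v)|$ is the number of edges of $T(v)$. *)

(* Defs.v *)
From HB Require Import structures.
From mathcomp Require Export all_boot all_order all_algebra.
From mathcomp Require Export all_classical all_reals all_analysis.
#[export] Set Implicit Arguments.
#[export] Unset Strict Implicit.
#[export] Unset Printing Implicit Defensive.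
Export Order.TTheory GRing.Theory Num.Theory.

#[global] Open Scope classical_set_scope.
#[global] Open Scope ring_scope.

Definition vertex : Type := (int * int)%type.
Definition edge : Type := (vertex * vertex)%type.

Definition halfplane (v : vertex) : bool := (2 %| v.1 + v.2)%Z && (0 <= v.2).
Definition boundary (v : vertex) : bool := (2 %| v.1)%Z && (v.2 == 0).
Definition Root := {v : vertex | boundary v}.

(* [false] is a step along (-1,1), [true] a step along (1,1) *)
Definition step (b : bool) (v : vertex) : vertex :=
  (if b then v.1 + 1 else v.1 - 1, v.2 + 1).

Definition lattice_edge : set edge :=
  [set e | halfplane e.1 /\ exists b, e.2 = step b e.1].

Definition in_tree (v : Root) (A : set edge) (a : vertex) : Prop :=
  a = val v \/ exists2 e, A e & (a = e.1 \/ a = e.2).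

Section particle.
Variables (F : Root -> set edge) (* the trees just before the particle starts *)
          (u : Root)
          (dir : nat -> bool).   (* dir k: direction chosen at the k-th step *)

Definition unoccupied (a : vertex) : Prop := forall v, ~ in_tree v (F v) a.

Definition blocked (w a : vertex) : Prop :=
  (exists2 v, v <> u & in_tree v (F v) a) \/
  (in_tree u (F u) a /\ ~ F u (w, a)).

Inductive particle_at : nat -> vertex -> Prop :=
| particle_start : particle_at 0 (val u)
| particle_move k w : particle_at k w ->
    ~ unoccupied (step (dir k) w) -> ~ blocked w (step (dir k) w) ->
    particle_at k.+1 (step (dir k) w).

Definition particle_adds (e : edge) : Prop :=
  exists k w, [/\ particle_at k w,
                  unoccupied (step (dir k) w) & e = (w, step (dir k) w)].
End particle.

Section evolution.
Variable R : realType.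
Implicit Types (T : Root -> R -> set edge) (t : R).

Definition forest_before T t (v : Root) : set edge :=
  \bigcup_(s in [set s : R | 0 <= s < t]) T v s.

(* [clock u n] is the time of the n-th ring at u, and [dir u n] the directions
   available to the particle started at that ring.  The last clause says that
   the tree of u changes only at the rings of u, by the edge (if any) which is
   added by the particle started there; when all the ring times are positive it
   implies the other three. *)
Record is_sidla (clock : Root -> nat -> R) (dir : Root -> nat -> nat -> bool)
    T : Prop := {
  sidla_edges : forall v t, 0 <= t -> T v t `<=` lattice_edge ;
  sidla_mono : forall v s t, 0 <= s -> s <= t -> T v s `<=` T v t ;
  sidla0 : forall v, T v 0 = set0 ;
  sidla_rule : forall u t, 0 <= t ->
    T u t = \bigcup_(n in [set n | clock u n <= t])
              [set e | particle_adds (forest_before T (clock u n)) u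
                         (dir u n) e] }.

Definition limit_tree T (v : Root) : set edge :=
  \bigcup_(t in [set t : R | 0 <= t]) T v t.
End evolution.

Section randomness.
Context {R : realType} {d : measure_display} {Omega : measurableType d}.
Variable P : probability Omega R.

Definition mutually_independent (I : choiceType)
    (G : I -> set (set Omega)) : Prop :=
  forall (J : seq I) (A : I -> set Omega), uniq J ->
    (forall i, i \in J -> G i (A i)) ->
    P (\bigcap_(i in [set` J]) A i) = (\prod_(i <- J) P (A i))%E.

Definition sigma_of d' (S : measurableType d') (X : Omega -> S) :
  set (set Omega) := preimage_set_system setT X measurable.

(* A Poisson clock of rate 1 is given by its independent exponential waiting
   times: [gap u n] is the time between rings n-1 and n at u (between time 0
   and the first ring for n = 0).  [coin u n k] is the k-th direction chosen by
   the particle started at the n-th ring at u. *)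
Definition ring_time (gap : Root -> nat -> {RV P >-> R}) (omega : Omega)
  (u : Root) (n : nat) : R := \sum_(i < n.+1) gap u i omega.

Definition driving_sigma (gap : Root -> nat -> {RV P >-> R})
    (coin : Root -> nat -> nat -> {RV P >-> bool})
    (i : (Root * nat + Root * nat * nat)%type) : set (set Omega) :=
  match i with
  | inl (u, n) => sigma_of (gap u n)
  | inr (u, n, k) => sigma_of (coin u n k)
  end.

Record sidla_randomness (gap : Root -> nat -> {RV P >-> R})
    (coin : Root -> nat -> nat -> {RV P >-> bool}) : Prop := {
  gap_exponential : forall u n (A : set R), measurable A ->
    distribution P (gap u n) A = exponential_prob 1 A ;
  coin_fair : forall u n k (A : set bool),
    distribution P (coin u n k) A = bernoulli_prob (2^-1 : R) A ;
  driving_independent : mutually_independent (driving_sigma gap coin) }.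
End randomness.

(* Main.v *)
From HB Require Import structures.
From mathcomp Require Import zify ring lra measurable_realfun.
Require Import Defs.

(** Write (i, y) for the vertex (2 i - y, y), whose parents are (i - 1, y - 1) and
    (i, y - 1).  Conditionally on the clocks and on the first y coins of every
    particle, which determine the forest up to level y, the competition for the
    vertices of level y + 1 is decided by the independent coins of index y.

    The root of the tree of (i, y) is nondecreasing in i, so level y is cut into
    blocks of vertices with a common root, and by translation invariance the
    probability that a given tree reaches level y is the density delta_y of the
    blocks.  The difference delta_y - delta_(y+1) is the density of the blocks of
    length 1 which die out, hence it tends to 0.

    A particle reaches a given vertex of its tree at level y with probability 2^-y.
    Therefore, uniformly in y, with probability close to 1 at least two and at most
    boundedly many particles reach a given vertex of level y by time B 2^y.  On
    this event one can prescribe boundedly many coins, at the price of a constant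
    factor, to the effect that the outer vertices on both sides of a block of length
    k > 1 win both children at its ends, so that its length drops to k - 1.  If
    k = 1 this requires that the right neighbour be reached before the vertex
    itself; but one can decrease the number of particles which reach the vertex
    first, because one of them is absorbed at the next level.  By induction, the
    density of the blocks of any fixed length tends to 0, and so does delta_y, since
    the density of the blocks longer than K is at most 1 / (K + 1). *)

(** * Independent coordinates *)

Section product_space.
Variables (I : choiceType) (R : realType).

(** With infinitely many clocks there is no first ring, so the process cannot be followed ring by
    ring. It is replaced by a recursion on levels: [st] computes, from its two parents alone, the
    root, the ring and the path by which a vertex joins. All estimates concern [st] on a space of
    independent real coordinates; the given process is identified with it pathwise, outside a null
    event. The decrements of [delta] vanish, but at no known rate, so each local modification must
    cost a factor that does not depend on the level. This dictates the time scale: only by times of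
    order [2 ^+ y] is the number of arrivals both positive and bounded with high probability. Two
    arrivals are asked for because the first may stop in creating a child, and the second carries
    the argument to the next level. Arrivals must not be biased by the way in which the vertex
    joined; the ring index at which it joined acts as a stopping time for the clock of its root, see
    [causality]. The coins to be prescribed are random as well, which [pr_force] handles by a
    countable partition. *)

Definition noise : Type := I -> R.

Definition cylinder (s : seq I) (B : I -> set R) : set noise :=
  [set x | forall i, i \in s -> B i (x i)].

Definition cylinders : set (set noise) :=
  [set A | exists s B, (forall i, measurable (B i)) /\ A = cylinder s B].

Lemma noise_sigma_algebraC (A : set noise) :
  <<s cylinders >> A -> <<s cylinders >> (~` A).
Proof. by move=> sA; rewrite -setTD; exact: sigma_algebraCD. Qed.

HB.instance Definition _ := gen_eqMixin noise.
HB.instance Definition _ := gen_choiceMixin noise.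
HB.instance Definition _ := isPointed.Build noise (fun=> 0).
HB.instance Definition _ := @isMeasurable.Build (sigma_display cylinders) noise
  <<s cylinders >> (@sigma_algebra0 _ setT cylinders) noise_sigma_algebraC
  (@sigma_algebra_bigcup _ setT cylinders).

End product_space.

(** * Events that depend on given coordinates, and their independence *)

Section events.
Variables (I : choiceType) (R : realType).
Local Notation noise := (noise I R).
Local Notation cylinders := (@cylinders I R).

Lemma measurable_cylinder s B : (forall i, measurable (B i)) ->
  measurable (cylinder s B : set noise).
Proof. by move=> mB; apply: sub_gen_smallest; exists s, B. Qed.

Lemma cylinders_setI : setI_closed cylinders.
Proof.
move=> _ _ [s [B [mB ->]]] [t [C [mC ->]]]; exists (s ++ t).
exists (fun i => (if i \in s then B i else setT) `&`
                 (if i \in t then C i else setT)); split.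
  by move=> i; apply: measurableI; case: ifP.
apply/seteqP; split=> x.
  move=> [Bx Cx] i _; split; case: ifPn => // ?; [exact: Bx|exact: Cx].
move=> BCx; split=> i si.
  by have [] := BCx i; rewrite ?mem_cat ?si.
by have [] := BCx i; rewrite ?mem_cat ?si ?orbT.
Qed.

Lemma measurable_noise d (T : measurableType d) (f : T -> noise) :
  (forall i, measurable_fun setT (fun w => f w i)) -> measurable_fun setT f.
Proof.
move=> mf; apply: (measurability cylinders) => //.
move=> _ -[_ [s [B [mB ->]]] <-]; rewrite setTI.
rewrite [X in measurable X](_ : _ = \big[setI/setT]_(i <- s)
    ((fun w => f w i) @^-1` B i)); last first.
  rewrite -bigcap_seq; apply/seteqP; split=> w //=.
apply: bigsetI_measurable => i _; rewrite -[X in measurable X]setTI.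
exact: mf.
Qed.

Lemma measurable_coord i : measurable_fun setT (fun x : noise => x i : R).
Proof.
move=> _ B mB; rewrite setTI.
rewrite [X in measurable X](_ : _ = cylinder [:: i] (fun=> B)).
  exact: measurable_cylinder.
by apply/seteqP; split=> x /= => [Bx j|/(_ i)]; rewrite inE ?eqxx; [move/eqP->|apply].
Qed.

(** Measurability with respect to the coordinates in [J], split into plain measurability and
    invariance when the other coordinates change. Both halves pass through the logical connectives,
    and [keep] recombines them. *)
Definition ev (J : I -> Prop) (Q : noise -> Prop) : Prop :=
  measurable [set x | Q x] /\
  forall x x' : noise, (forall i, J i -> x i = x' i) -> Q x -> Q x'.

Definition evf (J : I -> Prop) (f : noise -> R) : Prop :=
  measurable_fun setT f /\
  forall x x' : noise, (forall i, J i -> x i = x' i) -> f x = f x'.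

Lemma ev_sub (J K : I -> Prop) Q : (forall i, J i -> K i) -> ev J Q -> ev K Q.
Proof. by move=> JK [mQ JQ]; split=> // x x' e; apply: JQ => i /JK /e. Qed.

Lemma ev_ext J Q Q' : (forall x, Q x <-> Q' x) -> ev J Q -> ev J Q'.
Proof. by move=> QQ' [mQ JQ]; rewrite (_ : Q' = Q)//; apply/funext => x; apply/propext;
  split=> /QQ'. Qed.

Lemma ev_cst J (Q : Prop) : ev J (fun=> Q).
Proof.
by split=> //; have [/propT ->|/propF ->] := pselect Q;
  [rewrite (_ : mkset _ = setT)|rewrite (_ : mkset _ = set0)] => //; apply/seteqP; split.
Qed.

Lemma ev_not J Q : ev J Q -> ev J (fun x => ~ Q x).
Proof.
move=> [mQ JQ]; split; first exact: measurableC.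
by move=> x x' e nQ Qx; apply: nQ; apply: JQ Qx => i /e.
Qed.

Lemma ev_and J Q Q' : ev J Q -> ev J Q' -> ev J (fun x => Q x /\ Q' x).
Proof.
move=> [mQ JQ] [mQ' JQ']; split; first exact: measurableI.
by move=> x x' e [Qx Q'x]; split; [exact: JQ Qx|exact: JQ' Q'x].
Qed.

Lemma ev_or J Q Q' : ev J Q -> ev J Q' -> ev J (fun x => Q x \/ Q' x).
Proof.
move=> [mQ JQ] [mQ' JQ']; split; first exact: measurableU.
by move=> x x' e [Qx|Q'x]; [left; exact: JQ Qx|right; exact: JQ' Q'x].
Qed.

Lemma ev_imp J Q Q' : ev J Q -> ev J Q' -> ev J (fun x => Q x -> Q' x).
Proof.
move=> eQ eQ'; apply: ev_ext (ev_or (ev_not eQ) eQ') => x.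
by split=> [[]//|QQ']; have [/QQ'|] := pselect (Q x); [right|left].
Qed.

Lemma ev_exists J (T : countType) (Q : T -> noise -> Prop) :
  (forall a, ev J (Q a)) -> ev J (fun x => exists a, Q a x).
Proof.
move=> eQ; split; last first.
  by move=> x x' e [a Qa]; exists a; case: (eQ a) => _; apply; [exact: e|].
rewrite [X in measurable X](_ : _ = \bigcup_(n : nat)
    (if unpickle n is Some a then [set x | Q a x] else set0)).
  by apply: bigcupT_measurable => n; case: unpickle => // a; case: (eQ a).
apply/seteqP; split=> x /=.
  by move=> [a Qa]; exists (pickle a); rewrite ?pickleK.
by move=> [n _]; case: unpickle => // a Qa; exists a.
Qed.

Lemma ev_forall J (T : countType) (Q : T -> noise -> Prop) :
  (forall a, ev J (Q a)) -> ev J (fun x => forall a, Q a x).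
Proof.
move=> eQ; have := ev_not (ev_exists (fun a => ev_not (eQ a))).
apply: ev_ext => x; split=> [nQ a|Qx [a nQa]]; last by apply: nQa; exact: Qx.
by apply: contrapT => nQa; apply: nQ; exists a.
Qed.

Lemma evf_coord (J : I -> Prop) i : J i -> evf J (fun x => x i).
Proof. by move=> Ji; split; [exact: measurable_coord|move=> x x'; apply]. Qed.

Lemma evf_cst J c : evf J (fun=> c).
Proof. by split. Qed.

Lemma evf_add J f g : evf J f -> evf J g -> evf J (fun x => f x + g x).
Proof.
by move=> [mf Jf] [mg Jg]; split; [exact: measurable_funD|move=> x x' e;
  rewrite (Jf _ x')// (Jg _ x')].
Qed.

Lemma evf_opp J f : evf J f -> evf J (fun x => - f x).
Proof.
by move=> [mf Jf]; split; [exact: measurable_funN|move=> x x' e; rewrite (Jf _ x')].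
Qed.

Lemma evf_sum J T (s : seq T) (P : pred T) f : (forall a, evf J (f a)) ->
  evf J (fun x => \sum_(a <- s | P a) f a x).
Proof.
move=> ef; split.
  under eq_fun do rewrite -big_filter.
  by apply: measurable_sum => a; case: (ef a).
by move=> x x' e; apply: eq_bigr => a _; case: (ef a) => _; apply.
Qed.

Lemma ev_preim J f (B : set R) : measurable B -> evf J f -> ev J (fun x => B (f x)).
Proof.
move=> mB [mf Jf]; split; first by have := mf measurableT _ mB; rewrite setTI.
by move=> x x' e; rewrite (Jf x x').
Qed.

Lemma ev_le J f g : evf J f -> evf J g -> ev J (fun x => f x <= g x).
Proof.
move=> ef eg; have := ev_preim (measurable_itv `]-oo, 0]) (evf_add ef (evf_opp eg)).
by apply: ev_ext => x /=; rewrite in_itv/= subr_le0.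
Qed.

Lemma ev_lt J f g : evf J f -> evf J g -> ev J (fun x => f x < g x).
Proof.
move=> ef eg; have := ev_not (ev_le eg ef).
by apply: ev_ext => x; split=> [/negP|]; [rewrite -ltNge|rewrite ltNge => /negP].
Qed.

Lemma ev_eq J f c : evf J f -> ev J (fun x => f x = c).
Proof. by move=> ef; have := ev_preim (measurable_set1 c) ef. Qed.

Lemma evf_if J Q f g : ev J Q -> evf J f -> evf J g ->
  evf J (fun x => if `[< Q x >] then f x else g x).
Proof.
move=> [mQ JQ] [mf Jf] [mg Jg]; split.
  apply: measurable_fun_ifT => //=; apply: (measurable_fun_bool true) => //.
  by rewrite setTI (_ : _ @^-1` _ = [set x | Q x])//; apply/seteqP; split=> x /= /asboolP.
move=> x x' e; rewrite (Jf x x' e) (Jg x x' e); congr (if _ then _ else _).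
by apply: asbool_equiv_eq; split; apply: JQ => i /e.
Qed.

Section probability.
Variable mu : probability noise R.

Definition indep_coords : Prop := forall s B, uniq s ->
  (forall i, measurable (B i)) ->
  mu (cylinder s B) = (\prod_(i <- s) mu [set x | B i (x i)])%E.

(** Resetting the coordinates outside [J] to 0 makes every event that depends on [J] a preimage
    under a measurable map, so that independence of events reduces to that of [keep J] and
    [keep K]. *)
Definition keep (J : I -> Prop) (x : noise) : noise :=
  fun i => if `[< J i >] then x i else 0.

Lemma measurable_keep J : measurable_fun setT (keep J).
Proof.
apply: measurable_noise => i; rewrite /keep.
by case: asboolP => _; [exact: measurable_coord|exact: measurable_cst].
Qed.

Lemma keep_ev J Q : ev J Q -> [set x | Q x] = keep J @^-1` [set x | Q x].
Proof.
move=> [_ JQ]; apply/seteqP; split=> x /= Qx; apply: JQ Qx => i Ji;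
  by rewrite /keep asboolT.
Qed.

Lemma dynkin_indep (f : noise -> noise) (C : set noise) :
  measurable_fun setT f -> measurable C ->
  (forall A, cylinders A -> mu (f @^-1` A `&` C) = (mu (f @^-1` A) * mu C)%E) ->
  forall A, measurable A -> mu (f @^-1` A `&` C) = (mu (f @^-1` A) * mu C)%E.
Proof.
move=> mf mC cylC.
have mpre A : measurable A -> measurable (f @^-1` A).
  by move=> mA; rewrite -[X in measurable X]setTI; exact: mf.
have finC : mu C \is a fin_num by exact: fin_num_measure.
apply: (@dynkin_induction _ noise cylinders) => //.
- exact: cylinders_setI.
- by rewrite preimage_setT setTI probability_setT mul1e.
- move=> A /mpre mB IB; rewrite [f @^-1` (~` A)](_ : _ = ~` (f @^-1` A))//.
  move: (f @^-1` A) mB IB => B mB IB; rewrite probability_setC//.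
  rewrite [_ `&` C]setIC -setDE measureD//; last by rewrite ltey_eq finC.
  rewrite (setIC C); transitivity (mu C - mu B * mu C)%E; first by rewrite -IB.
  have := fineK finC; have := fineK (fin_num_measure mu _ mB).
  move: (fine (mu B)) (fine (mu C)) => b c <- <-.
  by rewrite -[1%E]/(1%:E) -EFinM -!EFinB -EFinM mulrBl mul1r.
- move=> F mF tF IF; rewrite preimage_bigcup setI_bigcupl.
  have tF' : trivIset setT (fun n => f @^-1` F n).
    apply/trivIsetP => i j _ _ ij; rewrite -preimage_setI.
    by move/trivIsetP : tF => /(_ _ _ _ _ ij) ->//; rewrite preimage_set0.
  have mF' n : measurable (f @^-1` F n) by exact: mpre.
  rewrite measure_bigcup//; last 2 first.
  - by move=> n _; exact: measurableI.
  - exact: trivIset_setIr.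
  rewrite measure_bigcup//.
  rewrite (eq_eseriesr (g := fun n => (fine (mu C))%:E * mu (f @^-1` F n))%E).
    by rewrite nneseriesZl// muleC fineK.
  by move=> n _; rewrite fineK// muleC; exact: IF.
Qed.

(** The Dynkin argument is applied once on each side, which leaves two cylinders on disjoint sets of
    coordinates and hence the product formula. *)
Lemma indep_keep J K : indep_coords -> (forall i, J i -> ~ K i) ->
  forall A B : set noise, measurable A -> measurable B ->
  mu (keep J @^-1` A `&` keep K @^-1` B) =
  (mu (keep J @^-1` A) * mu (keep K @^-1` B))%E.
Proof.
move=> muI JK A B mA mB.
have mpre S (C : set noise) : measurable C -> measurable (keep S @^-1` C).
  by move=> mC; rewrite -[X in measurable X]setTI; exact: measurable_keep.
(* Pulled back by [keep S], a cylinder is empty if a condition outside [S] rejects the default value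
   0, and otherwise it constrains coordinates in [S] only. Repeated indices are removed for the
   product formula. *)
have keepcyl S s E : (forall i, measurable (E i)) ->
    keep S @^-1` cylinder s E = set0 \/
    exists2 t, uniq t & keep S @^-1` cylinder s E = cylinder t E /\
      forall i, i \in t -> S i.
  move=> mE; have [[i si [nSi nE]]|/forall2NP sE] :=
      pselect (exists2 i, i \in s & ~ S i /\ ~ E i 0).
    left; apply/seteqP; split=> x //= /(_ i si).
    by rewrite /keep asboolF.
  right; exists (undup [seq i <- s | `[< S i >]]); first exact: undup_uniq.
  split; last by move=> i; rewrite mem_undup mem_filter => /andP[/asboolP].
  apply/seteqP; split=> x /= xE i.
    rewrite mem_undup mem_filter => /andP[/asboolP Si /xE].
    by rewrite /keep asboolT.
  move=> si; have := xE i; rewrite mem_undup mem_filter si andbT /keep.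
  case: asboolP => [_ /(_ isT)//|nS _].
  by case: (sE i) => // /not_andP[/contrapT//|/contrapT].
have step : forall C, cylinders C -> mu (keep J @^-1` A `&` keep K @^-1` C) =
    (mu (keep J @^-1` A) * mu (keep K @^-1` C))%E.
  move=> C [t [E [mE ->]]].
  apply: dynkin_indep => //; [exact: measurable_keep|apply: mpre;
    exact: measurable_cylinder|].
  move=> _ [s [D [mD ->]]].
  have [->|[s' us' [-> sJ]]] := keepcyl J s D mD.
    by rewrite set0I measure0 mul0e.
  have [->|[t' ut' [-> tK]]] := keepcyl K t E mE.
    by rewrite setI0 measure0 mule0.
  have dis i : i \in s' -> i \notin t' by move=> /sJ/JK nK; apply/negP => /tK.
  pose G i := if i \in s' then D i else E i.
  have -> : cylinder s' D `&` cylinder t' E = cylinder (s' ++ t') G.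
    apply/seteqP; split=> x /=.
      by move=> [Dx Ex] i; rewrite mem_cat /G; case: ifPn => [/Dx//|_ /= /Ex].
    move=> Gx; split=> i si; have := Gx i; rewrite mem_cat /G si ?orbT; first by apply.
    by case: ifPn => [/dis/negP//|_]; apply.
  have -> : cylinder s' D = cylinder s' G.
    by apply/seteqP; split=> x Hx i si; move: (Hx i si); rewrite /G si.
  have -> : cylinder t' E = cylinder t' G.
    apply/seteqP; split=> x Hx i si; move: (Hx i si); rewrite /G;
      by case: ifPn => // /dis/negP.
  have mG i : measurable (G i) by rewrite /G; case: ifP.
  rewrite !muI ?big_cat// cat_uniq us' ut' andbT/=.
  by apply/hasPn => i it; apply/negP => /dis; rewrite it.
rewrite setIC muleC.
apply: (dynkin_indep (measurable_keep K) (mpre _ _ mA) _ mB) => C cC.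
by rewrite setIC muleC; exact: step.
Qed.

Definition prob (Q : noise -> Prop) : R := fine (mu [set x | Q x]).

Lemma prE J Q : ev J Q -> mu [set x | Q x] = (prob Q)%:E.
Proof. by move=> [mQ _]; rewrite fineK// fin_num_measure. Qed.

Lemma indep_ev J K Q Q' : indep_coords -> (forall i, J i -> ~ K i) ->
  ev J Q -> ev K Q' -> prob (fun x => Q x /\ Q' x) = prob Q * prob Q'.
Proof.
move=> muI JK eQ eQ'; rewrite /prob.
rewrite -fineM; [|by rewrite (prE eQ)|by rewrite (prE eQ')].
rewrite (keep_ev eQ) (keep_ev eQ') -indep_keep//; [|by case: eQ|by case: eQ'].
by rewrite -(keep_ev eQ) -(keep_ev eQ').
Qed.

End probability.
End events.

(** * Union bounds, countable partitions, Markov's inequality, changes of coordinates *)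

Section pr_theory.
Variables (I : choiceType) (R : realType).
Local Notation noise := (noise I R).
Local Notation cylinders := (@cylinders I R).
Variable mu : probability noise R.
Local Notation pr := (prob mu).
Local Notation mev := (@ev I R (fun=> True)).

Lemma ev_mev J (Q : noise -> Prop) : ev J Q -> mev Q.
Proof. exact: ev_sub. Qed.

Lemma pr_ge0 Q : 0 <= pr Q.
Proof. by rewrite fine_ge0// measure_ge0. Qed.

Lemma pr_le Q Q' : mev Q -> mev Q' -> (forall x, Q x -> Q' x) -> pr Q <= pr Q'.
Proof.
move=> eQ eQ' QQ'; rewrite -lee_fin -(prE mu eQ) -(prE mu eQ').
by apply: le_measure; rewrite ?inE; [case: eQ|case: eQ'|exact: QQ'].
Qed.

Lemma pr_ext Q Q' : (forall x, Q x <-> Q' x) -> pr Q = pr Q'.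
Proof. by move=> QQ'; congr prob; apply/funext => x; apply/propext. Qed.

Lemma prT : pr (fun=> True) = 1.
Proof. by rewrite /prob -[mkset _]/setT probability_setT. Qed.

Lemma pr0 : pr (fun=> False) = 0.
Proof. by rewrite /prob -[mkset _]/set0 measure0. Qed.

Lemma pr_le1 Q : mev Q -> pr Q <= 1.
Proof. by move=> eQ; rewrite -prT; apply: pr_le => //; exact: ev_cst. Qed.

Lemma prD Q Q' : mev Q -> mev Q' -> (forall x, Q x -> ~ Q' x) ->
  pr (fun x => Q x \/ Q' x) = pr Q + pr Q'.
Proof.
move=> eQ eQ' dis; apply: EFin_inj; rewrite EFinD -(prE mu eQ) -(prE mu eQ').
rewrite -(prE mu (ev_or eQ eQ')) [X in mu X](_ : _ = [set x | Q x] `|` [set x | Q' x])//.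
rewrite measureU//; [by case: eQ|by case: eQ'|].
by apply/seteqP; split=> x // -[/dis].
Qed.

Lemma pr_split Q S : mev Q -> mev S ->
  pr Q = pr (fun x => Q x /\ S x) + pr (fun x => Q x /\ ~ S x).
Proof.
move=> eQ eS; rewrite -prD; first last.
- by move=> x [_ ?] [].
- exact/ev_and/ev_not.
- exact/ev_and.
by apply: pr_ext => x; have [Sx|nSx] := pselect (S x); tauto.
Qed.

Lemma pr_or Q Q' : mev Q -> mev Q' -> pr (fun x => Q x \/ Q' x) <= pr Q + pr Q'.
Proof.
move=> eQ eQ'; rewrite (pr_split (ev_or eQ eQ') eQ).
by apply: lerD; apply: pr_le; try (by do ?[apply: ev_and|apply: ev_or|apply: ev_not]);
  tauto.
Qed.

Lemma pr_exists_seq (T : eqType) (s : seq T) (Q : T -> noise -> Prop) (P : T -> R) :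
  (forall a, mev (Q a)) -> (forall a, pr (Q a) <= P a) ->
  forall E, mev E -> (forall x, E x -> exists2 a, a \in s & Q a x) ->
  pr E <= \sum_(a <- s) P a.
Proof.
move=> eQ QP; elim: s => [|a s IH] E eE Es.
  rewrite big_nil -pr0; apply: pr_le => //; first exact: ev_cst.
  by move=> x /Es[a]; rewrite in_nil.
rewrite big_cons (pr_split eE (eQ a)); apply: lerD.
  by apply: le_trans (QP a); apply: pr_le => //; [exact: ev_and|tauto].
apply: IH; first exact/ev_and/ev_not.
by move=> x [/Es[b]]; rewrite inE => /predU1P[->//|sb Qb] nQ; exists b.
Qed.

Lemma pr_disjoint (T : eqType) (s : seq T) (Q : T -> noise -> Prop) E :
  uniq s -> (forall a, mev (Q a)) -> mev E ->
  (forall a b x, a \in s -> b \in s -> Q a x -> Q b x -> a = b) ->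
  (forall a x, a \in s -> Q a x -> E x) -> \sum_(a <- s) pr (Q a) <= pr E.
Proof.
move=> + eQ; elim: s E => [|a s IH] E /=; first by rewrite big_nil pr_ge0.
move=> /andP[as_ us] eE dis QE; rewrite big_cons (pr_split eE (eQ a)); apply: lerD.
  apply: pr_le => //; first exact: ev_and.
  by move=> x Qa; split=> //; apply: QE Qa; rewrite mem_head.
apply: IH => //; first exact/ev_and/ev_not.
  by move=> b c x bs cs; apply: dis; rewrite inE ?bs ?cs orbT.
move=> b x bs Qb; split; first by apply: QE Qb; rewrite inE bs orbT.
move=> Qa; have ba := dis _ _ _ _ _ Qb Qa; move: as_; rewrite -ba ?bs// ?mem_head//.
by rewrite inE bs orbT.
Qed.

(** This takes the place of conditioning on a variable with countably many values: the estimate on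
    each piece is summed over the pieces. The pieces will be joining states, lists of prescribed
    coins, or cells of a grid. *)
Lemma pr_cond_le (T : countType) (S : T -> noise -> Prop) E q :
  (forall a, mev (S a)) -> (forall a b x, S a x -> S b x -> a = b) -> mev E ->
  (forall a, pr (fun x => E x /\ S a x) <= q * pr (S a)) ->
  pr (fun x => E x /\ exists a, S a x) <= q * pr (fun x => exists a, S a x).
Proof.
move=> eS dis eE le_q.
(* [pickle_inv] decodes genuine codes only, so that no piece is counted twice. *)
pose F (n : nat) : set noise := if @pickle_inv T n is Some a then [set x | S a x] else set0.
have tF : trivIset setT F.
  apply/trivIsetP => m n _ _ mn; apply/seteqP; split=> x // -[].
  rewrite /F; case em: (pickle_inv m) => [a|//] Sa;
    case en: (@pickle_inv T n) => [b|//] Sb.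
  have := @pickle_invK T m; have := @pickle_invK T n; rewrite em en /= => en' em'.
  by move: mn; rewrite -em' -en' (dis _ _ _ Sa Sb) eqxx.
have mF n : measurable (F n).
  by rewrite /F; case: pickle_inv => // a; case: (eS a).
have [mE _] := eE.
have FE : \bigcup_n F n = [set x | exists a, S a x].
  apply/seteqP; split=> x /=.
    by move=> [n _]; rewrite /F; case: pickle_inv => // a Sa; exists a.
  by move=> [a Sa]; exists (pickle a) => //; rewrite /F pickleK_inv.
(* A negative [q] forces every piece to be null. *)
have q_ge0 : 0 <= q \/ forall a, pr (S a) = 0.
  have [q0|q0] := leP 0 q; [by left|right=> a].
  apply/eqP; rewrite eq_le pr_ge0 andbT -(ler_nM2l q0) mulr0.
  by apply: le_trans (le_q a); exact: pr_ge0.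
have eU : mev (fun x => exists a, S a x) by exact: ev_exists.
case: q_ge0 => [q0|S0].
  rewrite -lee_fin EFinM -(prE mu eU) -(prE mu (ev_and eE eU)).
  rewrite -FE [X in mu X](_ : _ = \bigcup_n (F n `&` [set x | E x])); last first.
    by rewrite -setI_bigcupl FE setIC.
  rewrite measure_bigcup//; last 2 first.
  - by move=> n _; exact: measurableI.
  - exact: trivIset_setIr.
  rewrite measure_bigcup// -nneseriesZl//.
  apply: lee_nneseries => // n _; rewrite /F; case: pickle_inv => [a|]; last first.
    by rewrite set0I measure0 mule0.
  have := le_q a; rewrite -lee_fin EFinM -(prE mu (eS a)) -(prE mu (ev_and eE (eS a))).
  by rewrite setIC.
have U0 : pr (fun x => exists a, S a x) = 0.
  apply: EFin_inj; rewrite -(prE mu eU) -FE measure_bigcup//.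
  rewrite eseries0// => n _ _; rewrite /F; case: pickle_inv => [a|]; last exact: measure0.
  by apply: etrans (prE mu (eS a)) _; rewrite S0.
rewrite U0 mulr0 -U0; apply: pr_le => //; first exact: ev_and.
by move=> x [].
Qed.

Lemma count_indicE (T : Type) (s : seq T) (E : T -> noise -> Prop) x :
  (count (fun a => `[< E a x >]) s)%:R = \sum_(a <- s) \1_[set x | E a x] x :> R.
Proof.
rewrite -sum1_count natr_sum big_mkcond/=; apply: eq_bigr => a _.
by rewrite indicE; case: asboolP => Ea; [rewrite mem_set|rewrite memNset].
Qed.

Lemma ev_count (T : Type) (s : seq T) (E : T -> noise -> Prop) (h : R) :
  (forall a, mev (E a)) ->
  mev (fun x => h <= (count (fun a => `[< E a x >]) s)%:R).
Proof.
move=> eE; apply: ev_le; first exact: evf_cst.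
rewrite (funext (count_indicE s E)).
apply: evf_sum => a; split; first by apply: measurable_indic; case: (eE a).
by move=> x x' e; congr (\1_ _ _); apply/funext => i; exact: e.
Qed.

(** Markov's inequality for the number of events that occur. *)
Lemma pr_count (T : Type) (s : seq T) (E : T -> noise -> Prop) (h : R) :
  (forall a, mev (E a)) ->
  h * pr (fun x => h <= (count (fun a => `[< E a x >]) s)%:R) <=
  \sum_(a <- s) pr (E a).
Proof.
move=> eE; have [h0|h0] := leP h 0.
  apply: (@le_trans _ _ 0); last by apply: sumr_ge0 => a _; exact: pr_ge0.
  by rewrite mulr_le0_ge0// pr_ge0.
have mE a : measurable [set x | E a x] by case: (eE a).
have countE := count_indicE s E; have eA := ev_count s h eE.
have intE A : measurable A -> mu A = (\int[mu]_x (\1_A x)%:E)%E.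
  by move=> mA; rewrite integral_indic// setIT.
rewrite -lee_fin EFinM -(prE mu eA) -sumEFin.
rewrite [leRHS](eq_bigr (fun a => \int[mu]_x (\1_[set x | E a x] x)%:E)%E); last first.
  by move=> a _; rewrite -(prE mu (eE a)) (intE _ (mE a)).
rewrite -ge0_integral_sum//; last first.
- by move=> a; apply/measurable_EFinP; exact: measurable_indic.
rewrite (intE _ eA.1).
rewrite -ge0_integralZl_EFin//; last 2 first.
- by apply/measurable_EFinP/measurable_indic; case: eA.
- exact: ltW.
apply: ge0_le_integral => //.
- - by move=> x _; rewrite -EFinM lee_fin; apply: mulr_ge0; [exact: ltW|rewrite indicE].
- apply: measurable_funeM; by apply/measurable_EFinP/measurable_indic; case: eA.
- by apply: emeasurable_sum => a; apply/measurable_EFinP; exact: measurable_indic.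
move=> x _; rewrite sumEFin -EFinM lee_fin -countE indicE.
by case: (boolP (x \in _)) => [|_]; rewrite ?mulr1 ?mulr0// inE.
Qed.

(** As functions of [Q] both sides are probabilities, and they agree on the cylinders, a generating
    family stable under intersection. *)
Lemma pr_reindex (f : I -> I) (g : I -> I) :
  cancel f g -> cancel g f -> indep_coords mu ->
  (forall i (B : set R), measurable B ->
    mu [set x | B (x (f i))] = mu [set x | B (x i)]) ->
  forall Q, mev Q -> pr (fun x => Q (fun i => x (f i))) = pr Q.
Proof.
move=> fK gK muI mu_f Q [mQ _].
pose h (x : noise) : noise := fun i => x (f i).
have mh : measurable_fun setT h.
  by apply: measurable_noise => i; exact: measurable_coord.
pose hm : {mfun noise >-> noise} := mfun_Sub (mem_set mh).
have hE A : distribution mu hm A = mu (h @^-1` A) by [].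
rewrite /prob; congr fine; rewrite -[LHS]/(mu (h @^-1` [set x | Q x])) -hE.
apply: (measure_unique cylinders (fun=> setT)) => //.
- exact: cylinders_setI.
- by move=> _; exists [::], (fun=> setT); split => //; apply/seteqP; split.
- exact: bigcup_const.
- move=> _ [s [B [mB ->]]].
  have cylE : cylinder s B = cylinder (undup s) B.
    by apply/seteqP; split=> x /= xB i; [rewrite mem_undup|rewrite -mem_undup]; exact: xB.
  transitivity (mu (cylinder [seq f i | i <- undup s] (B \o g))).
    rewrite cylE; rewrite -[LHS]/(mu (h @^-1` _)); congr (mu _); apply/seteqP;
      split=> x /=.
      by move=> xB _ /mapP[i si ->]; rewrite /= fK; exact: xB.
    move=> xB i si; have := xB (f i); rewrite /= fK; apply.
    exact: map_f.
  rewrite cylE; apply: etrans (esym (muI _ B (undup_uniq s) mB)).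
  rewrite muI; last 2 first.
  - by rewrite map_inj_uniq ?undup_uniq//; exact: can_inj fK.
  - by move=> i; exact: mB.
  rewrite big_map; apply: eq_bigr => i _ /=.
  by rewrite fK mu_f.
- by move=> _; rewrite -[X in (X < _)%E]/(mu setT) probability_setT ltry.
Qed.

End pr_theory.

(** * The competition for the vertices *)

(* [inl (u, n)] is the n-th waiting time at the root [u], [inr (u, n, k)] the k-th
   coin of its n-th particle, encoded by 1 for a step to the right. *)
Definition idx : countType := (int * nat + int * nat * nat)%type.

(* [(u, n, p)]: the vertex joined the tree of [u] by the path [p], at the ring of
   [u] of index [n - 1]; the roots have [n = 0]. *)
Definition state : countType := (int * nat * seq bool)%type.

Section growth.
Variable R : realType.
Implicit Types (x : noise idx R) (u : int) (n y : nat) (w p : seq bool).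

(* The junk value 1 makes the waiting times positive everywhere, so that [tm] is
   strictly increasing in [n]. *)
Definition gp x u n : R :=
  let g := x (inl (u, n)) in if 0 < g then g else 1.

Definition cn x u n k : bool := x (inr (u, n, k)) == 1.

(* The ring of index [n] takes place at time [tm x u n.+1]. *)
Definition tm x u n : R := \sum_(i < n) gp x u i.

Definition pre x u n y : seq bool := mkseq (cn x u n) y.

Definition hits x u w n : bool := pre x u n (size w) == w.

Definition hit x u n0 w : option nat :=
  if pselect (exists n, (n0 <= n)%N && hits x u w n) is left e
  then Some (ex_minn e) else None.

(* The first crossing of the edge in direction [b] by a particle which reaches a
   vertex of state [o]. *)
Definition cand x (o : option state) (b : bool) : option state :=
  if o is Some (u, n0, p) then
    if hit x u n0 (rcons p b) is Some n then Some (u, n.+1, rcons p b) else None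
  else None.

Definition join_time x (s : state) : R := tm x s.1.1 s.1.2.

(** An absent candidate counts as infinitely late. Ties go to the left parent, an arbitrary choice
    that matters on a null event only, see [pr_tie]. If both candidates are absent the value affects
    [anc] alone, whose monotonicity holds for any choice. *)
Definition lwin x (o1 o2 : option state) : bool :=
  match o1, o2 with
  | Some s1, Some s2 => join_time x s1 <= join_time x s2
  | Some _, None => true
  | None, _ => false
  end.

(* The state of the vertex (2 i - y, y), whose parents are [i - 1] and [i] at
   level [y - 1]; [None] if it never joins a tree. *)
Fixpoint st x y (i : int) : option state :=
  if y is y'.+1 then
    let c1 := cand x (st x y' (i - 1)) true in
    let c2 := cand x (st x y' i) false in
    if lwin x c1 c2 then c1 else c2
  else Some (i, 0%N, [::]).

Definition win x y i : bool :=
  lwin x (cand x (st x y (i - 1)) true) (cand x (st x y i) false).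

(* The root of the tree of the vertex; it is also defined, hence monotone in [i],
   where [st] is [None]. *)
Fixpoint anc x y (i : int) : int :=
  if y is y'.+1 then
    if win x y' i then anc x y' (i - 1) else anc x y' i
  else i.

(* The particle [n] of [u] reaches the vertex after it joined the tree of [u]. *)
Definition Arr x y i u n : Prop :=
  exists n0 p, [/\ st x y i = Some (u, n0, p), (n0 <= n)%N & hits x u p n].

Lemma gp_gt0 x u n : 0 < gp x u n.
Proof. by rewrite /gp; case: ifP. Qed.

Lemma tm0 x u : tm x u 0 = 0.
Proof. exact: big_ord0. Qed.

Lemma tmS x u n : tm x u n.+1 = tm x u n + gp x u n.
Proof. exact: big_ord_recr. Qed.

Lemma ltr_tm x u m n : (tm x u m < tm x u n) = (m < n)%N.
Proof.
have tmS_lt k : tm x u k < tm x u k.+1 by rewrite tmS ltrDl gp_gt0.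
have mono : {homo tm x u : a b / (a < b)%N >-> a < b}.
  exact: homo_ltn lt_trans tmS_lt.
apply/idP/idP => [|/mono//]; apply: contraLR; rewrite -leqNgt -leNgt leq_eqVlt.
by move=> /orP[/eqP ->//|/mono/ltW].
Qed.

Lemma ler_tm x u m n : (tm x u m <= tm x u n) = (m <= n)%N.
Proof. by rewrite leNgt ltr_tm -leqNgt. Qed.

Lemma hitP x u n0 w n : hit x u n0 w = Some n <->
  [/\ (n0 <= n)%N, hits x u w n & forall m, (n0 <= m)%N -> hits x u w m -> (n <= m)%N].
Proof.
rewrite /hit; case: pselect => [e|ne]; last first.
  by split=> // -[n0n hn _]; case: ne; exists n; rewrite n0n.
case: ex_minnP => k /andP[n0k hk] kmin; split.
  by move=> [<-]; split=> // m n0m hm; apply: kmin; rewrite n0m.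
by move=> [n0n hn nmin]; congr Some; apply/eqP; rewrite eqn_leq nmin// kmin// n0n.
Qed.

Lemma hitNP x u n0 w : hit x u n0 w = None <->
  forall m, (n0 <= m)%N -> ~~ hits x u w m.
Proof.
rewrite /hit; case: pselect => [e|ne]; split=> //.
  by have [n /andP[n0n hn]] := e; move=> /(_ n n0n); rewrite hn.
by move=> _ m n0m; apply/negP => hm; apply: ne; exists m; rewrite n0m.
Qed.

Lemma hit_ex x u n0 w m : (n0 <= m)%N -> hits x u w m ->
  exists2 n, hit x u n0 w = Some n & (n <= m)%N.
Proof.
move=> n0m hm; case e: (hit x u n0 w) => [n|].
  by exists n => //; have /hitP[_ _] := e; apply.
by have /hitNP/(_ _ n0m) := e; rewrite hm.
Qed.

Lemma hits_rcons x u p b n :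
  hits x u (rcons p b) n = hits x u p n && (cn x u n (size p) == b).
Proof. by rewrite /hits size_rcons /pre mkseqS eqseq_rcons. Qed.

Lemma stS x y i : st x y.+1 i =
  if win x y i then cand x (st x y (i - 1)) true else cand x (st x y i) false.
Proof. by []. Qed.

Lemma candP x o b s : cand x o b = Some s -> exists u n0 p n,
  [/\ o = Some (u, n0, p), s = (u, n.+1, rcons p b) & hit x u n0 (rcons p b) = Some n].
Proof.
by case: o => [[[u n0] p]|//] /=; case e: hit => [n|//] [<-]; exists u, n0, p, n.
Qed.

Lemma st_size x y i u n p : st x y i = Some (u, n, p) -> size p = y.
Proof.
elim: y i u n p => [|y IH] i u n p; first by case=> _ _ <-.
rewrite stS; case: ifP => _ /candP[v [n0 [q [m [/IH sq [_ _ ->] _]]]]];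
  by rewrite size_rcons sq.
Qed.

Lemma st_pos x y i u n p : st x y i = Some (u, n, p) -> i = u + (count id p)%:Z.
Proof.
elim: y i u n p => [|y IH] i u n p; first by case=> <- _ <-; rewrite addr0.
rewrite stS; case: ifP => _ /candP[v [n0 [q [m [/IH eq [-> _ ->] _]]]]];
  rewrite -cats1 count_cat /=; lia.
Qed.

Lemma st_anc x y i u n p : st x y i = Some (u, n, p) -> anc x y i = u.
Proof.
elim: y i u n p => [|y IH] i u n p; first by case.
rewrite stS /=; case: ifP => _ /candP[v [n0 [q [m [/IH -> [-> _ _] _]]]]] //.
Qed.

(** Planarity: at the next level the vertices [i - 1] and [i] have the common parent [i - 1], whose
    root separates theirs. *)
Lemma anc_mono1 x y i : anc x y (i - 1) <= anc x y i.
Proof.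
elim: y i => [|y IH] i /=; first by lia.
apply: (@le_trans _ _ (anc x y (i - 1))).
  by case: ifP => // _.
by case: ifP.
Qed.

Lemma anc_mono x y i j : i <= j -> anc x y i <= anc x y j.
Proof.
move=> ij; have [k ->] : exists k : nat, j = i + k%:Z by exists `|j - i|%N; lia.
elim: k => [|k IH]; first by rewrite addr0.
apply: le_trans IH _; have := anc_mono1 x y (i + k.+1%:Z).
by rewrite (_ : i + k.+1%:Z - 1 = i + k%:Z)//; lia.
Qed.

Lemma anc_bound x y i : i - y%:Z <= anc x y i <= i.
Proof.
elim: y i => [|y IH] i /=; first by lia.
case: ifP => _; [have := IH (i - 1)|have := IH i]; move: (anc _ _ _) => a; lia.
Qed.

Lemma Arr_pos x y i u n : Arr x y i u n -> i = u + (count id (pre x u n y))%:Z.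
Proof.
by move=> [n0 [p [e _]]]; rewrite /hits (st_size e) => /eqP ->; exact: st_pos e.
Qed.

Lemma Arr_anc x y i u n : Arr x y i u n -> anc x y i = u.
Proof. by move=> [n0 [p [/st_anc]]]. Qed.

Lemma cand_Arr x y i b s : cand x (st x y i) b = Some s ->
  exists2 n, s.1 = (anc x y i, n.+1) & [/\ Arr x y i (anc x y i) n,
    cn x (anc x y i) n y = b &
    forall m, Arr x y i (anc x y i) m -> cn x (anc x y i) m y = b -> (n <= m)%N].
Proof.
move=> /candP[u [n0 [p [n [e -> /hitP[n0n]]]]]];
  rewrite (st_anc e) hits_rcons (st_size e).
move=> /andP[hn /eqP cb] nmin; exists n => //; split=> //; first by exists n0, p.
move=> m [n1 [q []]]; rewrite e => -[<- <-] n0m hm cm; apply: nmin => //.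
by rewrite hits_rcons hm (st_size e) cm eqxx.
Qed.

Lemma Arr_cand x y i u n b : Arr x y i u n -> cn x u n y = b ->
  exists2 s, cand x (st x y i) b = Some s & join_time x s <= tm x u n.+1.
Proof.
move=> [n0 [p [e n0n hn]]] cb; rewrite e /=.
have [|m -> mn] := @hit_ex x u n0 (rcons p b) n n0n.
  by rewrite hits_rcons hn (st_size e) cb eqxx.
by exists (u, m.+1, rcons p b) => //; rewrite /join_time/= ler_tm.
Qed.

Lemma win_left x y i u n : Arr x y (i - 1) u n -> cn x u n y = true ->
  (forall v m, Arr x y i v m -> cn x v m y = false ->
     tm x u n.+1 <= tm x v m.+1) -> win x y i.
Proof.
move=> A c H; have [s e js] := Arr_cand A c; rewrite /win e /=.
case e2: cand => [s2|//]; have [m sm [Am cm _]] := cand_Arr e2.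
by apply: le_trans js _; rewrite /join_time sm/=; exact: H.
Qed.

(** The comparison is strict here because ties go to the left parent. *)
Lemma win_right x y i u n : Arr x y i u n -> cn x u n y = false ->
  (forall v m, Arr x y (i - 1) v m -> cn x v m y = true ->
     tm x u n.+1 < tm x v m.+1) -> ~~ win x y i.
Proof.
move=> A c H; have [s e js] := Arr_cand A c; rewrite /win e.
case e2: cand => [s2|//]; have [m sm [Am cm _]] := cand_Arr e2.
by rewrite /= -ltNge; apply: le_lt_trans js _; rewrite /join_time sm/=; exact: H.
Qed.

(* Causality: what happens at the rings of [u] of index at least [n] has no
   influence on the vertices which joined at earlier rings of [u]. *)
Definition future u n (i : idx) : Prop :=
  match i with
  | inl (v, m) => v = u /\ (n <= m)%N
  | inr (v, m, _) => v = u /\ (n <= m)%N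
  end.

Definition agree u n x x' := forall i, ~ future u n i -> x i = x' i.

Lemma agree_gp u n x x' v m : agree u n x x' -> (v = u -> (m < n)%N) ->
  gp x v m = gp x' v m.
Proof.
move=> e h; rewrite /gp e//= => -[vu]; rewrite leqNgt => /negP; apply; exact: h.
Qed.

Lemma agree_tm u n x x' v m : agree u n x x' -> (v = u -> (m <= n)%N) ->
  tm x v m = tm x' v m.
Proof.
move=> e h; apply: eq_bigr => k _; apply: agree_gp e _ => /h.
exact: leq_trans.
Qed.

Lemma agree_hits u n x x' v m w : agree u n x x' -> (v = u -> (m < n)%N) ->
  hits x v w m = hits x' v w m.
Proof.
move=> e h; rewrite /hits/pre; congr (_ == _); apply: eq_mkseq => k.
by rewrite /cn e//= => -[vu]; rewrite leqNgt => /negP; apply; exact: h.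
Qed.

Lemma agree_hit u n x x' v n0 w m : agree u n x x' -> (v = u -> (m < n)%N) ->
  hit x v n0 w = Some m -> hit x' v n0 w = Some m.
Proof.
move=> e h /hitP[n0m hm min]; have hits' k : (k <= m)%N -> hits x v w k = hits x' v w k.
  by move=> km; apply: agree_hits e _ => /h; exact: leq_ltn_trans.
apply/hitP; split=> //; first by rewrite -hits'.
move=> k n0k hk; rewrite leqNgt; apply/negP => km.
have := min k n0k; rewrite hits' ?(ltnW km)// => /(_ hk).
by rewrite leqNgt km.
Qed.

Lemma agree_sym u n x x' : agree u n x x' -> agree u n x' x.
Proof. by move=> e i /e. Qed.

Lemma agree_cand u n x x' o b s : agree u n x x' ->
  cand x o b = Some s -> join_time x s <= tm x u n ->
  cand x' o b = Some s /\ join_time x' s = join_time x s.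
Proof.
move=> e /candP[v [n0 [p [m [-> -> hm]]]]] /=; rewrite /join_time/= => jm.
have h : v = u -> (m < n)%N by move=> vu; move: jm; rewrite vu ler_tm.
by rewrite (agree_hit e h hm); split=> //; apply/esym/(agree_tm e).
Qed.

(** Induction on the level. The winning candidate persists in [x'] by the induction hypothesis; a
    rival that beat it in [x'] would join before the horizon [tm x u n] too, hence by symmetry it
    would be present in [x], where it lost. *)
Lemma causality u n x x' y i s : agree u n x x' ->
  st x y i = Some s -> join_time x s <= tm x u n ->
  st x' y i = Some s /\ join_time x' s = join_time x s.
Proof.
elim: y i s x x' => [|y IH] i s x x' e.
  by case=> <- _; rewrite /join_time/= !tm0.
have tmE : tm x u n = tm x' u n by apply: agree_tm e _ => _; exact: leqnn.
have candE z b c : cand x (st x y z) b = Some c -> join_time x c <= tm x u n ->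
    cand x' (st x' y z) b = Some c /\ join_time x' c = join_time x c.
  move=> ec jc; have [v [n0 [p [m [eo ce hm]]]]] := candP ec.
  have [|-> _] := IH z (v, n0, p) x x' e eo.
    apply: le_trans jc; rewrite ce /join_time/= ler_tm.
    by have /hitP[/leqW] := hm.
  by apply: agree_cand e _ jc; rewrite -eo.
have candE' z b c : cand x' (st x' y z) b = Some c -> join_time x' c <= tm x u n ->
    cand x (st x y z) b = Some c /\ join_time x c = join_time x' c.
  rewrite tmE; move=> ec jc; have [v [n0 [p [m [eo ce hm]]]]] := candP ec.
  have [|-> _] := IH z (v, n0, p) x' x (agree_sym e) eo.
    apply: le_trans jc; rewrite ce /join_time/= ler_tm.
    by have /hitP[/leqW] := hm.
  by apply: agree_cand (agree_sym e) _ jc; rewrite -eo.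
rewrite !stS /win.
case: ifPn => [wx c1 js|wx c2 js].
  have [c1' js'] := candE _ _ _ c1 js; rewrite c1' /=.
  case c2': cand => [s2|//]; case: ifPn => //; rewrite -ltNge => lt2.
  have [|c2 j2] := candE' _ _ _ c2'; first by apply: le_trans (ltW lt2) _; rewrite js'.
  by move: wx; rewrite c1 c2/= -js' j2 leNgt lt2.
have [c2' js'] := candE _ _ _ c2 js; rewrite c2'.
case c1': cand => [s1|//] /=; case: ifPn => // le1.
have [|c1 j1] := candE' _ _ _ c1'; first by apply: le_trans le1 _; rewrite js'.
by move: wx; rewrite c1 c2/= -js' j1 le1.
Qed.

(** The ring index in a state acts as a stopping time: joining as [(u, n, p)] is decided by
    coordinates outside [future u n], so the rings of [u] from index [n] on are fresh. *)
Lemma st_future u n x x' y i p : agree u n x x' ->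
  st x y i = Some (u, n, p) -> st x' y i = Some (u, n, p).
Proof. by move=> e es; have [] := causality e es (lexx _). Qed.

(** * Covariance under translations *)

Definition shift_idx (z : int) (i : idx) : idx :=
  match i with
  | inl (u, n) => inl (u + z, n)
  | inr (u, n, k) => inr (u + z, n, k)
  end.

Definition shift z x : noise idx R := fun i => x (shift_idx z i).

Definition shift_state z (s : state) : state := (s.1.1 - z, s.1.2, s.2).

Lemma hit_shift z x u n0 w : hit (shift z x) u n0 w = hit x (u + z) n0 w.
Proof.
case e: (hit x (u + z) n0 w) => [n|]; first exact/hitP/hitP.
exact/hitNP/hitNP.
Qed.

Lemma cand_shift z x o b :
  cand (shift z x) (omap (shift_state z) o) b = omap (shift_state z) (cand x o b).
Proof.
case: o => [[[u n0] p]|//] /=; rewrite hit_shift subrK.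
by case: hit.
Qed.

Lemma lwin_shift z x o1 o2 :
  lwin (shift z x) (omap (shift_state z) o1) (omap (shift_state z) o2) = lwin x o1 o2.
Proof.
case: o1 o2 => [[[u1 n1] p1]|] [[[u2 n2] p2]|] //=.
have E u n : tm (shift z x) (u - z) n = tm x u n.
  by apply: eq_bigr => k _; rewrite /gp/shift/= subrK.
by rewrite /join_time/= !E.
Qed.

Lemma st_shift z x y i : st (shift z x) y i = omap (shift_state z) (st x y (i + z)).
Proof.
elim: y i => [|y IH] i; first by rewrite /= /shift_state/= addrK.
rewrite !stS /win !IH !cand_shift lwin_shift addrAC.
by case: ifP.
Qed.

Lemma win_shift z x y i : win (shift z x) y i = win x y (i + z).
Proof. by rewrite /win !st_shift !cand_shift lwin_shift addrAC. Qed.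

Lemma anc_shift z x y i : anc (shift z x) y i = anc x y (i + z) - z.
Proof.
elim: y i => [|y IH] i; first by rewrite /= addrK.
by rewrite /= win_shift !IH addrAC; case: ifP.
Qed.

End growth.

(** * The forest up to level y as a function of the clocks and of the first y coins *)

Section measurability.
Variable R : realType.
Implicit Types (x : noise idx R) (u i : int) (n y : nat) (w p : seq bool).

Definition low y (c : idx) : Prop :=
  if c is inr (_, _, k) then (k < y)%N else True.

Lemma evf_gp (J : idx -> Prop) u n : J (inl (u, n)) -> evf J (fun x => gp x u n).
Proof.
move=> Jn; rewrite (_ : (fun x => _) = fun x : noise idx R =>
    if `[< 0 < x (inl (u, n)) >] then x (inl (u, n)) else 1); last first.
  by apply/funext => x; rewrite /gp asboolb.
apply: evf_if; [apply: ev_lt| |]; by [exact: evf_cst|exact: evf_coord].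
Qed.

Lemma evf_tm (J : idx -> Prop) u n : (forall m, (m < n)%N -> J (inl (u, m))) ->
  evf J (fun x => tm x u n).
Proof.
elim: n => [|n IH] Jn.
  by rewrite (_ : (fun x => _) = fun=> 0); [exact: evf_cst|apply/funext => x;
    rewrite tm0].
rewrite (_ : (fun x => _) = fun x => tm x u n + gp x u n); last first.
  by apply/funext => x; rewrite tmS.
by apply: evf_add; [apply: IH => m mn; apply: Jn; exact: ltnW|apply: evf_gp; exact: Jn].
Qed.

Lemma ev_cn (J : idx -> Prop) u n k b : J (inr (u, n, k)) ->
  ev J (fun x => cn x u n k = b).
Proof.
move=> Jc; have e1 : ev J (fun x => x (inr (u, n, k)) = 1) by exact/ev_eq/evf_coord.
case: b; first by apply: ev_ext e1 => x; split=> /eqP.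
apply: ev_ext (ev_not e1) => x; rewrite /cn.
by split=> [/eqP/negbTE //|/negbT/eqP].
Qed.

Lemma hits_nth x u w n : hits x u w n <->
  forall k, (k < size w)%N -> cn x u n k = nth false w k.
Proof.
split=> [/eqP e k kw|e]; first by rewrite -e nth_mkseq.
apply/eqP/(@eq_from_nth _ false); first by rewrite size_mkseq.
by move=> k; rewrite size_mkseq => kw; rewrite nth_mkseq// e.
Qed.

Lemma ev_hits (J : idx -> Prop) u w n :
  (forall k, (k < size w)%N -> J (inr (u, n, k))) -> ev J (fun x => hits x u w n).
Proof.
move=> Jw; suff : ev J (fun x => forall k, (k < size w)%N -> cn x u n k = nth false w k).
  by apply: ev_ext => x; split=> /hits_nth.
apply: ev_forall => k; have [kw|kw] := boolP (k < size w)%N; last first.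
  by apply: ev_ext (@ev_cst idx R J True) => x; split.
by apply: ev_imp; [exact: ev_cst|apply: ev_cn; exact: Jw].
Qed.

Lemma ev_hit_Some (J : idx -> Prop) u n0 w n :
  (forall m k, (k < size w)%N -> (m <= n)%N -> J (inr (u, m, k))) ->
  ev J (fun x => hit x u n0 w = Some n).
Proof.
move=> Jw; suff : ev J (fun x => (n0 <= n)%N /\ hits x u w n /\
    forall m, (m < n)%N -> (n0 <= m)%N -> ~ hits x u w m).
  apply: ev_ext => x; split.
    move=> [n0n [hn min]]; apply/hitP; split=> // m n0m hm.
    by rewrite leqNgt; apply/negP => mn; exact: min hm.
  move=> /hitP[n0n hn min]; do 2!split=> //.
  by move=> m mn n0m /(min _ n0m); rewrite leqNgt mn.
apply: ev_and; first exact: ev_cst.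
apply: ev_and; first by apply: ev_hits => k kw; exact: Jw.
apply: ev_forall => m; have [mn|mn] := boolP (m < n)%N; last first.
  by apply: ev_ext (@ev_cst idx R J True) => x; split.
apply: ev_imp; first exact: ev_cst.
apply: ev_imp; first exact: ev_cst.
by apply/ev_not/ev_hits => k kw; apply: Jw => //; exact: ltnW.
Qed.

Lemma low_sub y y' : (y <= y')%N -> forall c, low y c -> low y' c.
Proof. by move=> yy' [//|[[? ?] k]] /= /leq_trans; apply. Qed.

Lemma ev_hit y u n0 w o : (size w <= y)%N ->
  ev (low y) (fun x => hit x u n0 w = o).
Proof.
have eS y' w' n : (size w' <= y')%N -> ev (low y') (fun x => hit x u n0 w' = Some n).
  by move=> wy; apply: ev_hit_Some => m k kw _ /=; exact: leq_trans wy.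
case: o => [n|] wy; first exact: eS.
apply: ev_ext (ev_not (ev_exists (fun n => eS y w n wy))) => x.
split=> [ne|-> [n]//]; case e: hit => [n|//].
by case: ne; exists n.
Qed.

(** The values of [f] form a countable type, so measurability may be checked with the value
    fixed. *)
Lemma ev_eq_case J (T : countType) (f : noise idx R -> T)
    (Q : T -> noise idx R -> Prop) :
  (forall a, ev J (fun x => f x = a)) -> (forall a, ev J (Q a)) ->
  ev J (fun x => Q (f x) x).
Proof.
move=> ef eQ; apply: ev_ext (ev_exists (fun a => ev_and (ef a) (eQ a))) => x.
by split=> [[a [-> ]]//|Qx]; exists (f x).
Qed.

Definition state_size (o : option state) : nat := if o is Some s then size s.2 else 0.

Lemma ev_cand y o b c : (state_size o < y)%N -> ev (low y) (fun x => cand x o b = c).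
Proof.
case: o => [[[u n0] p]|] /= py; last exact: ev_cst.
apply: (@ev_eq_case _ _ (fun x => hit x u n0 (rcons p b))
  (fun h x => (if h is Some n then Some (u, n.+1, rcons p b) else None) = c)).
  by move=> h; apply: ev_hit; rewrite size_rcons.
by move=> h; exact: ev_cst.
Qed.

Lemma ev_lwin y o1 o2 : ev (low y) (fun x => lwin x o1 o2).
Proof.
case: o1 o2 => [s1|] [s2|] /=; try exact: ev_cst.
by apply: ev_le; exact: evf_tm.
Qed.

Lemma st_state_size x y i : (state_size (st x y i) <= y)%N.
Proof. by case e: st => [[[u n] p]|//] /=; rewrite (st_size e). Qed.

Lemma ev_cand_st y i b c : (forall j o, ev (low y) (fun x => st x y j = o)) ->
  ev (low y.+1) (fun x => cand x (st x y i) b = c).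
Proof.
move=> est; have e1 o : ev (low y.+1) (fun x => st x y i = o).
  exact: ev_sub (low_sub (leqnSn y)) (est i o).
(* The bound on the size, always true of [st], is carried along so that longer states can be
   dismissed once the value is fixed. *)
suff : ev (low y.+1) (fun x => (state_size (st x y i) <= y)%N /\ cand x (st x y i) b = c).
  by apply: ev_ext => x; rewrite st_state_size; split=> [[]|].
apply: (ev_eq_case e1 (Q := fun o x => (state_size o <= y)%N /\ cand x o b = c)) => o.
have [oy|oy] := boolP (state_size o <= y)%N; last first.
  by apply: ev_ext (@ev_cst idx R _ False) => x; split=> // -[].
by apply: ev_and; [exact: ev_cst|exact: ev_cand].
Qed.

Lemma ev_st y i o : ev (low y) (fun x => st x y i = o).
Proof.
elim: y i o => [|y IH] i o; first by rewrite /=; exact: ev_cst.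
have ec := fun j b c => @ev_cand_st y j b c IH.
apply: (ev_eq_case (ec (i - 1) true) (Q := fun c1 x =>
  (let c2 := cand x (st x y i) false in if lwin x c1 c2 then c1 else c2) = o)) => c1.
apply: (ev_eq_case (ec i false) (Q := fun c2 x =>
  (if lwin x c1 c2 then c1 else c2) = o)) => c2.
apply: (ev_eq_case (f := fun x => lwin x c1 c2)
    (Q := fun b x => (if b then c1 else c2) = o)) => b; last exact: ev_cst.
case: b; first exact: ev_lwin.
by apply: ev_ext (ev_not (ev_lwin _ c1 c2)) => x; split=> [/negP/negbTE|->].
Qed.

Lemma ev_win y i b : ev (low y.+1) (fun x => win x y i = b).
Proof.
have ec := fun j b c => @ev_cand_st y j b c (@ev_st y).
apply: (ev_eq_case (ec (i - 1) true) (Q := fun c1 x =>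
  lwin x c1 (cand x (st x y i) false) = b)) => c1.
apply: (ev_eq_case (ec i false) (Q := fun c2 x => lwin x c1 c2 = b)) => c2.
case: b; first exact: ev_lwin.
by apply: ev_ext (ev_not (ev_lwin _ c1 c2)) => x; split=> [/negP/negbTE|->].
Qed.

Lemma ev_anc y i v : ev (low y) (fun x => anc x y i = v).
Proof.
elim: y i v => [|y IH] i v; first by rewrite /=; exact: ev_cst.
apply: (ev_eq_case (ev_win y i)
    (Q := fun b x => (if b then anc x y (i - 1) else anc x y i) = v)) => -[];
  exact: ev_sub (low_sub (leqnSn y)) (IH _ _).
Qed.

Lemma ev_anc_eq y i j : ev (low y) (fun x => anc x y i = anc x y j).
Proof.
by apply: (ev_eq_case (ev_anc y j) (Q := fun v x => anc x y i = v)) => v; exact: ev_anc.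
Qed.

Lemma ev_Arr y i u n : ev (low y) (fun x => Arr x y i u n).
Proof.
apply: ev_exists => n0; apply: ev_exists => p.
suff : ev (low y) (fun x => st x y i = Some (u, n0, p) /\ (size p = y /\ (n0 <= n)%N /\ hits x u p n)).
  apply: ev_ext => x; split=> [[? [? []]]//|[e ? ?]].
  by rewrite (st_size e).
apply: ev_and; first exact: ev_st.
have [py|py] := pselect (size p = y); last first.
  by apply: ev_ext (@ev_cst idx R _ False) => x; split=> // -[].
do 2!(apply: ev_and; first exact: ev_cst).
by apply: ev_hits => k; rewrite py.
Qed.

Lemma evf_tm_low y u n : evf (low y) (fun x => tm x u n).
Proof. exact: evf_tm. Qed.

End measurability.

(** * Waiting times and arrivals *)

Lemma exprn_small (R : realType) (r e : R) : 0 <= r < 1 -> 0 < e ->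
  exists m, r ^+ m <= e.
Proof.
move=> /andP[r0 r1] e0.
have := @cvg_expr R r; rewrite ger0_norm// => /(_ r1).
move=> /cvgr0Pnorm_le/(_ _ e0)[m _ /(_ m (leqnn m))] /= h; exists m.
by rewrite -[leLHS]ger0_norm// exprn_ge0.
Qed.

Lemma sum_geometric (R : realType) (r : R) m : 0 <= r < 1 ->
  \sum_(0 <= l < m) r ^+ l <= (1 - r)^-1.
Proof.
move=> /andP[r0 r1]; have d : 0 < 1 - r by lra.
suff -> : \sum_(0 <= l < m) r ^+ l = (1 - r ^+ m) / (1 - r).
  by rewrite ler_pdivrMr// mulVf ?gt_eqF// gerBl exprn_ge0.
apply: (canRL (mulfK _)); first by rewrite gt_eqF.
elim: m => [|m IH]; first by rewrite big_geq// mul0r expr0 subrr.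
rewrite big_nat_recr//= mulrDl IH exprS; ring.
Qed.

(** Comparing a gap with the number of naturals below it turns an expected time into a sum of
    probabilities. *)
Lemma le_count_levels (R : realType) (g : R) (m : nat) : g <= m%:R ->
  g <= \sum_(0 <= j < m) (j%:R < g)%R%:R.
Proof.
elim: m => [|m IH] gm; first by rewrite big_geq.
rewrite big_nat_recr//=; have [lt|le] := ltP m%:R g; last by rewrite addr0 IH.
rewrite big_nat_cond (eq_bigr (fun=> 1)); last first.
  move=> j /andP[/andP[_ jm] _]; rewrite (lt_trans _ lt)//.
  by rewrite ltr_nat.
rewrite -big_nat_cond sumr_const_nat subn0 -[_ *+ _]/(m%:R).
by rewrite -natr1 in gm.
Qed.

Lemma size_sub_count (R : realType) T (P : pred T) (s : seq T) :
  (size s)%:R - (count P s)%:R = \sum_(a <- s) (if P a then 0 else 1) :> R.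
Proof.
elim: s => [|a s IH]; first by rewrite big_nil subrr.
by rewrite big_cons /= -IH natrD -natr1; case: (P a) => /=; ring.
Qed.

(** * The time needed to see a given path *)

Section law.
Variable R : realType.
Variable mu : probability (noise idx R) R.
Implicit Types (x : noise idx R) (u : int) (n y : nat) (w p : seq bool).
Local Notation mev := (@ev idx R (fun=> True)).
Local Notation pr := (prob mu).
Local Notation half := (2^-1 : R).

(** The interface between the given randomness and the argument. The exponential law enters through
    a density at most 1, which makes short gaps rare and ties null, and through a geometric tail,
    which bounds the expected waiting times. *)
Record noise_law : Prop := {
  law_indep : indep_coords mu ;
  law_coin : forall u n k b, pr (fun x => cn x u n k = b) = half ;
  law_gap : forall u n (a b : R), 0 <= a -> a <= b ->
    pr (fun x => a < gp x u n /\ gp x u n <= b) <= b - a ;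
  law_tail : forall u n j, pr (fun x => j%:R < gp x u n) <= half ^+ j ;
  law_shift : forall z (i : idx) (B : set R), measurable B ->
    mu [set x | B (x (shift_idx z i))] = mu [set x | B (x i)] }.

Hypothesis L : noise_law.

Definition coin_is x (c : (int * nat * nat) * bool) : Prop :=
  cn x c.1.1.1 c.1.1.2 c.1.2 = c.2.

Lemma pr_coins (J : idx -> Prop) S (l : seq ((int * nat * nat) * bool)) :
  ev J S -> uniq (unzip1 l) -> (forall c, c \in l -> ~ J (inr c.1)) ->
  pr (fun x => S x /\ forall c, c \in l -> coin_is x c) = half ^+ size l * pr S.
Proof.
elim: l J S => [|c l IH] J S eS /=.
  by rewrite mul1r => _ _; apply: pr_ext => x; split=> [[]|].
move=> /andP[cl ul] Jl; have ec : ev (fun i => i = inr c.1) (fun x => coin_is x c).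
  by apply: ev_cn; case: c.1 {cl Jl} => -[].
have eSc : ev (fun i => J i \/ i = inr c.1) (fun x => S x /\ coin_is x c).
  by apply: ev_and; [apply: ev_sub eS|apply: ev_sub ec]; tauto.
rewrite (@pr_ext _ _ mu _ (fun x => (S x /\ coin_is x c) /\
    forall d, d \in l -> coin_is x d)); last first.
  move=> x; split=> [[Sx cx]|[[Sx cx] lx]].
    split; first by split=> //; apply: cx; rewrite mem_head.
    by move=> d dl; apply: cx; rewrite inE dl orbT.
  by split=> // d; rewrite inE => /predU1P[->//|]; exact: lx.
rewrite (IH _ _ eSc)//; last first.
  move=> d dl [|[dc]]; first by apply: Jl; rewrite inE dl orbT.
  by move: cl; rewrite -dc map_f.
rewrite (indep_ev (law_indep L) _ eS ec); last first.
  by move=> k Jk kc; apply: (Jl c); rewrite ?mem_head -?kc.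
by rewrite /coin_is (law_coin L) exprSr; ring.
Qed.

Lemma pr_hits (J : idx -> Prop) S u n w : ev J S ->
  (forall k, (k < size w)%N -> ~ J (inr (u, n, k))) ->
  pr (fun x => S x /\ hits x u w n) = half ^+ size w * pr S.
Proof.
move=> eS Jw; pose l := [seq ((u, n, k), nth false w k) | k <- iota 0 (size w)].
have sl : size l = size w by rewrite size_map size_iota.
rewrite -sl -(pr_coins (l := l) eS).
- apply: pr_ext => x; split=> -[Sx].
    move=> /hits_nth h; split=> // c /mapP[k]; rewrite mem_iota => /= kw ->.
    exact: h.
  move=> h; split=> //; apply/hits_nth => k kw.
  by apply: (h ((u, n, k), nth false w k)); apply: map_f; rewrite mem_iota.
- rewrite /unzip1 -map_comp map_inj_uniq ?iota_uniq//.
  by move=> a b [].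
- by move=> c /mapP[k]; rewrite mem_iota => /= kw ->; exact: Jw.
Qed.

Lemma ev_not_future u n S : mev S ->
  (forall x x', agree u n x x' -> S x -> S x') -> ev (fun c => ~ future u n c) S.
Proof. by move=> [mS _] aS; split. Qed.

Section wait.
Variables (u : int) (n0 : nat) (S : noise idx R -> Prop).
Hypothesis eS : ev (fun c => ~ future u n0 c) S.

Lemma sum_gp x m :
  tm x u (n0 + m) - tm x u n0 = \sum_(l <- iota 0 m) gp x u (n0 + l).
Proof.
elim: m => [|m IH]; first by rewrite big_nil addn0 subrr.
by rewrite -[in RHS]addn1 iotaD big_cat big_seq1/= -IH addnS tmS; ring.
Qed.

Lemma pr_gap_le l (d : R) : 0 <= d ->
  pr (fun x => S x /\ gp x u (n0 + l) <= d) <= d * pr S.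
Proof.
move=> d0; have eg : ev (fun c => c = inl (u, (n0 + l)%N)) (fun x => gp x u (n0 + l) <= d).
  by apply: ev_le; [exact: evf_gp|exact: evf_cst].
rewrite (indep_ev (law_indep L) _ eS eg); last first.
  by move=> c nf ce; apply: nf; rewrite ce /=; split=> //; exact: leq_addr.
rewrite mulrC ler_wpM2r ?pr_ge0//.
have := law_gap L u (n0 + l) (lexx 0) d0; rewrite subr0; apply: le_trans.
by rewrite le_eqVlt (@pr_ext _ _ mu _ (fun x => 0 < gp x u (n0 + l) /\
  gp x u (n0 + l) <= d)) ?eqxx// => x; rewrite gp_gt0; split=> [|[]].
Qed.

(* Otherwise at least half of the [m] gaps would be at most [d]. *)
Lemma pr_short_time m (t d : R) : 0 < d -> 0 < t -> 2 * t <= m%:R * d ->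
  pr (fun x => S x /\ tm x u (n0 + m) - tm x u n0 <= t) <= 2 * d * pr S.
Proof.
move=> d0 t0 tm_.
have m0 : 0 < m%:R :> R by rewrite -(pmulr_lgt0 _ d0); apply: lt_le_trans tm_; lra.
pose E l x := S x /\ gp x u (n0 + l) <= d.
have eE l : mev (E l).
  apply: ev_and; first exact: ev_mev eS.
  by apply: ev_le; [exact: evf_gp|exact: evf_cst].
have := pr_count mu (iota 0 m) (m%:R / 2) eE.
have : \sum_(l <- iota 0 m) pr (E l) <= m%:R * (d * pr S).
  apply: (@le_trans _ _ (\sum_(l <- iota 0 m) d * pr S)).
    by apply: ler_sum => l _; apply: pr_gap_le; exact: ltW.
  by rewrite big_const_seq count_predT size_iota iter_addr_0 mulr_natl.
have : pr (fun x => S x /\ tm x u (n0 + m) - tm x u n0 <= t) <=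
    pr (fun x => m%:R / 2 <= (count (fun a => `[< E a x >]) (iota 0 m))%:R :> R).
  apply: pr_le => [||x [Sx le_t]].
  - apply: ev_and; first exact: ev_mev eS.
    by apply: ev_le; [apply: evf_add; [|apply: evf_opp]; exact: evf_tm|exact: evf_cst].
  - exact: ev_count.
  have sumE := sum_gp x m.
  have le_sum : d * (m%:R - (count (fun a => `[< E a x >]) (iota 0 m))%:R) <=
      \sum_(l <- iota 0 m) gp x u (n0 + l).
    rewrite -[in X in X - _](size_iota 0 m) size_sub_count mulr_sumr.
    apply: ler_sum => l _; case: asboolP => [_|nE]; first by rewrite mulr0 ltW// gp_gt0.
    rewrite mulr1 leNgt; apply/negP => lt; apply: nE; split=> //.
    exact: ltW.
  rewrite sumE in le_t; have h := le_trans le_sum le_t.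
  have : d * (m%:R / 2) <= d * (count (fun a => `[< E a x >]) (iota 0 m))%:R by lra.
  by rewrite ler_pM2l.
move=> h1 h2 h3; have h4 := le_trans h3 h2.
have : m%:R / 2 * pr (fun x => S x /\ tm x u (n0 + m) - tm x u n0 <= t) <=
    m%:R / 2 * (2 * d * pr S).
  apply: le_trans (le_trans h4 _); last by lra.
  by rewrite ler_pM2l//; lra.
by rewrite ler_pM2l//; lra.
Qed.

Let A w l x := S x /\ forall m, (m < l)%N -> ~ hits x u w (n0 + m).

(** Only coins are added to the past, so the gap of index [n0 + l] stays independent of the failure
    of the [l] rings before it. *)
Let J l (c : idx) : Prop :=
  ~ future u n0 c \/ (if c is inr (v, m, _) then v = u /\ (m < n0 + l)%N else False).

Let evA w l : ev (J l) (A w l).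
Proof.
apply: ev_and; first by apply: ev_sub eS => c; left.
apply: ev_forall => m; have [ml|ml] := boolP (m < l)%N; last first.
  by apply: ev_ext (@ev_cst idx R _ True) => x; split.
apply: ev_imp; first exact: ev_cst.
by apply/ev_not/ev_hits => k _ /=; right; rewrite ltn_add2l.
Qed.

Let pr_A w l : pr (A w l) = (1 - half ^+ size w) ^+ l * pr S.
Proof.
elim: l => [|l IH].
  by rewrite mul1r; apply: pr_ext => x; split=> [[]//|].
have -> : pr (A w l.+1) = pr (fun x => A w l x /\ ~ hits x u w (n0 + l)).
  apply: pr_ext => x; split=> [[Sx h]|[[Sx h] hl]].
    by split; [split=> // m ml; apply: h; exact: ltnW|exact: h].
  by split=> // m; rewrite ltnS leq_eqVlt => /predU1P[->//|]; exact: h.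
have eh : mev (fun x => hits x u w (n0 + l)) by exact: ev_hits.
have := pr_split mu (ev_mev (evA w l)) eh.
rewrite (pr_hits (evA w l)); last first.
  move=> k _ [|[_]]; last by rewrite ltnn.
  by apply; split=> //; exact: leq_addr.
by rewrite IH exprS => e; lra.
Qed.

Let pr_A_gap w l j : pr (fun x => A w l x /\ j%:R < gp x u (n0 + l)) <=
  (1 - half ^+ size w) ^+ l * pr S * half ^+ j.
Proof.
rewrite (indep_ev (K := fun c => c = inl (u, (n0 + l)%N)) (law_indep L) _ (evA w l)).
- by rewrite pr_A ler_wpM2l ?law_tail// -pr_A pr_ge0.
- move=> c Jc ce; move: Jc; rewrite ce => -[|//].
  by apply; split=> //; exact: leq_addr.
by apply: ev_lt; [exact: evf_cst|exact: evf_gp].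
Qed.

(* The rings are failures with probability [1 - 2^-|w|] each, so the expected time
   to the first success is at most [2 * 2^|w|]; the time is compared with the
   number of pairs (l, j) such that the first l rings fail and the next gap
   exceeds j. *)
Lemma pr_wait w (s : R) : 0 < s ->
  pr (fun x => S x /\ ~ exists n, [/\ (n0 <= n)%N, hits x u w n &
    tm x u n.+1 - tm x u n0 <= s]) <= 2 * 2 ^+ size w / s * pr S.
Proof.
move=> s0; set bad := (X in pr X); pose q : R := half ^+ size w.
have q0 : 0 < q by rewrite exprn_gt0// invr_gt0.
have q1 : q <= 1 by rewrite exprn_ile1// ?invr_ge0// invf_le1//; lra.
have ebad : mev bad.
  apply: ev_and; [exact: ev_mev eS|apply: ev_not; apply: ev_exists => n].
  suff : mev (fun x => (n0 <= n)%N /\ (hits x u w n /\ tm x u n.+1 - tm x u n0 <= s)).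
    by apply: ev_ext => x; split=> [[? []]|[]].
  apply: ev_and; first exact: ev_cst.
  apply: ev_and; first exact: ev_hits.
  by apply: ev_le; [apply: evf_add; [|apply: evf_opp]; exact: evf_tm|exact: evf_cst].
(* Truncation to the first [m] rings. The error terms, for [m] failures and for a gap longer than
   [m + m], vanish as [m] grows; the last term is Markov's bound for the number of pairs. *)
have bound m : pr bad <= (1 - q) ^+ m * pr S + half ^+ m + 2 * 2 ^+ size w / s * pr S.
  pose E (c : nat * nat) x := A w c.1 x /\ c.2%:R < gp x u (n0 + c.1).
  have eE c : mev (E c).
    by apply: ev_and; [exact: ev_mev (evA _ _)|apply: ev_lt;
      [exact: evf_cst|exact: evf_gp]].
  pose B1 x := exists2 l, l \in iota 0 m & (m + m)%:R < gp x u (n0 + l).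
  pose cl := [seq (l, j) | l <- iota 0 m, j <- iota 0 (m + m)].
  pose B2 x := s <= (count (fun c => `[< E c x >]) cl)%:R.
  have eB1 : mev B1.
    rewrite (_ : B1 = fun x => exists l, l \in iota 0 m /\ (m + m)%:R < gp x u (n0 + l)).
      apply: ev_exists => l; apply: ev_and; first exact: ev_cst.
      by apply: ev_lt; [exact: evf_cst|exact: evf_gp].
    by apply/funext => x; apply/propext; split=> [[l]|[l []]]; exists l.
  have eB2 : mev B2 by exact: ev_count.
  have eAm : mev (A w m) by exact: ev_mev (evA w m).
  have sub x : bad x -> A w m x \/ (B1 x \/ B2 x).
    move=> [Sx nb]; have [|nAm] := pselect (A w m x); first by left.
    have [|nB1] := pselect (B1 x); first by right; left.
    right; right.
    have [l [lm hl min]] : exists l, [/\ (l < m)%N, hits x u w (n0 + l) &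
        forall k, (k < l)%N -> ~ hits x u w (n0 + k)].
      have ex : exists l, (l < m)%N && hits x u w (n0 + l).
        apply: contrapT => nex; apply: nAm; split=> // k km hk; apply: nex.
        by exists k; rewrite km.
      case: (ex_minnP ex) => l /andP[lm hl] min; exists l; split=> // k kl hk.
      by have := min k; rewrite (ltn_trans kl lm) hk leqNgt kl => /(_ isT).
    have lt_s : s < tm x u (n0 + l.+1) - tm x u n0.
      rewrite ltNge; apply/negP => le_s; apply: nb; exists (n0 + l)%N.
      by rewrite leq_addr hl -addnS.
    rewrite /B2; apply: (le_trans (ltW lt_s)).
    rewrite sum_gp.
    have gle k : (k < m)%N -> gp x u (n0 + k) <=
        \sum_(j <- iota 0 (m + m)) (j%:R < gp x u (n0 + k))%R%:R.
      move=> km; have := @le_count_levels R (gp x u (n0 + k)) (m + m).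
      rewrite /index_iota subn0; apply; rewrite leNgt; apply/negP => lt.
      by apply: nB1; exists k => //; rewrite mem_iota.
    rewrite -sum1_count natr_sum [leRHS]big_mkcond /cl big_allpairs.
    rewrite (_ : iota 0 m = iota 0 l.+1 ++ iota l.+1 (m - l.+1)); last first.
      by rewrite -[X in iota _ X](subnKC lm) iotaD.
    rewrite [leRHS]big_cat -[leLHS]addr0; apply: lerD; last first.
      by apply: sumr_ge0 => k _; apply: sumr_ge0 => j _; case: ifP.
    rewrite [leLHS]big_seq [leRHS]big_seq; apply: ler_sum => k.
    rewrite mem_iota add0n ltnS => kl; apply: le_trans (gle _ _) _.
      exact: leq_ltn_trans kl lm.
    apply: ler_sum => j _; case: ltP => [lt|_]; last by case: ifP.
    rewrite asboolT//; split=> //=; split=> // k' kk'.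
    by apply: min; exact: leq_trans kk' kl.
  have le1 : pr bad <= pr (fun x => A w m x \/ (B1 x \/ B2 x)).
    by apply: pr_le => //; apply: ev_or => //; exact: ev_or.
  have le2 := pr_or mu eAm (ev_or eB1 eB2).
  have le3 := pr_or mu eB1 eB2.
  (* There are [m] gaps, each with tail [half ^+ (m + m)]; doubling the threshold pays for the
     factor [m]. *)
  have le4 : pr B1 <= half ^+ m.
    have : pr B1 <= \sum_(l <- iota 0 m) half ^+ (m + m).
      apply: (pr_exists_seq (Q := fun l x => (m + m)%:R < gp x u (n0 + l))) => //.
        by move=> l; apply: ev_lt; [exact: evf_cst|exact: evf_gp].
      by move=> l; exact: law_tail.
    move=> h; apply: le_trans h _.
    rewrite big_const_seq count_predT size_iota iter_addr_0 -[leLHS]mulr_natr exprD -mulrA.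
    rewrite ler_piMr// ?exprn_ge0 ?invr_ge0// exprVn mulrC ler_pdivrMr ?exprn_gt0//.
    by rewrite mul1r -natrX ler_nat ltnW// ltn_expl.
  have le5 : pr B2 <= 2 * 2 ^+ size w / s * pr S.
    have := pr_count mu cl s eE; rewrite -/B2 => h.
    have : s * pr B2 <= 2 * 2 ^+ size w * pr S.
      apply: le_trans h _; rewrite /cl big_allpairs/=.
      have half01 : 0 <= half < 1 by lra.
      apply: (@le_trans _ _ (\sum_(l <- iota 0 m) (1 - q) ^+ l * (2 * pr S))).
        apply: ler_sum => l _.
        apply: (@le_trans _ _ (\sum_(j <- iota 0 (m + m)) (1 - q) ^+ l * pr S * half ^+ j)).
          by apply: ler_sum => j _; exact: pr_A_gap.
        rewrite -mulr_sumr -mulrA ler_wpM2l ?exprn_ge0 ?subr_ge0//.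
        rewrite mulrC ler_wpM2r ?pr_ge0//.
        have := @sum_geometric R half (m + m) half01.
        rewrite /index_iota subn0 (_ : 1 - half = half); last by lra.
        by rewrite invrK.
      have le_sum : \sum_(l <- iota 0 m) (1 - q) ^+ l <= 2 ^+ size w.
        have := @sum_geometric R (1 - q) m; rewrite /index_iota subn0 subKr.
        by rewrite /q exprVn invrK; apply; rewrite -exprVn -/q; lra.
      have p0 : 0 <= 2 * pr S by rewrite mulr_ge0 ?pr_ge0.
      by rewrite -mulr_suml; have := ler_wpM2r p0 le_sum; lra.
    move=> h'; rewrite mulrAC ler_pdivlMr// mulrC; exact: h'.
  rewrite pr_A in le2; lra.
apply/ler_addgt0Pr => e e0.
pose r := Num.max (1 - q) half.
have r01 : 0 <= r < 1.
  by rewrite le_max gt_max; apply/andP; split; [apply/orP; right|apply/andP; split]; lra.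
have [|m rm] := @exprn_small R r (e / 2) r01; first by lra.
have h1 : (1 - q) ^+ m <= r ^+ m by rewrite lerXn2r ?nnegrE ?le_max ?lexx ?subr_ge0//;
  lra.
have h2 : half ^+ m <= r ^+ m by rewrite lerXn2r ?nnegrE ?le_max ?lexx ?orbT ?subr_ge0//; lra.
have h3 : pr S <= 1 by apply: pr_le1; exact: ev_mev eS.
have h4 : (1 - q) ^+ m * pr S <= (1 - q) ^+ m.
  by rewrite ler_piMr// exprn_ge0// subr_ge0.
by have := bound m; lra.
Qed.

End wait.
End law.

(** * The number of arrivals on the time scale 2^y *)

Section tightness.
Variable R : realType.
Variable mu : probability (noise idx R) R.
Implicit Types (x : noise idx R) (u : int) (n y : nat) (w p : seq bool).
Local Notation mev := (@ev idx R (fun=> True)).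
Local Notation pr := (prob mu).
Local Notation half := (2^-1 : R).
Hypothesis L : noise_law mu.

Lemma mev_st y i o : mev (fun x => st x y i = o).
Proof. exact: ev_mev (ev_st _ y i o). Qed.

Lemma mev_tm_le u n (t : R) : mev (fun x => tm x u n <= t).
Proof. by apply: ev_le; [exact: evf_tm|exact: evf_cst]. Qed.

Section wait_partition.
Variables (T : countType) (S : T -> noise idx R -> Prop).
Variables (u : T -> int) (n0 : T -> nat) (w : T -> seq bool) (l : nat) (s : R).
Hypothesis eS : forall a, mev (S a).
Hypothesis dis : forall a b x, S a x -> S b x -> a = b.
Hypothesis agreeS : forall a x x', agree (u a) (n0 a) x x' -> S a x -> S a x'.
Hypothesis size_w : forall a x, S a x -> size (w a) = l.

Definition slow a x := ~ exists n, [/\ (n0 a <= n)%N, hits x (u a) (w a) n &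
    tm x (u a) n.+1 - tm x (u a) (n0 a) <= s].

Lemma mev_slow a : mev (slow a).
Proof.
apply: ev_not; apply: ev_exists => n.
suff : mev (fun x => (n0 a <= n)%N /\ (hits x (u a) (w a) n /\
    tm x (u a) n.+1 - tm x (u a) (n0 a) <= s)).
  by apply: ev_ext => x; split=> [[? []]|[]].
apply: ev_and; first exact: ev_cst.
apply: ev_and; first exact: ev_hits.
by apply: ev_le; [apply: evf_add; [|apply: evf_opp]; exact: evf_tm|exact: evf_cst].
Qed.

(** The bound of [pr_wait] depends on the length of the word alone, so it survives a partition
    according to what has happened up to a stopping time. *)
Lemma pr_slow : 0 < s ->
  pr (fun x => exists a, S a x /\ slow a x) <= 2 * 2 ^+ l / s.
Proof.
(* One event for all pieces; as these are disjoint, on their union it says that the piece which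
   holds is slow. *)
move=> s0; pose E x := forall a, S a x -> slow a x.
have eE : mev E.
  by apply: ev_forall => a; apply: ev_imp; [exact: eS|exact: mev_slow].
have c0 : 0 <= 2 * 2 ^+ l / s by rewrite divr_ge0 ?mulr_ge0 ?exprn_ge0 ?ltW.
have le a : pr (fun x => E x /\ S a x) <= 2 * 2 ^+ l / s * pr (S a).
  have [[x Sx]|nS] := pselect (exists x, S a x); last first.
    rewrite (@pr_ext _ _ mu _ (fun=> False)); last first.
      by move=> x; split=> // -[_ Sx]; apply: nS; exists x.
    by rewrite pr0 mulr_ge0// pr_ge0.
  have := pr_wait L (ev_not_future (eS a) (@agreeS a)) (w a) s0.
  rewrite (size_w Sx); apply: le_trans.
  apply: pr_le; [exact: ev_and|apply: ev_and => //; exact: mev_slow|].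
  by move=> z [Ez Sz]; split=> //; exact: Ez.
have := pr_cond_le eS dis eE le => h.
rewrite (@pr_ext _ _ mu _ (fun x => E x /\ exists a, S a x)).
  apply: le_trans h _; rewrite ler_piMr// pr_le1//; exact: ev_exists.
move=> x; split=> [[a [Sa sa]]|[Ex [a Sa]]]; last by exists a; split=> //; exact: Ex.
by split; [move=> b Sb; rewrite -(dis Sa Sb)|exists a].
Qed.

End wait_partition.

Definition late y i (t : R) x : Prop := ~ exists2 s, st x y i = Some s & join_time x s <= t.

Lemma mev_late y i t : mev (late y i t).
Proof.
apply: ev_not; rewrite (_ : (fun x => _) = fun x => exists s, st x y i = Some s /\ join_time x s <= t).
  apply: ev_exists => s; apply: ev_and; first exact: mev_st.
  exact: mev_tm_le.
by apply/funext => x; apply/propext; split=> [[s]|[s []]]; exists s.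
Qed.

(* A vertex of level [y + 1] which is late at time [B 2^(y + 1)] has a parent which
   is late at time [3/2 B 2^y], or which waits longer than [B 2^y / 2] before
   sending a particle to it: [24 / B = 24 / (3/2 B) + 8 / B]. *)
Lemma pr_late y i (B : R) : 0 < B -> pr (late y i (B * 2 ^+ y)) <= 24 / B.
Proof.
elim: y i B => [|y IH] i B B0.
  rewrite (@pr_ext _ _ mu _ (fun=> False)) ?pr0 ?divr_ge0 ?(ltW B0)// => x.
  split=> // nl; apply: nl; exists (i, 0%N, [::]) => //.
  by rewrite /join_time/= tm0 mulr1 ltW.
have p2 : 0 < 2 ^+ y :> R by rewrite exprn_gt0.
pose s : R := B * 2 ^+ y / 2.
have s0 : 0 < s by rewrite /s divr_gt0// mulr_gt0.
pose S (a : state) x := st x y i = Some a.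
pose W x := exists a : state, S a x /\
  slow (fun a : state => a.1.1) (fun a => a.1.2) (fun a => rcons a.2 false) s a x.
have eW : mev W by apply: ev_exists => a; apply: ev_and; [exact: mev_st|exact: mev_slow].
have prW : pr W <= 8 / B.
  have := @pr_slow state S (fun a => a.1.1) (fun a => a.1.2)
    (fun a => rcons a.2 false) y.+1 s.
  rewrite (_ : 2 * 2 ^+ y.+1 / s = 8 / B); last first.
    by rewrite /s exprS; field; rewrite ?gt_eqF.
  apply=> //.
  - by move=> a; exact: mev_st.
  - by move=> a b x; rewrite /S => -> [].
  - by move=> [[u n] p] x x' e; exact: st_future e.
  - by move=> [[u n] p] x /= e; rewrite size_rcons (st_size e).
have := IH i (3 / 2 * B); set t := 3 / 2 * B * 2 ^+ y => prl.
have : pr (late y.+1 i (B * 2 ^+ y.+1)) <= pr (fun x => late y i t x \/ W x).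
  apply: pr_le => [||x]; [exact: mev_late|exact: ev_or (mev_late _ _ _) eW|].
  move=> lx; have [|nl] := pselect (late y i t x); [by left|right].
  have /contrapT[[[u n0] p] e jle] := nl.
  exists (u, n0, p); split=> // -[n [n0n hn tn]]; apply: lx.
  have An : Arr x y i u n.
    by exists n0, p; split=> //; move: hn; rewrite /= hits_rcons => /andP[].
  have cnf : cn x u n y = false.
    by move: hn; rewrite /= hits_rcons (st_size e) => /andP[_ /eqP].
  have [c ec jc] := Arr_cand An cnf.
  have le : tm x u n.+1 <= B * 2 ^+ y.+1.
    move: tn jle; rewrite /join_time/= /s /t exprS; lra.
  (* Only the right parent has been followed; if the left one wins, the vertex joins no later. *)
  rewrite stS; case: ifPn => w.
    move: w; rewrite /win ec; case: (cand x (st x y (i - 1)) true) => [c1|//] /= h.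
    by exists c1 => //; apply: le_trans h (le_trans jc le).
  by exists c => //; exact: le_trans jc le.
move=> h1; have h2 := pr_or mu (mev_late y i t) eW.
have : 0 < 3 / 2 * B by lra.
move=> /prl h3; have -> : 24 / B = 24 / (3 / 2 * B) + 8 / B by field; rewrite gt_eqF.
lra.
Qed.

(** The second arrival is there for [lead_shrink], where the first one stops in creating a child and
    the second goes on to that child. *)
Definition busy y i (t : R) x : Prop := exists u n1 n2,
  [/\ (n1 < n2)%N, Arr x y i u n1, Arr x y i u n2 & tm x u n2.+1 <= t].

(** The list records ring indices only, since all particles that arrive at a vertex start from the
    same root. *)
Definition few y i (t : R) (m : nat) x : Prop := exists l : seq nat,
  (size l <= m)%N /\ forall u n, Arr x y i u n -> tm x u n.+1 <= t -> n \in l.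

Lemma ev_tm_le y u n (t : R) : ev (low y) (fun x => tm x u n <= t).
Proof. by apply: ev_le; [exact: evf_tm_low|exact: evf_cst]. Qed.

Lemma ev_busy y i (t : R) : ev (low y) (busy y i t).
Proof.
apply: ev_exists => u; apply: ev_exists => n1; apply: ev_exists => n2.
suff : ev (low y) (fun x => (n1 < n2)%N /\
    (Arr x y i u n1 /\ (Arr x y i u n2 /\ tm x u n2.+1 <= t))).
  by apply: ev_ext => x; split=> [[? [? []]]|[? ? ? ?]].
apply: ev_and; first exact: ev_cst.
do 2!(apply: ev_and; first exact: ev_Arr).
exact: ev_tm_le.
Qed.

Lemma ev_few y i (t : R) m : ev (low y) (few y i t m).
Proof.
apply: ev_exists => l; apply: ev_and; first exact: ev_cst.
apply: ev_forall => u; apply: ev_forall => n.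
apply: ev_imp; first exact: ev_Arr.
by apply: ev_imp; [exact: ev_tm_le|exact: ev_cst].
Qed.

Lemma mev_busy y i t : mev (busy y i t).
Proof. exact: ev_mev (ev_busy y i t). Qed.

Lemma mev_few y i t m : mev (few y i t m).
Proof. exact: ev_mev (ev_few y i t m). Qed.

(** The time is cut into thirds: the vertex joins, then come a first and a second arrival. This
    gives 84 = 24 * 3 + 6 + 6. *)
Lemma pr_not_busy y i (B : R) : 0 < B ->
  pr (fun x => ~ busy y i (B * 2 ^+ y) x) <= 84 / B.
Proof.
move=> B0; have p2 : 0 < 2 ^+ y :> R by rewrite exprn_gt0.
pose s : R := B / 3 * 2 ^+ y.
have s0 : 0 < s by rewrite /s mulr_gt0// divr_gt0.
have cost : 2 * 2 ^+ y / s = 6 / B by rewrite /s; field; rewrite ?gt_eqF.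
pose S1 (a : state) x := st x y i = Some a.
pose W1 x := exists a : state, S1 a x /\
  slow (fun a : state => a.1.1) (fun a => a.1.2) (fun a => a.2) s a x.
have eW1 : mev W1 by apply: ev_exists => a; apply: ev_and;
  [exact: mev_st|exact: mev_slow].
have prW1 : pr W1 <= 6 / B.
  have := @pr_slow state S1 (fun a => a.1.1) (fun a => a.1.2) (fun a => a.2) y s.
  rewrite cost; apply=> //.
  - by move=> a; exact: mev_st.
  - by move=> a b x; rewrite /S1 => -> [].
  - by move=> [[u n] p] x x' e; exact: st_future e.
  - by move=> [[u n] p] x /= e; rewrite (st_size e).
(* The second wait starts just after the first hit, so the partition also records the index of that
   hit. *)
pose S2 (a : state * nat) x := st x y i = Some a.1 /\
  hit x a.1.1.1 a.1.1.2 a.1.2 = Some a.2.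
have eS2 a : mev (S2 a) by apply: ev_and; [exact: mev_st|exact: ev_hit_Some].
pose W2 x := exists a : state * nat, S2 a x /\
  slow (fun a : state * nat => a.1.1.1) (fun a => a.2.+1) (fun a => a.1.2) s a x.
have eW2 : mev W2 by apply: ev_exists => a; apply: ev_and; [exact: eS2|exact: mev_slow].
have prW2 : pr W2 <= 6 / B.
  have := @pr_slow (state * nat)%type S2 (fun a => a.1.1.1) (fun a => a.2.+1)
    (fun a => a.1.2) y s.
  rewrite cost; apply=> //.
  - move=> [s1 n1] [s2 n2] x [/= e1 h1] [/= e2 h2].
    by move: h1 h2; rewrite e1 in e2; move: e2 => [->] -> [->].
  - move=> [[[u n0] p] n] x x' e [/= e1 hn]; split => /=.
      apply: (st_future _ e1) => c nf; apply: e => fc; apply: nf.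
      have /hitP[n0n _ _] := hn; case: c fc => [[v m]|[[v m] k]] /= [vu nm];
        by split=> //; apply: leq_trans n0n (ltnW nm).
    by apply: agree_hit e _ hn => _.
  - by move=> [[[u n0] p] n] x [/= e _]; rewrite (st_size e).
have := pr_late y i (B := B / 3); set t := B / 3 * 2 ^+ y => prl.
have : pr (fun x => ~ busy y i (B * 2 ^+ y) x) <=
    pr (fun x => late y i t x \/ (W1 x \/ W2 x)).
  apply: pr_le => [||x nb].
  - exact/ev_not/mev_busy.
  - by apply: ev_or; [exact: mev_late|exact: ev_or].
  have [|/contrapT[[[u n0] p] e jle]] := pselect (late y i t x); first by left.
  right; have [|nW1] := pselect (W1 x); [by left|right].
  have [[n1 [n01 h1 t1]]|ns] := pselect (exists n, [/\ (n0 <= n)%N, hits x u p n &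
      tm x u n.+1 - tm x u n0 <= s]); last by case: nW1; exists (u, n0, p).
  have [n hn nn1] := hit_ex n01 h1.
  have /hitP[n0n hn' _] := hn.
  exists ((u, n0, p), n); split=> // -[n2 [/= nn2 h2 t2]]; apply: nb.
  exists u, n, n2; split=> //; [by exists n0, p|by exists n0, p; split=> //; lia|].
  have : tm x u n.+1 <= tm x u n1.+1 by rewrite ler_tm.
  by move: t1 t2 jle; rewrite /join_time/= /s /t; lra.
move=> h1; have h2 := pr_or mu (mev_late y i t) (ev_or eW1 eW2).
have h3 := pr_or mu eW1 eW2.
have : 0 < B / 3 by lra.
move=> /prl h4; have -> : 84 / B = 24 / (B / 3) + 6 / B + 6 / B by field; rewrite gt_eqF.
lra.
Qed.

(** The first term bounds the chance that [m] further rings of the root fit into time [t] after the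
    vertex has joined. Otherwise all arrivals by time [t] are among these [m] rings, each of which
    arrives with probability [half ^+ y], and Markov's inequality gives the second term. *)
Lemma pr_not_few y i (t d : R) m k : 0 < d -> 0 < t -> 2 * t <= m%:R * d ->
  pr (fun x => ~ few y i t k x) <= 2 * d + m%:R * half ^+ y / k.+1%:R.
Proof.
move=> d0 t0 tmd.
pose S (a : state) x := st x y i = Some a.
pose U x := exists s : state, S s x.
pose E x := ~ few y i t k x.
have eE : mev E by exact/ev_not/mev_few.
have dis a b x : S a x -> S b x -> a = b by rewrite /S => -> [].
set c : R := 2 * d + _.
have k0 : 0 < k.+1%:R :> R by rewrite ltr0n.
have c0 : 0 <= c.
  apply: addr_ge0; first by rewrite mulr_ge0 ?(ltW d0).
  apply: divr_ge0; last exact: ltW.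
  by rewrite mulr_ge0// exprn_ge0// invr_ge0.
have le (a : state) : pr (fun x => E x /\ S a x) <= c * pr (S a).
  case: a => [[u n0] p].
  have eS : ev (fun c => ~ future u n0 c) (S (u, n0, p)).
    apply: ev_not_future; first exact: mev_st.
    by move=> x x' e; exact: st_future e.
  have h1 := pr_short_time L eS d0 t0 tmd.
  pose F l x := S (u, n0, p) x /\ hits x u p (n0 + l).
  have eF l : mev (F l) by apply: ev_and; [exact: mev_st|exact: ev_hits].
  have h2 := pr_count mu (iota 0 m) k.+1%:R eF.
  have h3 : \sum_(l <- iota 0 m) pr (F l) <= m%:R * half ^+ y * pr (S (u, n0, p)).
    apply: (@le_trans _ _ (\sum_(l <- iota 0 m) half ^+ y * pr (S (u, n0, p)))).
      apply: ler_sum => l _; rewrite (pr_hits L eS); last first.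
        by move=> j _ /=; apply; split=> //; exact: leq_addr.
      have [[x e]|nS] := pselect (exists x, S (u, n0, p) x); first by rewrite (st_size e).
      rewrite (@pr_ext _ _ mu (S (u, n0, p)) (fun=> False)) ?pr0 ?mulr0// => x.
      by split=> // Sx; apply: nS; exists x.
    by rewrite big_const_seq count_predT size_iota iter_addr_0 -[leLHS]mulr_natl mulrA.
  pose Q1 x := S (u, n0, p) x /\ tm x u (n0 + m) - tm x u n0 <= t.
  pose Q2 x := k.+1%:R <= (count (fun l => `[< F l x >]) (iota 0 m))%:R :> R.
  have eQ1 : mev Q1.
    apply: ev_and; first exact: mev_st.
    by apply: ev_le; [apply: evf_add; [|apply: evf_opp]; exact: evf_tm|exact: evf_cst].
  have eQ2 : mev Q2 by exact: ev_count.
  have : pr (fun x => E x /\ S (u, n0, p) x) <= pr (fun x => Q1 x \/ Q2 x).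
    apply: pr_le => [||x [Ex Sx]]; [apply: ev_and => //; exact: mev_st|exact: ev_or|].
    apply: contrapT => /not_orP[nQ1 nQ2]; apply: Ex.
    exists [seq (n0 + l)%N | l <- iota 0 m & `[< F l x >]]; split.
      rewrite size_map size_filter leqNgt; apply/negP => lt; apply: nQ2.
      by rewrite /Q2 ler_nat.
    move=> v n [n1 [q []]]; rewrite Sx => -[<- <- <-] n0n hn tn.
    have [nm|mn] := ltnP (n - n0) m.
      apply/mapP; exists (n - n0)%N; last by rewrite subnKC.
      by rewrite mem_filter mem_iota add0n nm leq0n !andbT; apply/asboolP; split=> //;
        rewrite subnKC.
    case: nQ1; split=> //; apply: le_trans tn.
    apply: (@le_trans _ _ (tm x u (n0 + m))).
      by rewrite gerBl -(tm0 x u) ler_tm.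
    by rewrite ler_tm; lia.
  move=> h4; have h5 := pr_or mu eQ1 eQ2.
  have h6 : pr Q2 <= m%:R * half ^+ y / k.+1%:R * pr (S (u, n0, p)).
    by rewrite mulrAC ler_pdivlMr// mulrC; exact: le_trans h2 h3.
  apply: le_trans h4 (le_trans h5 _); rewrite /c mulrDl.
  by apply: lerD; [exact: h1|exact: h6].
have := pr_cond_le (fun a => mev_st y i (Some a)) dis eE le => h.
rewrite (@pr_ext _ _ mu _ (fun x => E x /\ U x)).
  apply: le_trans h _; rewrite ler_piMr// pr_le1//; apply: ev_exists => a; exact: mev_st.
move=> x; split=> [Ex|[]//]; split=> //; apply: contrapT => nU; apply: Ex.
exists [::]; split=> // v n [n1 [q [e]]]; case: nU; by exists (v, n1, q).
Qed.

Definition good (B : R) k y i x : Prop :=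
  busy y i (B * 2 ^+ y) x /\ few y i (B * 2 ^+ y) k x.

Lemma ev_good (B : R) k y i : ev (low y) (good B k y i).
Proof. by apply: ev_and; [exact: ev_busy|exact: ev_few]. Qed.

Lemma mev_good B k y i : mev (good B k y i).
Proof. exact: ev_mev (ev_good B k y i). Qed.

Lemma good_likely (e : R) : 0 < e -> exists B k, 0 < B /\
  forall y i, pr (fun x => ~ good B k y i x) <= e.
Proof.
(* The budget is [84 / B = e / 2], then [2 * d = e / 4], and [e / 4] for Markov's inequality. The
   number [m] of rings grows like [2 ^+ y], but [m%:R * half ^+ y] stays below [K], so that [k] does
   not depend on [y]. *)
move=> e0; pose B : R := 84 * 2 / e; pose d := e / 8.
have B0 : 0 < B by rewrite /B divr_gt0// mulr_gt0.
have d0 : 0 < d by rewrite /d divr_gt0.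
pose K : R := 2 * B / d + 1.
pose k := Num.trunc (K / (e / 4)); exists B, k; split=> // y i.
have p2 : 0 < 2 ^+ y :> R by rewrite exprn_gt0.
have p21 : 1 <= 2 ^+ y :> R by rewrite exprn_ege1//; lra.
pose t := B * 2 ^+ y; have t0 : 0 < t by rewrite mulr_gt0.
pose m := (Num.trunc (2 * t / d)).+1.
have td0 : 0 <= 2 * t / d by apply: divr_ge0; [rewrite mulr_ge0// ltW|exact: ltW].
have /andP[m1 m2] := truncn_itv td0.
have tmd : 2 * t <= m%:R * d by rewrite -ler_pdivrMr// ltW.
have h1 := pr_not_few y i k d0 t0 tmd.
have h2 := pr_not_busy y i B0.
have K0 : 0 < K by rewrite /K addr_gt0// divr_gt0// mulr_gt0.
have h3 : m%:R * half ^+ y <= K.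
  rewrite exprVn ler_pdivrMr// /K mulrDl mul1r.
  rewrite (_ : 2 * B / d * 2 ^+ y = 2 * t / d); last by rewrite /t; ring.
  by rewrite /m -natr1; apply: lerD.
have Ke0 : 0 <= K / (e / 4) by apply: divr_ge0; [exact: ltW|rewrite divr_ge0// ltW].
have /andP[_ k2] := truncn_itv Ke0.
have h4 : m%:R * half ^+ y / k.+1%:R <= e / 4.
  rewrite ler_pdivrMr ?ltr0n//; apply: le_trans h3 _.
  by rewrite mulrC -ler_pdivrMr ?divr_gt0// ltW.
have : pr (fun x => ~ good B k y i x) <=
    pr (fun x => ~ busy y i t x \/ ~ few y i t k x).
  apply: pr_le => [||x /not_andP//]; first exact/ev_not/mev_good.
  by apply: ev_or; apply: ev_not; [exact: mev_busy|exact: mev_few].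
have := pr_or mu (ev_not (mev_busy y i t)) (ev_not (mev_few y i t k)).
have : 84 / B = e / 2 by rewrite /B; field; rewrite gt_eqF.
move=> eB g1 g2; apply: le_trans g2 (le_trans g1 _).
apply: le_trans (lerD h2 (le_trans h1 (lerD (lexx _) h4))) _; rewrite eB /d; lra.
Qed.

End tightness.

(** * Prescribing coins *)

Section forcing.
Variable R : realType.
Variable mu : probability (noise idx R) R.
Implicit Types (x : noise idx R) (u : int) (n y : nat).
Local Notation mev := (@ev idx R (fun=> True)).
Local Notation pr := (prob mu).
Local Notation half := (2^-1 : R).
Hypothesis L : noise_law mu.

Section force.
Variables (y l : nat) (H : noise idx R -> Prop).
Variable spec : bool -> int -> nat -> noise idx R -> Prop.
Hypothesis eH : ev (low y) H.
Hypothesis eS : forall b u n, ev (low y) (spec b u n).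
Hypothesis specF : forall u n x, spec true u n x -> spec false u n x -> False.
Hypothesis fin : forall x, H x -> exists s : seq (int * nat),
  (size s <= l)%N /\ forall b u n, spec b u n x -> (u, n) \in s.

Definition obey x := forall b u n, spec b u n x -> cn x u n y = b.

Lemma mev_obey : mev obey.
Proof.
do 3!apply: ev_forall => ?; apply: ev_imp; last exact: ev_cn.
exact: ev_mev (eS _ _ _).
Qed.

(** The set of prescribed coins is random. [H] is partitioned according to the list of least code
    which contains all the prescriptions; the list is constant on its piece and may prescribe more
    than is asked. *)
Let key : countType := seq (int * nat * bool).

Let ok (c : key) : bool := uniq (unzip1 c) && (size c <= l)%N.

Let Rk (c : key) x : Prop :=
  [/\ H x, ok c & forall b u n, spec b u n x -> ((u, n), b) \in c].

Let eRk c : ev (low y) (Rk c).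
Proof.
suff : ev (low y) (fun x => H x /\ (ok c /\ forall b u n, spec b u n x -> ((u, n), b) \in c)).
  by apply: ev_ext => x; split=> [[? []]|[]].
apply: ev_and => //; apply: ev_and; first exact: ev_cst.
by do 3!apply: ev_forall => ?; apply: ev_imp => //; exact: ev_cst.
Qed.

Let Sk (c : key) x : Prop :=
  Rk c x /\ forall c', (pickle c' < pickle c)%N -> ~ Rk c' x.

Let eSk c : ev (low y) (Sk c).
Proof.
apply: ev_and => //; apply: ev_forall => c'.
by apply: ev_imp; [exact: ev_cst|exact: ev_not].
Qed.

Let SkE x : (exists c, Sk c x) <-> H x.
Proof.
split=> [[c [[]]]//|Hx].
have [s [sl ss]] := fin Hx.
pose c0 : key := [seq (k, `[< spec true k.1 k.2 x >]) | k <- undup s].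
have R0 : Rk c0 x.
  split=> //; first apply/andP; first split.
  - by rewrite /unzip1 -map_comp map_id_in ?undup_uniq// => k.
  - by rewrite size_map; apply: leq_trans (size_undup _) sl.
  move=> b u n sx; apply/mapP; exists (u, n); first by rewrite mem_undup; exact: ss sx.
  congr pair => /=; case: b sx => sx; first by rewrite asboolT.
  by rewrite asboolF// => st; exact: specF st sx.
have ex : exists m, `[< exists2 c, pickle c = m & Rk c x >].
  by exists (pickle c0); apply/asboolP; exists c0.
case: (ex_minnP ex) => m /asboolP[c cm Rc] min; exists c; split=> // c' lt Rc'.
have : (m <= pickle c')%N by apply: min; apply/asboolP; exists c'.
by rewrite leqNgt -cm lt.
Qed.

Let Sk_dis c c' x : Sk c x -> Sk c' x -> c = c'.
Proof.
move=> [Rc mc] [Rc' mc']; have [lt|lt|e] := ltngtP (pickle c) (pickle c').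
- by case: (mc' _ lt).
- by case: (mc _ lt).
exact: pcan_inj (@pickleK key) _ _ e.
Qed.

(* Conditionally on the gaps and the coins of index less than [y], on which [H]
   and [spec] depend, [obey] prescribes at most [l] independent coins. *)
Lemma pr_force : pr H <= 2 ^+ l * pr (fun x => H x /\ obey x).
Proof.
have q1 (k : nat) : half ^+ k <= 1 by rewrite exprn_ile1// ?invr_ge0// invf_le1//; lra.
(* The failure of [obey] is estimated because [pr_cond_le] transfers upper bounds. *)
have le c : pr (fun x => ~ obey x /\ Sk c x) <= (1 - half ^+ l) * pr (Sk c).
  have [[x0 [[_ okc _] _]]|nS] := pselect (exists x, Sk c x); last first.
    rewrite (@pr_ext _ _ mu _ (fun=> False)); last first.
      by move=> x; split=> // -[_ Sx]; apply: nS; exists x.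
    by rewrite pr0 mulr_ge0 ?pr_ge0// subr_ge0.
  pose c' := [seq (k.1.1, k.1.2, y, k.2) | k <- c].
  have := @pr_coins R mu L _ (Sk c) c' (eSk c); rewrite size_map => h.
  have e1 : pr (fun x => Sk c x /\ forall d, d \in c' -> coin_is x d) =
      half ^+ size c * pr (Sk c).
    apply: h; last by move=> d /mapP[k _ ->] /=; rewrite ltnn.
    rewrite /unzip1 -map_comp (_ : map _ c = map (fun k => (k.1, k.2, y)) (unzip1 c)).
      by rewrite map_inj_uniq; [case/andP: okc|move=> [? ?] [? ?] [-> ->]].
    by rewrite /unzip1 -map_comp.
  have sub : pr (fun x => Sk c x /\ forall d, d \in c' -> coin_is x d) <=
      pr (fun x => Sk c x /\ obey x).
    apply: pr_le.
    - apply: ev_and; first exact: ev_mev (eSk c).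
      apply: ev_forall => d; apply: ev_imp; first exact: ev_cst.
      exact: ev_cn.
    - by apply: ev_and; [exact: ev_mev (eSk c)|exact: mev_obey].
    move=> x [Sx dx]; split=> // b u n sx; have [[_ _ kc] _] := Sx.
    by apply: (dx (u, n, y, b)); apply/mapP; exists (u, n, b) => //; exact: kc.
  have lel : half ^+ l <= half ^+ size c.
    case/andP: okc => _ sl; rewrite -(subnK sl) exprD ler_piMl// exprn_ge0// invr_ge0.
  have := pr_split mu (ev_mev (eSk c)) mev_obey.
  rewrite (@pr_ext _ _ mu (fun x => Sk c x /\ ~ obey x) (fun x => ~ obey x /\ Sk c x));
    last by move=> x; tauto.
  have := ler_wpM2r (pr_ge0 mu (Sk c)) lel.
  by move: sub; rewrite e1 mulrBl mul1r; lra.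
have := pr_cond_le (fun c => ev_mev (eSk c)) Sk_dis (ev_not mev_obey) le.
rewrite (pr_ext _ SkE) => h.
have := pr_split mu (ev_mev eH) mev_obey.
have : pr (fun x => H x /\ ~ obey x) = pr (fun x => ~ obey x /\ exists c, Sk c x).
  by apply: pr_ext => x; split=> [[/SkE]|[?] /SkE].
move=> e2 e3; rewrite e2 in e3.
have e4 : half ^+ l * pr H <= pr (fun x => H x /\ obey x) by lra.
by move: e4; rewrite exprVn mulrC ler_pdivrMr ?exprn_gt0// mulrC.
Qed.

End force.
End forcing.

(** * Shortening a block by one, and decreasing the lead *)

Section steps.
Variable R : realType.
Variable mu : probability (noise idx R) R.
Implicit Types (x : noise idx R) (u : int) (n y k : nat).
Local Notation mev := (@ev idx R (fun=> True)).
Local Notation pr := (prob mu).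
Hypothesis L : noise_law mu.

Lemma Arr_first x y i u n : Arr x y i u n -> exists n',
  [/\ Arr x y i u n', (n' <= n)%N & forall m, Arr x y i u m -> (n' <= m)%N].
Proof.
move=> A; have ex : exists m, `[< Arr x y i u m >] by exists n; apply/asboolP.
case: (ex_minnP ex) => n' /asboolP A' min; exists n'; split=> //.
  by apply: min; apply/asboolP.
by move=> m Am; apply: min; apply/asboolP.
Qed.

Lemma Arr_root x y i u v n m : Arr x y i u n -> Arr x y i v m -> u = v.
Proof. by move=> /Arr_anc <- /Arr_anc. Qed.

(** The number of right steps fixes the position of a particle at a level. Hence prescriptions for
    different vertices of a level never concern the same coin. *)
Lemma Arr_inj x y i j u n : Arr x y i u n -> Arr x y j u n -> i = j.
Proof. by move=> /Arr_pos -> /Arr_pos. Qed.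

(* The vertices 1, ..., k of level [y], and no others, descend from the root of 1. *)
Definition blk y k x : Prop := [/\ anc x y 0 <> anc x y 1,
  anc x y 1 = anc x y k%:Z & anc x y k%:Z <> anc x y k.+1%:Z].

(** The quantity that decreases along blocks of length 1. The reference particle at 2 may be any
    one, not just the first, which lets the property pass to the next level. *)
Definition lead y (j : nat) x : Prop := exists u n, Arr x y 2 u n /\
  exists s : seq nat, (size s <= j)%N /\
    forall v m, Arr x y 1 v m -> tm x v m.+1 <= tm x u n.+1 -> m \in s.

(** The children of 1 are the vertices 1 and 2 of the next level; both go to their other parent. *)
Definition die y x : Prop := [/\ anc x y 0 <> anc x y 1, anc x y 1 <> anc x y 2,
  win x y 1 & ~ win x y 2].

Lemma ev_blk y k : ev (low y) (blk y k).
Proof.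
suff : ev (low y) (fun x => anc x y 0 <> anc x y 1 /\
    (anc x y 1 = anc x y k%:Z /\ anc x y k%:Z <> anc x y k.+1%:Z)).
  by apply: ev_ext => x; split=> [[? []]|[]].
by do ?apply: ev_and; do ?apply: ev_not; exact: ev_anc_eq.
Qed.

Lemma ev_lead y j : ev (low y) (lead y j).
Proof.
apply: ev_exists => u; apply: ev_exists => n.
apply: ev_and; first exact: ev_Arr.
apply: ev_exists => s; apply: ev_and; first exact: ev_cst.
apply: ev_forall => v; apply: ev_forall => m; apply: ev_imp; first exact: ev_Arr.
by apply: ev_imp; [apply: ev_le; exact: evf_tm_low|exact: ev_cst].
Qed.

Lemma mev_die y : mev (die y).
Proof.
apply: (@ev_mev _ _ (low y.+1)).
have eA i j : ev (low y.+1) (fun x => anc x y i = anc x y j).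
  exact: ev_sub (low_sub (leqnSn y)) (ev_anc_eq _ y i j).
suff : ev (low y.+1) (fun x => anc x y 0 <> anc x y 1 /\ (anc x y 1 <> anc x y 2 /\
    (win x y 1 = true /\ win x y 2 = false))).
  apply: ev_ext => x; split=> [[? [? [? w]]]|[? ? ? /negP/negbTE]//].
  by split=> //; rewrite w.
do ?apply: ev_and; try exact: ev_win; apply: ev_not; exact: eA.
Qed.

Definition all_good (B : R) k y (s : seq int) x := forall i, i \in s -> good B k y i x.

Lemma ev_all_good (B : R) k y s : ev (low y) (all_good B k y s).
Proof.
apply: ev_forall => i; apply: ev_imp; first exact: ev_cst.
exact: ev_good.
Qed.

Lemma all_good_arrivals B k y s x : all_good B k y s x ->
  exists l : seq (int * nat), (size l <= size s * k)%N /\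
    forall i u n, i \in s -> Arr x y i u n -> tm x u n.+1 <= B * 2 ^+ y -> (u, n) \in l.
Proof.
elim: s => [|a s IH] gs; first by exists [::].
have [|l [sl inl]] := IH; first by move=> i si; apply: gs; rewrite inE si orbT.
have [_ [m [sm inm]]] : good B k y a x by apply: gs; rewrite mem_head.
exists ([seq (anc x y a, n) | n <- m] ++ l); split.
  by rewrite size_cat size_map mulSn leq_add.
move=> i u n; rewrite mem_cat inE => /predU1P[->|si] A le_t; apply/orP; [left|right].
  by apply/mapP; exists n; [exact: inm A le_t|rewrite (Arr_anc A)].
exact: inl A le_t.
Qed.

Lemma pr_all_good e B k y s : (forall i, pr (fun x => ~ good B k y i x) <= e) ->
  pr (fun x => ~ all_good B k y s x) <= (size s)%:R * e.
Proof.
move=> he; apply: le_trans (_ : \sum_(i <- s) e <= _); last first.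
  by rewrite big_const_seq count_predT iter_addr_0 mulr_natl.
apply: (pr_exists_seq (Q := fun i x => ~ good B k y i x)) => //.
- by move=> i; exact/ev_not/mev_good.
- apply/ev_not; exact: ev_mev (ev_all_good _ _ _ _).
move=> x ng; apply: contrapT => h; apply: ng => i si; apply: contrapT => ngi.
by apply: h; exists i.
Qed.

(* All particles arriving before time [B 2^y] at the vertices 0 and 1 go right,
   and those arriving at [k + 1] (and at [k], if [k > 1]) go left: this
   shortens the block [1..k] by one. *)
Lemma blk_shrink B l y k : (0 < k)%N ->
  pr (fun x => (blk y k x /\ ((1 < k)%N \/ lead y 0 x)) /\
      all_good B l y [:: 0; 1; k%:Z; k.+1%:Z] x) <=
  2 ^+ (4 * l) * pr (fun x => blk y k x /\ (win x y 1 /\ ~ win x y k.+1%:Z)).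
Proof.
move=> k0; set H := (X in pr X <= _); pose t : R := B * 2 ^+ y.
have eH : ev (low y) H.
  apply: ev_and; last exact: ev_all_good.
  apply: ev_and; first exact: ev_blk.
  by apply: ev_or; [exact: ev_cst|exact: ev_lead].
pose spec (b : bool) u n x := tm x u n.+1 <= t /\
  (if b then Arr x y 0 u n \/ Arr x y 1 u n
   else Arr x y k.+1%:Z u n \/ ((1 < k)%N /\ Arr x y k%:Z u n)).
have eS b u n : ev (low y) (spec b u n).
  apply: ev_and; first exact: ev_tm_le.
  case: b; apply: ev_or; try exact: ev_Arr.
  by apply: ev_and; [exact: ev_cst|exact: ev_Arr].
have specF u n x : spec true u n x -> spec false u n x -> False.
  move=> [_ [] A] [_ [|[k1]] A']; have := Arr_inj A A'; lia.
have fin x : H x -> exists s : seq (int * nat), (size s <= 4 * l)%N /\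
    forall b u n, spec b u n x -> (u, n) \in s.
  move=> [_ /all_good_arrivals[s [ss ins]]]; exists s; split=> //.
  move=> [] u n [le_t] [A|A].
  - by apply: ins A le_t; rewrite mem_head.
  - by apply: ins A le_t; rewrite !inE eqxx orbT.
  - by apply: ins A le_t; rewrite !inE eqxx !orbT.
  - by case: A => _ A; apply: ins A le_t; rewrite !inE eqxx !orbT.
have := pr_force L eH eS specF fin.
move=> h; apply: le_trans h _; rewrite ler_wpM2l ?exprn_ge0//; apply: pr_le.
- by apply: ev_and; [exact: ev_mev eH|exact: mev_obey].
- apply: ev_and; first exact: ev_mev (ev_blk _ _).
  apply: ev_and; first exact: ev_mev (ev_win _ y 1 true).
  by apply: ev_not; exact: ev_mev (ev_win _ y _ true).
move=> x [[[bx kx] gx] ox]; split=> //.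
have [[u [n1 [n2 [n12 A1 A2 n2t]]]] _] : good B l y 0 x by apply: gx; rewrite mem_head.
have [[v [m1 [m2 [m12 C1 C2 m2t]]]] _] : good B l y k.+1%:Z x.
  by apply: gx; rewrite !inE eqxx !orbT.
split.
  have n1t : tm x u n1.+1 <= t by apply: le_trans n2t; rewrite ler_tm; exact: leqW.
  apply: (@win_left _ x y 1 u n1); first by rewrite subrr.
    by apply: ox; split=> //; left.
  (* A rival that came first would have arrived by time [t] as well, so its coin is prescribed and
     points away from this child. *)
  move=> w m A cf; rewrite leNgt; apply/negP => lt.
  have := ox true w m; rewrite cf => h'; suff : false = true by [].
  by apply: h'; split; [exact: le_trans (ltW lt) n1t|right].
apply/negP; have kE : k.+1%:Z - 1 = k%:Z by lia.
have [m0 [C0 m01 min]] := Arr_first C1.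
have m0t : tm x v m0.+1 <= t by apply: le_trans m2t; rewrite ler_tm; lia.
apply: (win_right C0).
  by apply: ox; split=> //; left.
move=> w m; rewrite kE => A ct; rewrite ltNge; apply/negP => le.
have [k1|k1] := ltnP 1 k.
  have := ox false w m; rewrite ct => h'; suff : true = false by [].
  by apply: h'; split; [exact: le_trans le m0t|right].
(* The particles at 1 are all sent to the right, against those of 2; [lead y 0] ensures that none is
   as early as the first arrival at 2. *)
have ke : k = 1%N by lia.
case: kx => [|[v' [n [Cn [s [s0 ls]]]]]]; first by rewrite ke.
rewrite ke in A C0 C1 C2 min.
have vv' : v' = v := Arr_root Cn C1; rewrite vv' in Cn ls.
have : m \in s by apply: (ls w m A); apply: le_trans le _; rewrite ler_tm ltnS min.
by move: s0; rewrite leqn0 size_eq0 => /eqP ->.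
Qed.

(** The vertices 2, ..., k of the next level have both parents in the block, while 1 and k + 1 are
    taken from outside; the translation by 1 restores the normal form. *)
Lemma blk_succ y k x : (1 < k)%N -> blk y k x -> win x y 1 -> ~ win x y k.+1%:Z ->
  blk y.+1 k.-1 (shift 1 x).
Proof.
move=> k1 [b1 b2 b3] w1 /negP w2; rewrite /blk !anc_shift /=.
have e1 : 1 + 1 - 1 = 1 :> int by lia.
have e2 : (k.-1%:Z + 1) = k%:Z by lia.
have e3 : (k.-1.+1%:Z + 1) = k.+1%:Z by lia.
rewrite !e2 !e3 !add0r w1 (negbTE w2) subrr.
have inside i : 1 <= i <= k%:Z -> anc x y i = anc x y 1.
  move=> /andP[i1 ik]; apply/eqP; rewrite eq_le.
  by rewrite {1}b2 !anc_mono.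
have -> : (if win x y (1 + 1) then anc x y (1 + 1 - 1) else anc x y (1 + 1)) = anc x y 1.
  by case: ifP => _; apply: inside; lia.
have -> : (if win x y k%:Z then anc x y (k%:Z - 1) else anc x y k%:Z) = anc x y 1.
  by case: ifP => _; apply: inside; lia.
by split=> // /addIr; [exact: b1|rewrite b2; exact: b3].
Qed.

(** The particle [n0] stops where it creates the child; exactly the later ones with the same
    direction travel on to it. *)
Lemma win_Arr x y i u n0 n : Arr x y i u n0 -> cn x u n0 y = false -> ~~ win x y i ->
  (forall m, Arr x y i u m -> cn x u m y = false -> (n0 <= m)%N) ->
  Arr x y.+1 i u n <-> [/\ (n0 < n)%N, Arr x y i u n & cn x u n y = false].
Proof.
move=> A0 c0 /negbTE w min.
have [s es _] := Arr_cand A0 c0.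
have [m sm [Am cm mmin]] := cand_Arr es.
have ua : anc x y i = u := Arr_anc A0; rewrite ua in sm Am cm mmin.
have mn0 : m = n0 by apply/eqP; rewrite eqn_leq mmin// min.
have [v [n1 [p [m' [ei se hm']]]]] := candP es.
have [vu m'm] : v = u /\ m' = m by move: sm; rewrite se => -[].
rewrite /Arr stS w es se vu m'm mn0; split.
  move=> [_ [_ [[<- <-] lt]]]; rewrite hits_rcons (st_size ei) => /andP[h /eqP].
  split=> //; exists n1, p; split=> //; first by rewrite ei vu.
  move: hm'; rewrite m'm mn0 => /hitP[n1n0 _ _]; lia.
move=> [lt [n2 [q [e2 n2n hq]]] cf]; exists n0.+1, (rcons p false); split=> //.
rewrite hits_rcons (st_size ei) cf eqxx andbT.
by move: e2; rewrite ei => -[_ _ ->].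
Qed.

(* Until the first arrival at 2 the particles arriving at 1 go left, and then
   right, where they vanish; those arriving at 2 go left.  The first particle of
   the first kind is absorbed by the left child of 1, hence the lead decreases. *)
Lemma lead_shrink B l y j :
  pr (fun x => (blk y 1 x /\ lead y j.+1 x) /\ all_good B l y [:: 1; 2] x) <=
  2 ^+ (2 * l) * pr (fun x => die y x \/ (blk y.+1 1 x /\ lead y.+1 j x)).
Proof.
set H := (X in pr X <= _); pose t : R := B * 2 ^+ y.
have eH : ev (low y) H.
  apply: ev_and; last exact: ev_all_good.
  by apply: ev_and; [exact: ev_blk|exact: ev_lead].
pose late_at u n x := exists v m, Arr x y 2 v m /\ tm x v m.+1 < tm x u n.+1.
pose spec (b : bool) u n x := tm x u n.+1 <= t /\
  (if b then Arr x y 1 u n /\ late_at u n x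
   else Arr x y 2 u n \/ (Arr x y 1 u n /\ ~ late_at u n x)).
have el u n : ev (low y) (late_at u n).
  apply: ev_exists => v; apply: ev_exists => m; apply: ev_and; first exact: ev_Arr.
  by apply: ev_lt; exact: evf_tm_low.
have eS b u n : ev (low y) (spec b u n).
  apply: ev_and; first exact: ev_tm_le.
  case: b; first by apply: ev_and; [exact: ev_Arr|exact: el].
  apply: ev_or; first exact: ev_Arr.
  by apply: ev_and; [exact: ev_Arr|exact: ev_not].
have specF u n x : spec true u n x -> spec false u n x -> False.
  by move=> [_ [A la]] [_ [A'|[_ nl]]]; [have := Arr_inj A A'|].
have fin x : H x -> exists s : seq (int * nat), (size s <= 2 * l)%N /\
    forall b u n, spec b u n x -> (u, n) \in s.
  move=> [_ /all_good_arrivals[s [ss ins]]]; exists s; split=> //.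
  move=> [] u n [le_t].
  - by move=> [A _]; apply: ins A le_t; rewrite mem_head.
  - move=> [A|[A _]]; first by apply: ins A le_t; rewrite !inE eqxx orbT.
    by apply: ins A le_t; rewrite mem_head.
have := pr_force L eH eS specF fin.
move=> h; apply: le_trans h _; rewrite ler_wpM2l ?exprn_ge0//; apply: pr_le.
- by apply: ev_and; [exact: ev_mev eH|exact: mev_obey].
- apply: ev_or; first exact: mev_die.
  by apply: ev_and; [exact: ev_mev (ev_blk _ _)|exact: ev_mev (ev_lead _ _)].
move=> x [[[[b1 _ b3] [u0 [nw [Cw [s [sj ls]]]]]] gx] ox].
have [[u [m1 [m2 [m12 C1 C2 m2t]]]] _] : good B l y 2 x.
  by apply: gx; rewrite !inE eqxx orbT.
have uu : u0 = u := Arr_root Cw C1; rewrite {}uu in Cw ls.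
have [n0 [C0 n01 min]] := Arr_first C1.
have n0t : tm x u n0.+1 <= t by apply: le_trans m2t; rewrite ler_tm; lia.
have c0 : cn x u n0 y = false by apply: ox; split=> //; left.
have notlate w m : Arr x y 1 w m -> cn x w m y = false -> tm x w m.+1 <= t ->
    tm x w m.+1 <= tm x u n0.+1.
  move=> A cf mt; rewrite leNgt; apply/negP => lt.
  have := ox true w m; rewrite cf => h'; suff : false = true by [].
  by apply: h'; split=> //; split=> //; exists u, n0.
have w2 : ~~ win x y 2.
  apply: (win_right C0 c0) => w m; rewrite (_ : 2 - 1 = 1 :> int)// => A ct.
  rewrite ltNge; apply/negP => le.
  have := ox false w m; rewrite ct => h'; suff : true = false by [].
  apply: h'; split; first exact: le_trans le n0t.
  right; split=> // -[v [m' [C']]]; have vu := Arr_root C' C1; rewrite vu in C' *.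
  rewrite ltNge => /negP; apply; apply: le_trans le _.
  by rewrite ler_tm ltnS min.
(* If 0 takes the left child of 1, the block dies; otherwise this child forms the block of length 1
   at the next level. *)
have [w1|w1] := boolP (win x y 1); first by left; split=> //; exact/negP.
right; split.
  split=> //=; rewrite ?(negbTE w1) ?(negbTE w2)//.
  move=> e; have h1 : anc x y 0 <= anc x y 1 by rewrite anc_mono.
  have h2 : anc x y (0 - 1) <= anc x y 0 by rewrite anc_mono.
  by apply: b1; apply/eqP; rewrite eq_le h1; case: ifP e => _ <-; rewrite ?h2 ?lexx.
(* The first arrival at 2 is absorbed by its left child; the second one reaches that child and
   becomes the new reference particle. *)
have A2 := win_Arr m2 C0 c0 w2 (fun m A _ => min m A).
exists u, m2; split.
  by apply/A2; split=> //; [lia|apply: ox; split=> //; left].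
have [[v [m [Am mt]]]|none] := pselect (exists v m, Arr x y.+1 1 v m /\
    tm x v m.+1 <= tm x u m2.+1); last first.
  by exists [::]; split=> // v m Am mt; case: none; exists v, m.
have [n1 [p [e n1m hm]]] := Am.
have := e; rewrite stS (negbTE w1) => ec.
have [n' sn' [An' cn' minn']] := cand_Arr ec.
have [va n1n'] : v = anc x y 1 /\ n1 = n'.+1 by move: sn' => -[].
rewrite -va in An' cn' minn'.
have A1 k := win_Arr k An' cn' w1 minn'.
have ms k : Arr x y 1 v k -> cn x v k y = false -> tm x v k.+1 <= tm x u m2.+1 -> k \in s.
  move=> Ak ck kt; apply: (ls v k Ak).
  apply: le_trans (notlate v k Ak ck (le_trans kt m2t)) _.
  by rewrite ler_tm ltnS min.
have n's : n' \in s.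
  by apply: ms => //; apply: le_trans mt; rewrite ler_tm; lia.
(* The particles that reach the child of 1 before the new reference particle went left at 1, so they
   were in [s]; the absorbed one, [n'], is no longer among them. *)
exists (rem n' s); split; first by rewrite size_rem//; move: sj; case: (size s).
move=> v' k Ak kt; have vv : v' = v := Arr_root Ak Am; rewrite {}vv in Ak kt.
have [n'k A1k ck] := (A1 k).1 Ak.
have := ms k A1k ck kt; rewrite (perm_mem (perm_to_rem n's)) inE => /predU1P[kn|//].
by move: n'k; rewrite kn ltnn.
Qed.

End steps.

(** * The density of blocks *)

Definition tends0 (R : realType) (a : nat -> R) : Prop :=
  forall e, 0 < e -> exists N, forall n, (N <= n)%N -> a n <= e.

(** The factor [C] may depend on [e]: it will be 2 to a number of prescribed coins that is bounded
    in terms of [e] only. *)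
Lemma tends0_le (R : realType) (a b : nat -> R) :
  (forall e, 0 < e -> exists2 C, 0 <= C & forall n, a n <= C * b n + e) ->
  tends0 b -> tends0 a.
Proof.
move=> ab b0 e e0; have [|C C0 le] := ab (e / 2); first by lra.
have [|N hN] := b0 (e / 2 / (C + 1)); first by rewrite !divr_gt0//; lra.
exists N => n /hN bn; apply: le_trans (le n) _.
have : C * b n <= (C + 1) * (e / 2 / (C + 1)).
  apply: le_trans (ler_wpM2l C0 bn) _; rewrite ler_wpM2r//; last by lra.
  by rewrite !divr_ge0//; lra.
have -> : (C + 1) * (e / 2 / (C + 1)) = e / 2; last by lra.
by rewrite mulrC divfK// gt_eqF//; lra.
Qed.

Lemma tends0S (R : realType) (a : nat -> R) : tends0 a -> tends0 (fun n => a n.+1).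
Proof. by move=> a0 e /a0[N h]; exists N => n Nn; apply: h; exact: leqW. Qed.

Lemma tends0D (R : realType) (a b : nat -> R) :
  tends0 a -> tends0 b -> tends0 (fun n => a n + b n).
Proof.
move=> a0 b0 e e0; have e2 : 0 < e / 2 by lra.
have [N hN] := a0 _ e2; have [M hM] := b0 _ e2; exists (maxn N M) => n.
by rewrite geq_max => /andP[/hN h1 /hM h2]; lra.
Qed.

Section limits.
Variable R : realType.
Variable mu : probability (noise idx R) R.
Implicit Types (x : noise idx R) (u : int) (n y k : nat).
Local Notation mev := (@ev idx R (fun=> True)).
Local Notation pr := (prob mu).
Hypothesis L : noise_law mu.

Lemma pr_shift z Q : mev Q -> pr (fun x => Q (shift z x)) = pr Q.
Proof.
apply: (@pr_reindex _ _ mu (shift_idx z) (shift_idx (- z))).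
- by move=> [[u n]|[[u n] k]] /=; rewrite addrK.
- by move=> [[u n]|[[u n] k]] /=; rewrite addrNK.
- exact: law_indep L.
- exact: law_shift L z.
Qed.

Lemma mev_shift z Q : mev Q -> mev (fun x => Q (shift z x)).
Proof.
move=> [mQ _]; split.
  have mf : measurable_fun setT (shift z : noise idx R -> noise idx R).
    by apply: measurable_noise => i; exact: measurable_coord.
  by have := mf measurableT _ mQ; rewrite setTI.
by move=> x x' e; rewrite (_ : x = x')//; apply/funext => i; exact: e.
Qed.

Lemma pr_le_good Q G : mev Q -> mev G ->
  pr Q <= pr (fun x => Q x /\ G x) + pr (fun x => ~ G x).
Proof.
move=> eQ eG; rewrite (pr_split mu eQ eG) lerD2l; apply: pr_le; last by move=> x [].
  by apply: ev_and => //; exact: ev_not.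
exact: ev_not.
Qed.

Let meq y i j : mev (fun x => anc x y i = anc x y j).
Proof. exact: ev_mev (ev_anc_eq _ y i j). Qed.

Let mne y i j : mev (fun x => anc x y i <> anc x y j).
Proof. exact: ev_not. Qed.

Let mwin y i : mev (fun x => win x y i).
Proof. exact: ev_mev (ev_win _ y i true). Qed.

Let mblk y k : mev (blk y k).
Proof. exact: ev_mev (ev_blk _ y k). Qed.

Let mlead y j : mev (lead y j).
Proof. exact: ev_mev (ev_lead _ y j). Qed.

Definition delta y : R := pr (fun x => anc x y 0 <> anc x y 1).

(* The boundary between 0 and 1 moves to the left or to the right, and two
   boundaries merge when a block of length 1 dies. *)
Lemma delta_die y : delta y.+1 = delta y - pr (die y).
Proof.
pose A x := anc x y 0 <> anc x y 1 /\ win x y 1.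
pose B x := anc x y 1 <> anc x y 2 /\ ~ win x y 2.
have eA : mev A by exact: ev_and.
have eB : mev B by apply: ev_and => //; exact: ev_not.
have h1 : delta y.+1 = pr (fun x => A x \/ B x).
  rewrite /delta -(pr_shift 1) ?mne//; apply: pr_ext => x.
  rewrite !anc_shift /= !add0r /A /B (_ : 1 - 1 = 0 :> int)//.
  rewrite (_ : 1 + 1 = 2 :> int)// (_ : 2 - 1 = 1 :> int)//.
  have m01 : anc x y 0 <= anc x y 1 by exact: anc_mono.
  have m12 : anc x y 1 <= anc x y 2 by exact: anc_mono.
  move: (anc x y 0) (anc x y 1) (anc x y 2) m01 m12 => a b c.
  case: (win x y 1); case: (win x y 2) => /= ab bc; split=> h;
    first [by left; split=> //; lia | by right; split=> //; lia
          |by case: h => -[h1 h2] //; lia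
          |by have [e|/eqP e] := eqVneq a b; [right|left]; split=> //; lia].
have h2 := pr_split mu (ev_or eA eB) eA.
have h3 := pr_split mu eB eA.
have h4 : pr B = pr (fun x => anc x y 0 <> anc x y 1 /\ ~ win x y 1).
  rewrite -(pr_shift (-1)) //; apply: pr_ext => x; rewrite /B !anc_shift win_shift.
  rewrite (_ : 1 + -1 = 0 :> int)// (_ : 2 + -1 = 1 :> int)//.
  by split=> -[ne w]; split=> // e; apply: ne; [rewrite e|exact: addIr e].
have h5 := pr_split mu (mne y 0 1) (mwin y 1).
have h6 : pr (die y) = pr (fun x => B x /\ A x).
  by apply: pr_ext => x; split=> [[]|[[? ?] [? ?]]]; split.
rewrite /delta -/(pr A) in h5.
have h7 : pr (fun x => (A x \/ B x) /\ A x) = pr A by apply: pr_ext => x; tauto.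
have h8 : pr (fun x => (A x \/ B x) /\ ~ A x) = pr (fun x => B x /\ ~ A x).
  by apply: pr_ext => x; tauto.
rewrite h1 h2 h7 h8 h6 /delta h5 -/(pr A); move: h3; rewrite h4; lra.
Qed.

Lemma die_to0 : tends0 (fun y => pr (die y)).
Proof.
move=> e e0; pose A := [set delta y | y in setT].
have iA : has_inf A.
  split; first by exists (delta 0), 0%N.
  by exists 0 => _ [y _ <-]; exact: pr_ge0.
have [_ [N _ <-] lt] := inf_adherent e0 iA.
have mono m : delta (N + m) <= delta N.
  elim: m => [|m IH]; first by rewrite addn0.
  by apply: le_trans IH; rewrite addnS delta_die gerBl pr_ge0.
exists N => n Nn; have := mono (n - N)%N; rewrite subnKC// => h1.
have : inf A <= delta n.+1 by apply: ge_inf; [exact: iA.2|exists n.+1].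
by rewrite delta_die; lra.
Qed.

Lemma pr_drop_good Q s : (forall y, mev (Q y)) ->
  forall e : R, 0 < e -> exists B l, forall y,
  pr (Q y) <= pr (fun x => Q y x /\ all_good B l y s x) + e.
Proof.
move=> eQ e e0; pose e' := e / (size s).+1%:R.
have [|B [l [_ he]]] := @good_likely R mu L e'; first by rewrite divr_gt0.
exists B, l => y; have mg := ev_mev (ev_all_good B l y s).
apply: le_trans (pr_le_good (eQ y) mg) _; rewrite lerD2l.
apply: le_trans (pr_all_good s (he y)) _.
by rewrite /e' mulrCA ger_pMr// ler_pdivrMr// mul1r ler_nat.
Qed.

Lemma lead_to0 j : tends0 (fun y => pr (fun x => blk y 1 x /\ lead y j x)).
Proof.
elim: j => [|j IH].
  apply: tends0_le die_to0 => e e0.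
  have eQ y : mev (fun x => blk y 1 x /\ lead y 0 x) by exact: ev_and.
  have [B [l h]] := pr_drop_good [:: 0; 1; 1%:Z; 2%:Z] eQ e0.
  exists (2 ^+ (4 * l)); first by rewrite exprn_ge0.
  move=> y; apply: le_trans (h y) _; rewrite lerD2r.
  have := @blk_shrink R mu L B l y 1 isT => h'; apply: le_trans (le_trans h' _).
    apply: pr_le.
    - by apply: ev_and => //; exact: ev_mev (ev_all_good _ _ _ _).
    - apply: ev_and; last exact: ev_mev (ev_all_good _ _ _ _).
      by apply: ev_and => //; apply: ev_or => //; exact: ev_cst.
    by move=> x [[b ld] g]; do 2!split=> //; right.
  rewrite ler_wpM2l ?exprn_ge0//; apply: pr_le; [|exact: mev_die|].
    by apply: ev_and => //; apply: ev_and => //; exact: ev_not.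
  by move=> x [[b1 b2 b3] [w1 w2]]; split.
apply: tends0_le (tends0D die_to0 (tends0S IH)) => e e0.
have eQ y : mev (fun x => blk y 1 x /\ lead y j.+1 x) by exact: ev_and.
have [B [l h]] := pr_drop_good [:: 1; 2] eQ e0.
exists (2 ^+ (2 * l)); first by rewrite exprn_ge0.
move=> y; apply: le_trans (h y) _; rewrite lerD2r.
apply: le_trans (lead_shrink L B l y j) _; rewrite ler_wpM2l ?exprn_ge0//.
by apply: pr_or; [exact: mev_die|exact: ev_and].
Qed.

Lemma blk_to0 k : tends0 (fun y => pr (blk y k.+1)).
Proof.
elim: k => [|k IH].
  move=> e e0; have e2 : 0 < e / 2 by lra.
  have [B [l h]] := pr_drop_good [:: 1; 2] (fun y => mblk y 1) e2.
  have [N hN] := lead_to0 l e2; exists N => y /hN h2; apply: le_trans (h y) _.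
  (* On the good event some particle reaches 2 by time [B * 2 ^+ y] and at most [l] particles reach
     1 by then, which gives [lead y l]. *)
  have : pr (fun x => blk y 1 x /\ all_good B l y [:: 1; 2] x) <=
      pr (fun x => blk y 1 x /\ lead y l x).
    apply: pr_le.
    - by apply: ev_and => //; exact: ev_mev (ev_all_good _ _ _ _).
    - exact: ev_and.
    move=> x [b g]; split=> //.
    have [_ [s [sl ls]]] : good B l y 1 x by apply: g; rewrite mem_head.
    have [[u [_ [n [_ _ An nt]]]] _] : good B l y 2 x.
      by apply: g; rewrite !inE eqxx orbT.
    exists u, n; split=> //; exists s; split=> // v m Am mt.
    by apply: ls Am _; exact: le_trans mt nt.
  by lra.
apply: tends0_le (tends0S IH) => e e0.
have [B [l h]] := pr_drop_good [:: 0; 1; k.+2%:Z; k.+3%:Z] (fun y => mblk y k.+2) e0.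
exists (2 ^+ (4 * l)); first by rewrite exprn_ge0.
move=> y; apply: le_trans (h y) _; rewrite lerD2r.
have := @blk_shrink R mu L B l y k.+2 isT => h'; apply: le_trans (le_trans h' _).
  apply: pr_le.
  - by apply: ev_and => //; exact: ev_mev (ev_all_good _ _ _ _).
  - apply: ev_and; last exact: ev_mev (ev_all_good _ _ _ _).
    by apply: ev_and => //; apply: ev_or => //; exact: ev_cst.
  by move=> x [b g]; do 2!split=> //; left.
rewrite ler_wpM2l ?exprn_ge0// -(pr_shift 1 (mblk y.+1 k.+1)); apply: pr_le.
- by apply: ev_and => //; apply: ev_and => //; exact: ev_not.
- exact: mev_shift.
by move=> x [b [w1 w2]]; exact: (@blk_succ R y k.+2 x isT b w1 w2).
Qed.

(** A block longer than [K] leaves no room for another boundary in the [K] positions after its left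
    end, so [K.+1] consecutive translates of [long] are disjoint, and they have equal
    probabilities. *)
Lemma delta_le y K : delta y <= \sum_(1 <= k < K.+1) pr (blk y k) + K.+1%:R^-1.
Proof.
pose long x := anc x y 0 <> anc x y 1 /\ anc x y 1 = anc x y K.+1%:Z.
have elong : mev long by exact: ev_and.
have h1 : delta y <= \sum_(1 <= k < K.+1) pr (blk y k) + pr long.
  rewrite /delta (pr_split mu (mne y 0 1) elong) addrC; apply: lerD; last first.
    by apply: pr_le => //; [exact: ev_and|move=> x []].
  apply: (pr_exists_seq (Q := fun k => blk y k)) => //.
    by apply: ev_and => //; exact: ev_not.
  move=> x [ne nl]; apply: contrapT => nb.
  suff h k : (k <= K)%N -> anc x y 1 = anc x y k.+1%:Z by apply: nl; split=> //; exact: h.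
  elim: k => [//|k IH] kK; have := IH (ltnW kK) => e.
  apply: contrapT => ne'; apply: nb; exists k.+1.
    by rewrite mem_index_iota; lia.
  by split=> //; rewrite -e.
apply: le_trans h1 _; rewrite lerD2l -[leRHS]div1r ler_pdivlMr ?ltr0n// mulrC.
pose E (l : nat) x := long (shift l%:Z x).
have eE l : mev (E l).
  exact: mev_shift.
have h2 : \sum_(l <- iota 0 K.+1) pr (E l) <= pr (fun=> True).
  apply: (@pr_disjoint _ _ mu nat (iota 0 K.+1) E (fun=> True)) => //;
    [exact: iota_uniq|exact: ev_cst|].
  move=> a b x; wlog ab : a b / (a <= b)%N.
    move=> H; have [/H//|/ltnW ba] := leqP a b.
    by move=> aK bK Ea Eb; apply/esym/(H b a ba).
  rewrite !mem_iota /= => aK bK [_ ea] [nb _]; apply/eqP; rewrite eqn_leq ab /=.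
  rewrite leqNgt; apply/negP => lt; apply: nb; move: ea; rewrite !anc_shift => ea.
  have m1 : anc x y (1 + a%:Z) <= anc x y (0 + b%:Z) by apply: anc_mono; lia.
  have m2 : anc x y (0 + b%:Z) <= anc x y (1 + b%:Z) by apply: anc_mono; lia.
  have m3 : anc x y (1 + b%:Z) <= anc x y (K.+1%:Z + a%:Z) by apply: anc_mono; lia.
  move: m1 m2 m3 ea; move: (anc x y _) (anc x y _) (anc x y _) (anc x y _); lia.
rewrite prT in h2; apply: le_trans h2; rewrite (eq_bigr (fun=> pr long)).
  by rewrite big_const_seq count_predT size_iota iter_addr_0 mulr_natl.
by move=> l _; exact: pr_shift.
Qed.

Lemma delta_to0 : tends0 delta.
Proof.
move=> e e0; have e2 : 0 < e / 2 by lra.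
pose K := Num.trunc (e / 2)^-1.
have K1 : K.+1%:R^-1 <= e / 2.
  by rewrite -[leRHS]invrK lef_pV2 ?posrE ?invr_gt0 ?ltr0n// ltW// truncnS_gt.
have : tends0 (fun y => \sum_(1 <= k < K.+1) pr (blk y k)).
  elim: K {K1} => [|K IH]; first by move=> d d0; exists 0%N => n _; rewrite big_geq ?ltW.
  have := tends0D IH (blk_to0 K) => h d /h[N hN]; exists N => n /hN le_d.
  by rewrite big_nat_recr.
move=> /(_ _ e2)[N hN]; exists N => y /hN h.
by apply: le_trans (delta_le y K) (le_trans (lerD h K1) _); lra.
Qed.

(** Mass transport: if [v] survives, the leftmost vertex with root [v] lies at [v + m] for some [m]
    between 0 and [y]. Translating it to 1 turns these cases into events with distinct values of
    [anc x y 1], all contained in the event of [delta]. *)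
Lemma pr_alive y v : pr (fun x => exists i, anc x y i = v) <= delta y.
Proof.
pose F w x := anc x y 0 <> anc x y 1 /\ anc x y 1 = w.
have eF w : mev (F w) by apply: ev_and => //; exact: ev_mev (ev_anc _ _ _ _).
pose s := [seq v - 1 + l%:Z | l <- iota 0 y.+1].
pose E l x := F (v - l) (shift l x).
have ealive : mev (fun x => exists i, anc x y i = v).
  by apply: ev_exists => i; exact: ev_mev (ev_anc _ _ _ _).
have eE l : mev (E l).
  exact: mev_shift.
have h1 : pr (fun x => exists i, anc x y i = v) <= \sum_(l <- s) pr (E l).
  apply: (pr_exists_seq (Q := E)) => //.
  move=> x [i ei].
  have ex : exists m : nat, anc x y (v + m%:Z) == v.
    have := anc_bound x y i; rewrite ei => vi.
    by exists (absz (i - v)); rewrite (_ : v + _ = i) ?ei//; lia.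
  case: (ex_minnP ex) => m /eqP em min.
  have my : (m <= y)%N by have := anc_bound x y (v + m%:Z); rewrite em; lia.
  exists (v - 1 + m%:Z); first by apply/mapP; exists m => //; rewrite mem_iota.
  rewrite /E /F !anc_shift add0r addrA (_ : 1 + (v - 1) = v); last by lia.
  rewrite em; split; last by lia.
  move=> /addIr e'; case: m em min my e' => [|m] em min my e'.
    have := anc_bound x y (v - 1 + 0%:Z); rewrite e'; lia.
  have := min m; rewrite (_ : v + m%:Z = v - 1 + m.+1%:Z); last by lia.
  by rewrite e' eqxx => /(_ isT); rewrite ltnn.
apply: le_trans h1 _; rewrite (eq_bigr (fun l => pr (F (v - l)))); last first.
  by move=> l _; exact: pr_shift.
apply: (@pr_disjoint _ _ mu int s (fun l => F (v - l))) => //.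
- by rewrite map_inj_uniq ?iota_uniq// => a b; lia.
- move=> a b x _ _ [_ ea] [_]; rewrite ea => /addrI; exact: oppr_inj.
- by move=> a x _ [].
Qed.

End limits.

(** * Infinite trees and simultaneous rings are null events *)

Section almost_surely.
Variable R : realType.
Variable mu : probability (noise idx R) R.
Implicit Types (x : noise idx R) (u v : int) (n m y : nat).
Local Notation mev := (@ev idx R (fun=> True)).
Local Notation pr := (prob mu).
Hypothesis L : noise_law mu.

Lemma pr_exists0 (T : countType) (Q : T -> noise idx R -> Prop) :
  (forall a, mev (Q a)) -> (forall a, pr (Q a) = 0) ->
  pr (fun x => exists a, Q a x) = 0.
Proof.
move=> eQ Q0; have eU := ev_exists eQ.
pose F n : set (noise idx R) := if unpickle n is Some a then [set x | Q a x] else set0.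
have : mu.-negligible (\bigcup_n F n).
  apply: negligible_bigcup => n; rewrite /F; case: unpickle => [a|];
    last exact: negligible_set0.
  by apply/negligibleP; [case: (eQ a)|apply: etrans (prE mu (eQ a)) _; rewrite Q0].
rewrite (_ : \bigcup_n F n = [set x | exists a, Q a x]); last first.
  apply/seteqP; split=> x /=.
    by move=> [n _]; rewrite /F; case: unpickle => // a Qa; exists a.
  by move=> [a Qa]; exists (pickle a) => //; rewrite /F pickleK.
by move=> /negligibleP; rewrite /prob => -> //; case: eU.
Qed.

Lemma le_invn0 (a : R) : 0 <= a -> (forall n, a <= n.+1%:R^-1) -> a = 0.
Proof.
move=> a0 h; apply/eqP; rewrite eq_le a0 andbT leNgt; apply/negP => a_gt0.
have := h (Num.trunc a^-1); rewrite leNgt => /negP; apply.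
by rewrite -[ltRHS]invrK ltf_pV2 ?posrE ?invr_gt0 ?ltr0n// truncnS_gt.
Qed.

(** On a grid of mesh [h], the gap falls into the cell of the independent variable [Z] with
    conditional probability at most [h], by the density bound. *)
Lemma pr_gap_eq u n (J : idx -> Prop) (Z : noise idx R -> R) : evf J Z ->
  ~ J (inl (u, n)) -> pr (fun x => gp x u n = Z x) = 0.
Proof.
move=> eZ nJ; apply: le_invn0; first exact: pr_ge0.
move=> N; pose h : R := N.+1%:R^-1.
have h0 : 0 < h by rewrite invr_gt0 ltr0n.
pose S (k : nat) x := k%:R * h < Z x /\ Z x <= k.+1%:R * h.
have eS k : ev J (S k).
  by apply: ev_and; [apply: ev_lt|apply: ev_le] => //; exact: evf_cst.
have dis a b x : S a x -> S b x -> a = b.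
  move=> [a1 a2] [b1 b2]; have := lt_le_trans a1 b2; have := lt_le_trans b1 a2.
  by rewrite !ltr_pM2r// !ltr_nat; lia.
have eE : mev (fun x => gp x u n = Z x).
  have e1 : mev (fun x => gp x u n - Z x = 0).
    by apply: ev_eq; apply: evf_add; [exact: evf_gp|apply: evf_opp; split;
      [exact: eZ.1|move=> x x' e; apply: eZ.2 => i _; exact: e]].
  by apply: ev_ext e1 => x; split=> [/eqP|->]; rewrite ?subrr// subr_eq0 => /eqP.
have le k : pr (fun x => gp x u n = Z x /\ S k x) <= h * pr (S k).
  pose G x := k%:R * h < gp x u n /\ gp x u n <= k.+1%:R * h.
  have eG : ev (fun c => c = inl (u, n)) G.
    by apply: ev_and; [apply: ev_lt|apply: ev_le]; try exact: evf_cst; exact: evf_gp.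
  apply: (@le_trans _ _ (pr (fun x => S k x /\ G x))).
    apply: pr_le; first by apply: ev_and => //; exact: ev_mev (eS k).
      by apply: ev_and; [exact: ev_mev (eS k)|exact: ev_mev eG].
    by move=> x [e s]; split=> //; rewrite /G e.
  rewrite (indep_ev (law_indep L) _ (eS k) eG); last by move=> c Jc ce; apply: nJ;
    rewrite -ce.
  rewrite mulrC ler_wpM2r ?pr_ge0//.
  have kh : k%:R * h <= k.+1%:R * h by rewrite ler_wpM2r ?ler_nat// ltW.
  have := law_gap L u n _ kh; rewrite mulr_ge0 ?ler0n ?(ltW h0)// => /(_ isT).
  by rewrite (_ : k.+1%:R * h - k%:R * h = h)//; rewrite -natr1; ring.
have := pr_cond_le (fun k => ev_mev (eS k)) dis eE le.
rewrite (@pr_ext _ _ mu _ (fun x => gp x u n = Z x)).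
  move=> h1; apply: le_trans h1 _; rewrite ler_piMr ?(ltW h0)// pr_le1//.
  by apply: ev_exists => k; exact: ev_mev (eS k).
move=> x; split=> [[]//|e]; split=> //.
have Z0 : 0 < Z x by rewrite -e gp_gt0.
have ex : exists k : nat, Z x <= k%:R * h.
  exists (Num.trunc (Z x / h)).+1; rewrite -ler_pdivrMr// ltW// truncnS_gt//.
case: (ex_minnP ex) => -[|k] hk min; first by move: hk; rewrite mul0r leNgt Z0.
exists k; split=> //; rewrite ltNge; apply/negP => /min; lia.
Qed.

Lemma mev_tie u v n m : mev (fun x => tm x u n = tm x v m).
Proof.
have e1 : mev (fun x => tm x u n - tm x v m = 0).
  by apply: ev_eq; apply: evf_add; [|apply: evf_opp]; exact: evf_tm.
by apply: ev_ext e1 => x; split=> [/eqP|->]; rewrite ?subrr// subr_eq0 => /eqP.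
Qed.

Lemma pr_tie u v n m : u <> v -> pr (fun x => tm x u n.+1 = tm x v m) = 0.
Proof.
(* The first gap of [u] is isolated; the tie then says that it equals a function of the other
   coordinates. *)
move=> uv; pose J (c : idx) := c <> inl (u, 0%N).
pose Z x := tm x v m + - \sum_(i <- iota 1 n) gp x u i.
have eZ : evf J Z.
  apply: evf_add; first by apply: evf_tm => k _ [vu _]; apply: uv.
  apply: evf_opp; rewrite (_ : (fun x => _) = fun x => \sum_(i <- iota 0 n) gp x u i.+1).
    by apply: evf_sum => i; exact: evf_gp.
  apply/funext => x; rewrite -[1%N]addn0 iotaDl big_map.
  by apply: eq_bigr => i _; rewrite add1n.
rewrite (@pr_ext _ _ mu _ (fun x => gp x u 0 = Z x)); first exact: pr_gap_eq eZ _.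
move=> x; rewrite /Z /tm -(big_mkord xpredT (gp x u)) /index_iota subn0 /= big_cons.
by split=> [<-|->]; rewrite ?addrK// subrK.
Qed.

(** Outside this event, and that of a nonpositive waiting time, the finiteness of the trees is a
    pathwise statement. *)
Definition bad x : Prop :=
  (exists v, forall y, exists i, anc x y i = v) \/
  (exists u v n m, u <> v /\ tm x u n.+1 = tm x v m.+1).

Lemma mev_bad : mev bad.
Proof.
apply: ev_or.
  apply: ev_exists => v; apply: ev_forall => y; apply: ev_exists => i.
  exact: ev_mev (ev_anc _ y i v).
do 4!apply: ev_exists => ?; apply: ev_and; first exact: ev_cst.
exact: mev_tie.
Qed.

Lemma pr_bad : pr bad = 0.
Proof.
have e1 v : mev (fun x => forall y, exists i, anc x y i = v).
  apply: ev_forall => y; apply: ev_exists => i; exact: ev_mev (ev_anc _ y i v).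
have e2 u v n m : mev (fun x => u <> v /\ tm x u n.+1 = tm x v m.+1).
  by apply: ev_and; [exact: ev_cst|exact: mev_tie].
apply/eqP; rewrite eq_le pr_ge0 andbT.
apply: le_trans (pr_or mu (ev_exists e1) _) _.
  by do 4!apply: ev_exists => ?; exact: e2.
rewrite pr_exists0//; last first.
  move=> v; apply: le_invn0 => [|n]; first exact: pr_ge0.
  have [|N hN] := @delta_to0 R mu L n.+1%:R^-1; first by rewrite invr_gt0 ltr0n.
  apply: le_trans (hN N (leqnn N)); apply: le_trans (pr_alive L N v).
  apply: pr_le => //; apply: ev_exists => i; exact: ev_mev (ev_anc _ N i v).
rewrite add0r pr_exists0// => u; first by do 3!apply: ev_exists => ?; exact: e2.
rewrite pr_exists0// => v; first by do 2!apply: ev_exists => ?; exact: e2.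
rewrite pr_exists0// => n; first by apply: ev_exists => ?; exact: e2.
rewrite pr_exists0// => m.
have [->|/eqP uv] := eqVneq u v.
  by rewrite (@pr_ext _ _ mu _ (fun=> False)) ?pr0// => x; split=> // -[].
rewrite (@pr_ext _ _ mu _ (fun x => tm x u n.+1 = tm x v m.+1)) ?pr_tie// => x.
by split=> [[]|].
Qed.

End almost_surely.

(** * The driving randomness *)

Lemma boundary_even (z : int) : boundary (2 * z, 0).
Proof. by rewrite /boundary /= dvdz_mulr. Qed.

Definition root (z : int) : Root := exist _ (2 * z, 0) (boundary_even z).

Definition unroot (r : Root) : int := ((val r).1 %/ 2)%Z.

Lemma rootK : cancel root unroot.
Proof. by move=> z; rewrite /unroot /= mulKz. Qed.

Lemma unrootK : cancel unroot root.
Proof.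
move=> [[a b] /= ab]; apply: val_inj => /=; rewrite /unroot /=.
by move: ab => /andP[/= /divzK + /eqP ->]; rewrite mulrC => ->.
Qed.

(** * Estimates for the exponential law *)

Section exponential.
Variables (R : realType) (nu : probability R R).
Hypothesis nuE : forall A, measurable A -> nu A = exponential_prob 1 A.

Let nu0c (c : R) : 0 < c -> nu `[0, c]%classic = (1 - expR (- c))%:E.
Proof.
by move=> c0; rewrite nuE// exponential_prob_itv0c// mulN1r EFinB.
Qed.

Let le_expRN (c : R) : 1 - expR (- c) <= c.
Proof. have := expR_ge1Dx (- c); lra. Qed.

Let nuU A B : measurable A -> measurable B -> A `&` B = set0 ->
  nu (A `|` B) = (nu A + nu B)%E.
Proof. exact: measureU. Qed.

(** Everything is read off from the intervals [[0, c]]: the negative half-line misses [[0, c^-1]],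
    so it has mass at most [expR (- c^-1)], and the point 0 lies in [[0, c]], of mass at most
    [c]. *)
Lemma exp_nonpos : nu `]-oo, 0]%classic = 0%E.
Proof.
have fin A : measurable A -> nu A \is a fin_num by move=> mA; exact: fin_num_measure.
have le (c : R) : 0 < c -> fine (nu `]-oo, 0]%classic) <= c + expR (- c^-1).
  move=> c0; have ci : 0 < c^-1 by rewrite invr_gt0.
  have h1 : (nu `]-oo, 0%R[%classic <= (expR (- c^-1))%:E)%E.
    have : (nu (`]-oo, 0%R[%classic `|` `[0%R, c^-1%R]%classic) <= 1)%E by apply: probability_le1; exact: measurableU.
    rewrite nuU//; last first.
      apply/seteqP; split=> z //=; rewrite !in_itv /= => -[z0 /andP[]].
      by rewrite leNgt z0.
    rewrite nu0c// -leeBrDr// -EFinB opprB addrC subrK => h; exact: h.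
  have h2 : (nu `[0%R, c]%classic <= c%:E)%E by rewrite nu0c// lee_fin.
  rewrite -lee_fin fineK ?fin// EFinD addeC.
  apply: le_trans (leeD h1 h2); apply: le_trans (measureU2 _ _ _) => //.
  apply: le_measure; rewrite ?inE//; first exact: measurableU.
  by move=> z /=; rewrite !in_itv /= => z0; have [|z1] := ltP z 0; [left|right;
    rewrite (le_trans z0) ?ltW].
apply/eqP; rewrite eq_le measure_ge0 andbT -[leLHS]fineK ?fin// lee_fin.
rewrite leNgt; apply/negP => a0; set a := fine _ in a0 le.
have a4 : 0 < a / 4 by lra.
have := le _ a4; have : expR (- (a / 4)^-1) <= a / 4.
  rewrite expRN -[leRHS]invrK lef_pV2 ?posrE ?expR_gt0 ?invr_gt0//.
  by have := expR_ge1Dx (a / 4)^-1; lra.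
lra.
Qed.

Lemma exp_tail j : (nu `]j%:R%R, +oo[%classic <= (2^-1 ^+ j)%:E)%E.
Proof.
case: j => [|j]; first by rewrite expr0; exact: probability_le1.
have m1 : measurable (`[0, j.+1%:R] : set R) by [].
have : (nu (`[0%R, j.+1%:R%R]%classic `|` `]j.+1%:R%R, +oo[%classic) <= 1)%E.
  by apply: probability_le1; exact: measurableU.
rewrite nuU//; last first.
  apply/seteqP; split=> z //=; rewrite !in_itv /= andbT => -[/andP[_ z0]].
  by rewrite ltNge z0.
rewrite nu0c ?ltr0n// addeC -leeBrDr// -EFinB opprB addrC subrK => h.
apply: le_trans h _; rewrite lee_fin -[j.+1%:R]mulr1 -mulrN mulrC expRM_natr.
rewrite lerXn2r ?nnegrE ?expR_ge0 ?invr_ge0// expRN lef_pV2 ?posrE ?expR_gt0//.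
by have := expR_ge1Dx (1 : R); lra.
Qed.

Lemma exp_itv (a b : R) : 0 <= a -> a <= b -> (nu `]a, b]%classic <= (b - a)%:E)%E.
Proof.
rewrite le_eqVlt => /predU1P[<-|a0] ab.
  rewrite subr0; move: ab; rewrite le_eqVlt => /predU1P[<-|b0].
    by rewrite set_itvoc0// measure0.
  apply: (@le_trans _ _ (nu `[0, b]%classic)); last by rewrite nu0c// lee_fin.
  apply: le_measure; rewrite ?inE// => z /=; rewrite !in_itv /= => /andP[z0 ->].
  by rewrite ltW.
have b0 : 0 < b by exact: lt_le_trans ab.
have : nu `[0, b]%classic = (nu `[0%R, a]%classic + nu `]a, b]%classic)%E.
  rewrite -nuU//; last first.
    apply/seteqP; split=> z //=; rewrite !in_itv /= => -[/andP[_ z0] /andP[]].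
    by rewrite ltNge z0.
  congr (nu _); apply/seteqP; split=> z /=; rewrite !in_itv /=.
    move=> /andP[z0 zb]; have [za|az] := leP z a; first by left; rewrite z0.
    by right; rewrite zb.
  by move=> [/andP[-> /le_trans]|/andP[az ->]]; [apply|rewrite (ltW (lt_trans a0 az))].
rewrite !nu0c// => e;
  have fab : nu `]a, b]%classic \is a fin_num by exact: fin_num_measure.
move: e; rewrite -(fineK fab) -EFinD => -[] e; rewrite lee_fin.
have : expR (- b) = expR (- a) * expR (- (b - a)) by rewrite -expRD; congr expR; lra.
have : expR (- a) <= 1 by rewrite expR_le1; lra.
have := expR_ge0 (- a); have := le_expRN (b - a); have := expR_gt0 (- (b - a)).
have : expR (- (b - a)) <= 1 by rewrite expR_le1; lra.
move: (expR (- (b - a))) (expR (- a)) (expR (- b)) e => p q r; nra.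
Qed.

End exponential.

Section law.
Variables (R : realType) (d : measure_display) (Omega : measurableType d).
Variable P : probability Omega R.
Variable gap : Root -> nat -> {RV P >-> R}.
Variable coin : Root -> nat -> nat -> {RV P >-> bool}.
Hypothesis hrandom : sidla_randomness gap coin.

Definition driving (omega : Omega) : noise idx R := fun c : idx =>
  match c with
  | inl (u, n) => gap (root u) n omega
  | inr (u, n, k) => (coin (root u) n k omega)%:R
  end.

Lemma measurable_driving : measurable_fun setT driving.
Proof.
apply: measurable_noise => -[[u n]|[[u n] k]] /=; first exact: measurable_funPT.
have -> : (fun w => (coin (root u) n k w)%:R) =
    (fun b : bool => b%:R : R) \o coin (root u) n k by [].
by apply: measurableT_comp => //; exact: measurable_funPT.
Qed.

Definition driving_mfun : {mfun Omega >-> noise idx R} :=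
  mfun_Sub (mem_set measurable_driving).

Definition noise_of : probability (noise idx R) R := distribution P driving_mfun.

Let noise_ofE A : noise_of A = P (driving @^-1` A).
Proof. by []. Qed.

Let idx_root (c : idx) : Root * nat + Root * nat * nat :=
  match c with
  | inl (u, n) => inl (root u, n)
  | inr (u, n, k) => inr (root u, n, k)
  end.

Let root_idx (c : Root * nat + Root * nat * nat) : idx :=
  match c with
  | inl (r, n) => inl (unroot r, n)
  | inr (r, n, k) => inr (unroot r, n, k)
  end.

Let idx_rootK : cancel idx_root root_idx.
Proof. by move=> [[u n]|[[u n] k]] /=; rewrite rootK. Qed.

Lemma noise_of_indep : indep_coords noise_of.
Proof.
move=> s B us mB; rewrite noise_ofE.
pose A c := [set w | B (root_idx c) (driving w (root_idx c))].
have := driving_independent hrandom (J := [seq idx_root c | c <- s]) (A := A).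
rewrite map_inj_uniq ?us; last exact: can_inj idx_rootK.
rewrite big_map => h;
  transitivity (P (\bigcap_(c in [set` [seq idx_root c | c <- s]]) A c)).
  congr (P _); apply/seteqP; split=> w /=.
    by move=> wB c /= /mapP[i si ->]; rewrite /A /= idx_rootK; exact: wB.
  move=> wA c sc; have := wA (idx_root c); rewrite /A /= idx_rootK; apply.
  exact: map_f.
rewrite h//; first by apply: eq_bigr => c _; rewrite /A idx_rootK.
move=> _ /mapP[c _ ->]; case: c => [[u n]|[[u n] k]] /=.
  exists (B (inl (u, n))); first exact: mB.
  by rewrite setTI; apply/seteqP; split=> w; rewrite /A /= rootK.
exists [set b : bool | B (inr (u, n, k)) b%:R] => //.
by rewrite setTI; apply/seteqP; split=> w; rewrite /A /= rootK.
Qed.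

Let gapE u n (A : set R) : measurable A ->
  noise_of [set x | A (x (inl (u, n)))] = distribution P (gap (root u) n) A.
Proof. by []. Qed.

Let coinE u n k (A : set R) :
  noise_of [set x | A (x (inr (u, n, k)))] =
  distribution P (coin (root u) n k) [set b : bool | A b%:R].
Proof. by []. Qed.

Let gap_le0 u n : noise_of [set x | x (inl (u, n)) <= 0] = 0%E.
Proof.
have h := exp_nonpos (fun A => gap_exponential hrandom (root u) n (A := A)).
apply: etrans h; rewrite -[RHS]/(noise_of [set x | `]-oo, 0]%classic (x (inl (u, n)))]).
by congr (noise_of _); apply/seteqP; split=> x /=; rewrite in_itv.
Qed.

(** [gp] differs from the waiting time only where the latter is nonpositive, a null event that can
    be added for free. *)
Let pr_gap u n (Q : noise idx R -> Prop) (A : set R) (c : R) :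
  ev (fun=> True) Q -> measurable A ->
  (forall x, Q x -> 0 < x (inl (u, n)) -> A (x (inl (u, n)))) ->
  (distribution P (gap (root u) n) A <= c%:E)%E -> prob noise_of Q <= c.
Proof.
move=> eQ mA QA; rewrite -gapE// => hc; rewrite -lee_fin -(prE noise_of eQ).
apply: le_trans hc; have m0 : measurable [set x : noise idx R | x (inl (u, n)) <= 0].
  have : ev (fun=> True) (fun x : noise idx R => x (inl (u, n)) <= 0).
    by apply: ev_le; [exact: evf_coord|exact: evf_cst].
  by case.
have mA' : measurable [set x : noise idx R | A (x (inl (u, n)))].
  by have := @measurable_coord idx R (inl (u, n)) measurableT _ mA; rewrite setTI.
apply: (@le_trans _ _ (noise_of ([set x : noise idx R | x (inl (u, n)) <= 0] `|`
    [set x : noise idx R | A (x (inl (u, n)))]))).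
  apply: le_measure; rewrite ?inE; [by case: eQ|exact: measurableU|].
  by move=> x Qx /=; have [|/(QA x Qx)] := leP (x (inl (u, n))) 0; [left|right].
apply: le_trans (measureU2 _ _ _) _ => //.
by rewrite [X in (X + _)%E]gap_le0 add0e.
Qed.

Lemma noise_of_law : noise_law noise_of.
Proof.
have half01 : 0 <= (2^-1 : R) <= 1.
  by apply/andP; split; lra.
split.
- exact: noise_of_indep.
- move=> u n k b; apply: EFin_inj.
  have eC : ev (fun=> True) (fun x : noise idx R => cn x u n k = b) by exact: ev_cn.
  rewrite -(prE _ eC).
  have := coin_fair hrandom (root u) n k [set b].
  rewrite bernoulli_probE// => h;
    transitivity (distribution P (coin (root u) n k) [set b]).
    rewrite [LHS](coinE u n k [set r | (r == 1) = b]); congr (distribution _ _ _).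
    by apply/seteqP; split=> -[] /=; rewrite ?eqxx ?[0 == 1]eq_sym ?oner_eq0.
  rewrite h !diracE; case: b {h eC} => /=.
    by rewrite mem_set// memNset// mule1 mule0 adde0.
  by rewrite memNset// mem_set// mule1 mule0 add0e; congr EFin;
    rewrite -[LHS]/(1 - 2^-1); lra.
- move=> u n a b a0 ab; apply: (@pr_gap u n _ `]a, b]%classic) => //.
  + by apply: ev_and; [apply: ev_lt|apply: ev_le]; try exact: evf_cst; exact: evf_gp.
  + by move=> x; rewrite /gp /= in_itv /= => + x0; rewrite x0 => -[-> ->].
  + exact: (exp_itv (fun A => gap_exponential hrandom (root u) n (A := A))).
- move=> u n [|j]; first by rewrite expr0; apply: pr_le1; apply: ev_lt;
  [exact: evf_cst|exact: evf_gp].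
  apply: (@pr_gap u n _ `]j.+1%:R, +oo[%classic) => //.
  + by apply: ev_lt; [exact: evf_cst|exact: evf_gp].
  + by move=> x; rewrite /gp /= in_itv /= andbT => + x0; rewrite x0.
  + exact: (exp_tail (fun A => gap_exponential hrandom (root u) n (A := A))).
move=> z [[u n]|[[u n] k]] B mB.
  by rewrite [LHS](gapE _ _ mB) [RHS](gapE _ _ mB) !(gap_exponential hrandom).
by rewrite [LHS]coinE [RHS]coinE !(coin_fair hrandom).
Qed.

Lemma gap_gt0_ae : {ae P, forall omega, forall r n, 0 < gap r n omega}.
Proof.
pose F (c : nat) : set Omega := if unpickle c is Some (u, n)
  then driving @^-1` [set x | x (inl (u, n)) <= 0] else set0.
have : P.-negligible (\bigcup_c F c).
  apply: negligible_bigcup => c; rewrite /F; case: unpickle => [[u n]|];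
    last exact: negligible_set0.
  apply/negligibleP; last exact: gap_le0 u n.
  have : ev (fun=> True) (fun x : noise idx R => x (inl (u, n)) <= 0).
    by apply: ev_le; [exact: evf_coord|exact: evf_cst].
  by case=> m _; rewrite -[X in measurable X]setTI; exact: measurable_driving.
apply: negligibleS => w /= /existsNP[r /existsNP[n /negP]]; rewrite -leNgt => le0.
exists (pickle (unroot r, n)) => //; rewrite /F pickleK /=.
by rewrite unrootK.
Qed.

End law.

(** * The trees of the process *)

Definition vtx (y : nat) (i : int) : vertex := (2 * i - y%:Z, y%:Z).

Lemma vtx_inj y y' i i' : vtx y i = vtx y' i' -> y = y' /\ i = i'.
Proof. by rewrite /vtx => -[e1 e2]; split; lia. Qed.

Lemma step_vtx y i b : step b (vtx y i) = vtx y.+1 (i + (b : nat)%:Z).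
Proof. by rewrite /step /vtx /=; case: b; congr pair; lia. Qed.

Lemma val_root r : val r = vtx 0 (unroot r).
Proof. by rewrite -[r in LHS]unrootK /vtx /= subr0. Qed.

Lemma bool_shift_inj (a b : bool) (i : int) :
  i = i - (b : nat)%:Z + (a : nat)%:Z -> a = b.
Proof. by case: a; case: b => //=; lia. Qed.

Section winner.
Variables (R : realType) (x : noise idx R).

(** The particle tries the edge of direction [b] into vertex [i] of level [k + 1]; the coercion of
    [b] to 0 or 1 selects the parent. *)
Definition cross k i (b : bool) v m : Prop :=
  Arr x k (i - (b : nat)%:Z) v m /\ cn x v m k = b.

Lemma cross_inj k i b b' v m : cross k i b v m -> cross k i b' v m -> b = b'.
Proof. by move=> [_ <-] [_ <-]. Qed.

Lemma cross_st k i b v m : cross k i b v m -> exists s, st x k.+1 i = Some s.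
Proof.
move=> [A c]; have [s es _] := Arr_cand A c; rewrite stS /win.
case: b c A es => /= c A es; rewrite ?subr0 in es; rewrite es /=.
  by case: cand => [s2|]; [case: ifP; [exists s|exists s2]|exists s].
by case: cand => [s1|]; [case: ifP => /=; [exists s1|exists s]|exists s].
Qed.

(** The recursion compares the earliest crossing from each parent, so the state is that of a
    crossing which is earliest among all. *)
Lemma st_winner k i s : st x k.+1 i = Some s -> exists u n p b,
  [/\ s = (u, n.+1, rcons p b), cross k i b u n &
   forall b' v m, cross k i b' v m -> tm x u n.+1 <= tm x v m.+1].
Proof.
rewrite stS /win; case: ifPn => w e.
  have [u [n0 [p [n [est se hn]]]]] := candP e.
  have [n' sn [A c min]] := cand_Arr e.
  have [ua nn] : u = anc x k (i - 1) /\ n = n' by move: sn; rewrite se => -[].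
  rewrite -{}ua -{}nn in A c min; exists u, n, p, true; split=> // b' v m [A' c'].
  case: b' A' c' => A' c'; first by have vu := Arr_root A' A; rewrite vu in A' c' *;
    rewrite ler_tm ltnS; exact: min.
  rewrite /= subr0 in A'; have [s2 e2 j2] := Arr_cand A' c'; apply: le_trans j2.
  by move: w; rewrite e e2 /= /join_time se.
have [u [n0 [p [n [est se hn]]]]] := candP e.
have [n' sn [A c min]] := cand_Arr e.
have [ua nn] : u = anc x k i /\ n = n' by move: sn; rewrite se => -[].
rewrite -{}ua -{}nn in A c min; exists u, n, p, false; split=> //; first by split;
  rewrite //= subr0.
move=> b' v m [A' c']; case: b' A' c' => A' c'; last first.
  rewrite /= subr0 in A'.
  by have vu := Arr_root A' A; rewrite vu in A' c' *; rewrite ler_tm ltnS; exact: min.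
have [s2 e2 j2] := Arr_cand A' c'; apply: le_trans j2.
by move: w; rewrite e e2 /= -ltNge /join_time se => /ltW.
Qed.

End winner.

(** * Identification of the process with the recursion *)

Section link.
Variables (R : realType) (x : noise idx R).
Variables (clock : Root -> nat -> R) (dir : Root -> nat -> nat -> bool).
Variable T : Root -> R -> set edge.
Hypothesis clockE : forall r n, clock r n = tm x (unroot r) n.+1.
Hypothesis dirE : forall r n k, dir r n k = cn x (unroot r) n k.
Hypothesis hT : is_sidla clock dir T.
Hypothesis no_tie : forall u v n m, u <> v -> tm x u n.+1 <> tm x v m.+1.

Let tm_ge0 u n : 0 <= tm x u n.
Proof. by rewrite -(tm0 x u) ler_tm. Qed.

Lemma particle_vtx (F : Root -> set edge) r d k w :
  particle_at F r d k w -> exists i, w = vtx k i.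
Proof.
elim=> [|{}k {}w _ [i ->] _ _]; first by exists (unroot r); exact: val_root.
by exists (i + (d k : nat)%:Z); exact: step_vtx.
Qed.

Lemma particle_moveE (F : Root -> set edge) r d k w : particle_at F r d k.+1 w ->
  exists w', [/\ particle_at F r d k w', w = step (d k) w' & F r (w', w)].
Proof.
move=> pk; inversion pk as [|k' w' pk' nu nb]; subst; exists w'; split=> //.
have [v inv] : exists v, in_tree v (F v) (step (d k) w').
  by apply: contrapT => /forallNP no; apply: nu.
have vr : v = r by apply: contrapT => vr; apply: nb; left; exists v.
by rewrite vr in inv; apply: contrapT => nF; apply: nb; right.
Qed.

Lemma tree_edge r t e : 0 <= t -> T r t e -> exists n k i,
  [/\ clock r n <= t,
      particle_at (forest_before T (clock r n)) r (dir r n) k (vtx k i),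
      unoccupied (forest_before T (clock r n)) (step (dir r n k) (vtx k i)) &
      e = (vtx k i, step (dir r n k) (vtx k i))].
Proof.
move=> t0; rewrite (sidla_rule hT)// => -[n /= nt [k [w [pk un ->]]]].
have [i wi] := particle_vtx pk; rewrite wi in pk un *.
by exists n, k, i.
Qed.

Lemma tree_parent r t e : 0 <= t -> T r t e ->
  e.1 = val r \/ exists w, T r t (w, e.1).
Proof.
move=> t0 /(tree_edge t0)[n [[|k] [i [nt pk _ ->]]]] /=.
  by left; inversion pk.
have [w [_ _ [s /= /andP[s0 st] Ts]]] := particle_moveE pk; right; exists w.
by apply: (sidla_mono hT s0 _ Ts); exact: le_trans (ltW st) nt.
Qed.

(** Occupation is reduced to edges leading into the vertex: an edge that leaves it was added by a
    particle which had come through such an edge. *)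
Lemma in_tree_parent r t y i : 0 <= t -> in_tree r (T r t) (vtx y.+1 i) ->
  exists b : bool, T r t (vtx y (i - (b : nat)%:Z), vtx y.+1 i).
Proof.
have edge_in w : 0 <= t -> T r t (w, vtx y.+1 i) ->
    exists b : bool, T r t (vtx y (i - (b : nat)%:Z), vtx y.+1 i).
  move=> t0 Tw; have [n [k [j [_ _ _]]]] := tree_edge t0 Tw.
  rewrite step_vtx => ee; have /= ew := congr1 fst ee.
  have /= /vtx_inj[[yk] ij] := congr1 snd ee; exists (dir r n k).
  by rewrite {1}ij addrK {1}yk -ew.
move=> t0 [|[[a c] Te [|]]] /=.
- by rewrite val_root => /vtx_inj[].
- move=> ea; rewrite -ea in Te; have [/= |[w]] := tree_parent t0 Te.
    by rewrite val_root => /vtx_inj[].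
  exact: edge_in.
- by move=> ec; rewrite -ec in Te; exact: edge_in Te.
Qed.

(* The agreement of the process with [st] on the edges from level [k] to level
   [k + 1]. *)
Definition linked k : Prop := forall r t i (b : bool), 0 <= t ->
  T r t (vtx k (i - (b : nat)%:Z), vtx k.+1 i) <->
  exists n p, st x k.+1 i = Some (unroot r, n.+1, rcons p b) /\
    tm x (unroot r) n.+1 <= t.

Lemma linked_before k r s i (b : bool) : linked k ->
  forest_before T s r (vtx k (i - (b : nat)%:Z), vtx k.+1 i) <->
  exists n p, st x k.+1 i = Some (unroot r, n.+1, rcons p b) /\
    tm x (unroot r) n.+1 < s.
Proof.
move=> lk; split=> [[t /= /andP[t0 ts] /(lk _ _ _ _ t0)[n [p [e nt]]]]|].
  by exists n, p; split=> //; exact: le_lt_trans nt ts.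
move=> [n [p [e ns]]]; exists (tm x (unroot r) n.+1) => /=; first by rewrite tm_ge0.
by apply/lk => //; exists n, p.
Qed.

(** A tree contains only one path to each of its vertices, the one stored in the state. Walking
    along tree edges therefore means that the first coins spell this path at a ring after the one at
    which the vertex joined. *)
Lemma particle_Arr k : (forall j, (j < k)%N -> linked j) -> forall r n i,
  particle_at (forest_before T (clock r n)) r (dir r n) k (vtx k i) <->
  Arr x k i (unroot r) n.
Proof.
elim: k => [_|k IH lk] r n i.
  split=> [pk|[n0 [p [[ir _ _] _ _]]]].
    have /vtx_inj[_ ->] : vtx 0 i = vtx 0 (unroot r) by rewrite -val_root; inversion pk.
    by exists 0%N, [::].
  by rewrite ir -val_root; exact: particle_start.
have {}IH := IH (fun j jk => lk j (leqW jk)); have lkk := lk k (ltnSn k).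
have parent b : i - (b : nat)%:Z + (b : nat)%:Z = i by lia.
split.
  move=> /particle_moveE[w [pk e Fe]]; have [j wj] := particle_vtx pk.
  rewrite {}wj in pk e Fe; move: e; rewrite step_vtx => /vtx_inj[_ ij].
  have ji : j = i - (dir r n k : nat)%:Z by rewrite ij addrK.
  rewrite ji in pk Fe; have [m [p [est lt]]] := (linked_before _ _ _ _ lkk).1 Fe.
  have mn : (m < n)%N by move: lt; rewrite clockE ltr_tm.
  have [n0 [q [eq n0n hq]]] := (IH _ _ _).1 pk.
  exists m.+1, (rcons p (dir r n k)); split=> //.
  have [u [n1 [p1 [b [[_ _ pb] [[n2 [q2 [e2 _ h2]]] cb] _]]]]] := st_winner est.
  have [pp bb] := rcons_inj pb; rewrite -{}bb in cb e2 pb.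
  have := est; rewrite stS; case: ifPn => _ /candP[v [n3 [p3 [n4 [e3 [_ _ e4] _]]]]].
    have [p3p dt] := rcons_inj e4; move: eq.
    rewrite dt [st _ _ _]e3 => -[_ _ p3q]; rewrite hits_rcons p3p p3q hq.
    by rewrite -p3q (st_size e3) -dirE dt eqxx.
  have [p3p dt] := rcons_inj e4; move: eq.
  rewrite dt /= subr0 e3 => -[_ _ p3q]; rewrite hits_rcons p3p p3q hq.
  by rewrite -p3q (st_size e3) -dirE dt eqxx.
move=> [n0 [q [est n0n hq]]].
have [u [m [p [b [[ue ne qe] [A cb] _]]]]] := st_winner est.
rewrite -{}ue in A cb; rewrite {}ne in n0n est; rewrite {}qe in hq est.
have {A}[n2 [p2 [e2 n2m h2]]] := A.
have pp : p2 = p.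
  have := est; rewrite stS; case: ifPn => _ /candP[v [n3 [p3 [n4 [e3 [_ _ e4] _]]]]].
    have [p3p bt] := rcons_inj e4; move: e2.
    by rewrite bt [st _ _ _]e3 -p3p => -[_ _ ->].
  have [p3p bt] := rcons_inj e4; move: e2.
  by rewrite bt /= subr0 e3 -p3p => -[_ _ ->].
have [hp cn_] : hits x (unroot r) p n /\ cn x (unroot r) n k = b.
  by move: hq; rewrite hits_rcons -pp (st_size e2) => /andP[? /eqP].
have pk : particle_at (forest_before T (clock r n)) r (dir r n) k (vtx k (i - (b : nat)%:Z)).
  by apply/IH; exists n2, p; split; [rewrite -pp|lia|].
have sE : step (dir r n k) (vtx k (i - (b : nat)%:Z)) = vtx k.+1 i.
  by rewrite dirE cn_ step_vtx parent.
have Fe : forest_before T (clock r n) r (vtx k (i - (b : nat)%:Z), vtx k.+1 i).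
  by apply/linked_before => //; exists m, p; split=> //; rewrite clockE ltr_tm.
have inr : in_tree r (forest_before T (clock r n) r) (vtx k.+1 i).
  by right; exists (vtx k (i - (b : nat)%:Z), vtx k.+1 i) => //; right.
rewrite -sE; apply: particle_move => //; rewrite sE; first by move=> /(_ r).
move=> [[v vr inv]|[]//].
have [b' Fv] : exists b' : bool, forest_before T (clock r n) v (vtx k (i - (b' : nat)%:Z), vtx k.+1 i).
  case: inv => [|[e [s /= /andP[s0 sn] Te] ae]]; first by rewrite val_root => /vtx_inj[].
  have [|b' Tb] := @in_tree_parent v s k i s0; first by right; exists e.
  by exists b'; exists s => //=; rewrite s0.
have [n' [p' [est' _]]] := (linked_before _ _ _ _ lkk).1 Fv.
by apply: vr; apply: (can_inj unrootK); move: est'; rewrite est => -[].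
Qed.

Lemma edge_cross k : (forall j, (j < k)%N -> linked j) -> forall r t i (b : bool), 0 <= t ->
  T r t (vtx k (i - (b : nat)%:Z), vtx k.+1 i) <->
  exists n, [/\ tm x (unroot r) n.+1 <= t, cross x k i b (unroot r) n &
    unoccupied (forest_before T (tm x (unroot r) n.+1)) (vtx k.+1 i)].
Proof.
move=> lk r t i b t0; split.
  move=> /(tree_edge t0)[n [k' [j [nt pk un ee]]]].
  have /= e := congr1 snd ee; have /= /vtx_inj[kk ji] := congr1 fst ee.
  rewrite -{}kk -{}ji {ee} in pk un e.
  rewrite clockE in nt un; exists n; split=> //; last by rewrite e.
  split; first exact/particle_Arr.
  by move: e; rewrite step_vtx => /vtx_inj[_]; rewrite dirE; exact: bool_shift_inj.
move=> [n [nt [A cb] un]].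
have sE : step (dir r n k) (vtx k (i - (b : nat)%:Z)) = vtx k.+1 i.
  by rewrite dirE cb step_vtx subrK.
rewrite (sidla_rule hT)//; exists n; first by rewrite /= clockE.
exists k, (vtx k (i - (b : nat)%:Z)); rewrite sE; split=> //; first exact/particle_Arr.
by rewrite clockE.
Qed.

(** Whatever occupies the vertex has crossed into it earlier, so the earliest crossing finds it free
    and adds its edge; any strictly later crossing then finds it occupied. *)
Lemma all_linked k : linked k.
Proof.
elim/ltn_ind: k => k lk r t i b t0.
have edge := edge_cross lk.
have occupied s v : in_tree v (forest_before T s v) (vtx k.+1 i) ->
    exists (b' : bool) n, cross x k i b' (unroot v) n /\ tm x (unroot v) n.+1 < s.
  move=> [|[e [s' /= /andP[s0 ss] Te] ae]]; first by rewrite val_root => /vtx_inj[].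
  have [|b' Tb] := @in_tree_parent v s' k i s0; first by right; exists e.
  have [n [ns c _]] := (edge v s' i b' s0).1 Tb.
  by exists b', n; split=> //; exact: le_lt_trans ns ss.
have first u n : (forall b' v m, cross x k i b' v m -> tm x u n.+1 <= tm x v m.+1) ->
    unoccupied (forest_before T (tm x u n.+1)) (vtx k.+1 i).
  by move=> min v /occupied[b' [m [/min le]]]; rewrite ltNge le.
rewrite edge//; split.
  move=> [n [nt c un]]; have [s es] := cross_st c.
  have [u [m [p [b' [se c' min]]]]] := st_winner es.
  have eq : tm x u m.+1 = tm x (unroot r) n.+1.
    apply/eqP; rewrite eq_le (min _ _ _ c)/= leNgt; apply/negP => lt.
    apply: (un (root u)); right.
    exists (vtx k (i - (b' : nat)%:Z), vtx k.+1 i); last by right.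
    exists (tm x u m.+1) => /=; first by rewrite tm_ge0.
    apply/edge; first exact: tm_ge0.
    by exists m; rewrite rootK; split=> //; exact: first.
  (* Trees are taken strictly before a ring, so simultaneous particles of two roots could both find
     the vertex free; this is where ties are excluded. *)
  have ur : u = unroot r by apply: contrapT => /(@no_tie _ _ m n).
  have mn : m = n.
    by apply/eqP; rewrite -eqSS eqn_leq -!(ler_tm x u) eq ur !lexx.
  rewrite ur mn in c' se *; have bb := cross_inj c c'.
  by exists n, p; rewrite es se bb.
move=> [n [p [es nt]]]; have [u [m [q [b' [[ue me pe] c min]]]]] := st_winner es.
have [_ bb] := rcons_inj pe; rewrite -ue -me -bb in c min.
by exists n; split=> //; exact: first.
Qed.

Lemma limit_tree_finite r : (exists y, forall i, anc x y i <> unroot r) ->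
  finite_set (limit_tree T r).
Proof.
move=> [Y dead].
have deadS y : (Y <= y)%N -> forall i, anc x y i <> unroot r.
  move=> /subnK <-; elim: (y - Y)%N => [//|m IH] i; rewrite addSn /=.
  by case: ifP => _; exact: IH.
(* The tree ends below level [Y], and [anc_bound] confines its vertices to offsets 0, ..., [Y] from
   the root; the box of such edges is finite. *)
pose f (c : 'I_Y * 'I_Y.+1 * bool) : edge :=
  (vtx c.1.1 (unroot r + (c.1.2 : nat)%:Z - (c.2 : nat)%:Z),
   vtx c.1.1.+1 (unroot r + (c.1.2 : nat)%:Z)).
apply: (@sub_finite_set _ _ (f @` setT)); last exact/finite_image/finite_finset.
move=> e [t /= t0 Te]; have [n [k [j [_ _ _ ee]]]] := tree_edge t0 Te.
rewrite step_vtx in ee; set b := dir r n k in ee; set i := j + _ in ee.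
have ji : j = i - (b : nat)%:Z by rewrite /i addrK.
rewrite ee ji in Te; have [m [p [es _]]] := (all_linked k r i b t0).1 Te.
have ai := st_anc es; have kY : (k < Y)%N.
  by rewrite ltnNge; apply/negP => Yk; exact: (deadS k.+1 (leqW Yk) i).
have bd := anc_bound x k.+1 i; rewrite ai in bd.
have [l il lY] : exists2 l : nat, i = unroot r + l%:Z & (l < Y.+1)%N.
  exists (absz (i - unroot r)); first by rewrite gez0_abs ?subr_ge0; lia.
  by lia.
exists (Ordinal kY, Ordinal lY, b) => //; rewrite /f /= -il -ji ee.
by [].
Qed.

End link.

Theorem theorem1p2 (R : realType) (d : measure_display)
    (Omega : measurableType d) (P : probability Omega R)
    (gap : Root -> nat -> {RV P >-> R})
    (coin : Root -> nat -> nat -> {RV P >-> bool})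
    (T : Omega -> Root -> R -> set edge)
    (hrandom : sidla_randomness gap coin)
    (hT : {ae P, forall omega, is_sidla (ring_time gap omega)
                   (fun u n k => coin u n k omega) (T omega)}) :
  {ae P, forall omega, forall v : Root, finite_set (limit_tree (T omega) v)}.
Proof.
(* [bad] is an event of the driving noise, so its preimage in [Omega] is measurable and null; off
   it, the tree structure of [T omega] is determined pathwise. *)
have hbad : {ae P, forall omega, ~ bad (driving gap coin omega)}.
  have L := noise_of_law hrandom.
  have eb := mev_bad R.
  have : (noise_of gap coin).-negligible [set x | bad x].
    by apply/negligibleP; [exact: eb.1|apply: etrans (prE _ eb) _; rewrite pr_bad].
  move=> /negligibleP h;
    apply: negligibleS (_ : _ `<=` driving gap coin @^-1` [set x | bad x]) _.
    by move=> w /= /contrapT.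
  apply/negligibleP; last by apply: h; exact: eb.1.
  by rewrite -[X in measurable X]setTI; apply: measurable_driving => //; exact: eb.1.
have hgap := gap_gt0_ae hrandom.
move: hT hbad hgap; apply: filterS3 => w sid nbad gap0 r.
have tmE v n : tm (driving gap coin w) v n = \sum_(i < n) gap (root v) i w.
  by apply: eq_bigr => i _; rewrite /gp /= gap0.
apply: (limit_tree_finite (x := driving gap coin w) _ _ sid).
- by move=> s n; rewrite tmE unrootK.
- move=> s n k; rewrite /cn /= unrootK.
  by case: (coin s n k w); rewrite ?eqxx// eq_sym oner_eq0.
- by move=> u v n m uv e; apply: nbad; right; exists u, v, n, m.
apply: contrapT => alive; apply: nbad; left; exists (unroot r) => y.
apply: contrapT => dead; apply: alive; exists y => i e; apply: dead; by exists i.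
Qed.
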